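(* Let $\mathcal{V}$ be a variety of groups defined by a set of laws $V$, and let $\{(G_i,M_i,N_i)\}_{i\in I}$ be a directed system of triples of groups. Then $$\mathcal{V}M(\varinjlim G_i,\varinjlim M_i,\varinjlim N_i)\cong \varinjlim \mathcal{V} M(G_i,M_i,N_i).$$
   Context: A triple of groups $(G,M,N)$ is a group $G$ with two normal subgroups $M,N$; a homomorphism of triples $(G_1,M_1,N_1)\to(G_2,M_2,N_2)$ is a group homomorphism $G_1\to G_2$ sending $M_1$ into $M_2$ and $N_1$ into $N_2$. A directed system of triples is a system of triples and homomorphisms of triples indexed by a directed set $I$. $V(G)$ is the verbal subgroup of $G$ for the laws $V$; for a simplicial group $K_.$, $V(K_.)$ is formed degreewise. A simplicial group $K_.$ is free if each $K_n$ is a free group with a basis such that all degeneracies send the basis of $K_n$ into the basis of $K_{n+1}$. A free simplicial resolution of $G$ is a free simplicial group $K_.$ with $\pi_0(K_.)=G$ and $\pi_n(K_.)=0$ for $n\ge1$. Baer invariant of a triple $(G,M,N)$: take free simplicial resolutions $K_.,L_.,R_.,S_.$ of $G$, $G/N$, $G/M$, $G/MN$, respectively, and a commutative square of simplicial homomorphisms $\alpha:K_.\to L_.$, $\beta:K_.\to R_.$, $\gamma:R_.\to S_.$, $\delta:L_.\to S_.$ (with $\gamma\beta=\delta\alpha$) inducing the natural projections on $\pi_0$, such that the induced maps $\alpha_V,\beta_V,\gamma_V,\delta_V$ between the quotients $K_./V(K_.)$, $L_./V(L_.)$, $R_./V(R_.)$, $S_./V(S_.)$ are surjective, and the induced maps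 $\ker\alpha_V\to\ker\gamma_V$ and $\ker\beta_V\to\ker\delta_V$ are surjective. Let $\ker(\alpha_V,\gamma_V)$ denote the kernel of $\ker\alpha_V\to\ker\gamma_V$ (equivalently of $\ker\beta_V\to\ker\delta_V$). Then $\mathcal{V}M(G,M,N):=\pi_1(\ker(\alpha_V,\gamma_V))$; it is functorial in $(G,M,N)$. *)

(* Defs.v *)
From HB Require Import structures.
From mathcomp Require Import ssreflect ssrfun ssrbool eqtype choice ssrnat seq.
From mathcomp Require Import fintype bigop monoid generic_quotient order.
From mathcomp Require Import boolp classical_sets.

Set Implicit Arguments.
Unset Strict Implicit.
Unset Printing Implicit Defensive.

Import Order.Theory.

Local Open Scope classical_set_scope.
Local Open Scope group_scope.
Local Open Scope quotient_scope.

Notation "{ 'hom' G -> H }" := (UMagmaMorphism.type G H)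
  (at level 0, G at level 98, H at level 99, format "{ 'hom'  G  ->  H }") : type_scope.

Section HomOf.
Variables (G H : groupType) (f : G -> H).
Hypothesis fM : {morph f : x y / x * y}.

Lemma hom_of1 : f 1 = 1.
Proof. by apply: (mulgI (f 1)); rewrite -fM !mulg1. Qed.

Definition hom_of : {hom G -> H} :=
  HB.pack f (isUMagmaMorphism.Build G H f (hom_of1, fM)).

End HomOf.

Definition isomorphic (G H : groupType) : Prop :=
  exists f : {hom G -> H}, bijective f.

Record subgroup (G : groupType) := Subgroup {
  subgroup_set :> G -> Prop;
  subgroup1 : subgroup_set 1;
  subgroupM : forall x y, subgroup_set x -> subgroup_set y -> subgroup_set (x * y);
  subgroupV : forall x, subgroup_set x -> subgroup_set x^-1
}.

Record normal_subgroup (G : groupType) := NormalSubgroup {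
  normal_subgroup_set :> subgroup G;
  normal_subgroupJ :
    forall x y, normal_subgroup_set x -> normal_subgroup_set (x ^ y)
}.

Section SubgroupType.
Variables (G : groupType) (A : subgroup G).

Record subgroup_type := SubgroupElt {
  subgroup_val :> G;
  subgroup_valP : subgroup_val \in (subgroup_set A : set G)
}.

HB.instance Definition _ := [isSub for subgroup_val].
HB.instance Definition _ := [Choice of subgroup_type by <:].

Lemma subgroup_group_closed : group_closed (mem (subgroup_set A : set G)).
Proof.
split; first by apply/mem_set/subgroup1.
move=> x y /set_mem Ax /set_mem Ay; apply/mem_set/subgroupM => //.
exact: subgroupV.
Qed.

HB.instance Definition _ :=
  SubChoice_isSubGroup.Build G _ subgroup_type subgroup_group_closed.

Definition in_subgroup (x : G) (Ax : A x) : subgroup_type := SubgroupElt (mem_set Ax).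

Lemma subgroup_typeP (x : subgroup_type) : A (val x).
Proof. exact: set_mem (valP x). Qed.

End SubgroupType.

Section RestrictedHom.
Variables (G H : groupType) (A : subgroup G) (B : subgroup H).
Variables (f : {hom G -> H}) (fAB : forall x, A x -> B (f x)).

Definition restr_fun (x : subgroup_type A) : subgroup_type B :=
  in_subgroup (fAB (subgroup_typeP x)).

Lemma restr_funM : {morph restr_fun : x y / x * y}.
Proof. by move=> x y; apply: val_inj; rewrite /= gmulfM. Qed.

Definition restr_hom : {hom subgroup_type A -> subgroup_type B} :=
  hom_of restr_funM.

End RestrictedHom.

Section Kernel.
Variables (G H : groupType) (f : {hom G -> H}).

Definition ker_set : set G := [set x | f x = 1].

Lemma ker_set1 : ker_set 1. Proof. exact: gmulf1. Qed.

Lemma ker_setM x y : ker_set x -> ker_set y -> ker_set (x * y).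
Proof. by rewrite /ker_set /= gmulfM => -> ->; rewrite mulg1. Qed.

Lemma ker_setV x : ker_set x -> ker_set x^-1.
Proof. by rewrite /ker_set /= gmulfV => ->; rewrite invg1. Qed.

Definition ker : subgroup G := Subgroup ker_set1 ker_setM ker_setV.

End Kernel.

Section Preimage.
Variables (G H : groupType) (f : {hom G -> H}) (N : normal_subgroup H).

Definition preim_set : set G := [set x | N (f x)].

Lemma preim_set1 : preim_set 1.
Proof. by rewrite /preim_set /= gmulf1; apply: subgroup1. Qed.

Lemma preim_setM x y : preim_set x -> preim_set y -> preim_set (x * y).
Proof. by rewrite /preim_set /= gmulfM; apply: subgroupM. Qed.

Lemma preim_setV x : preim_set x -> preim_set x^-1.
Proof. by rewrite /preim_set /= gmulfV; apply: subgroupV. Qed.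

Lemma preim_setJ x y : preim_set x -> preim_set (x ^ y).
Proof. by rewrite /preim_set /= gmulfJ; apply: normal_subgroupJ. Qed.

Definition preim_normal : normal_subgroup G :=
  @NormalSubgroup G (Subgroup preim_set1 preim_setM preim_setV) preim_setJ.

End Preimage.

Section ProductOfNormalSubgroups.
Variables (G : groupType) (M N : normal_subgroup G).

Definition prod_set : set G :=
  [set x | exists m n, [/\ M m, N n & x = m * n]].

Lemma prod_set1 : prod_set 1.
Proof. by exists 1, 1; rewrite mulg1; split=> //; apply: subgroup1. Qed.

Lemma prod_setM x y : prod_set x -> prod_set y -> prod_set (x * y).
Proof.
move=> [m [n [Mm Nn ->]]] [m' [n' [Mm' Nn' ->]]].
exists (m * m'), (n ^ m' * n'); split.
- exact: subgroupM.
- by apply: subgroupM => //; apply: normal_subgroupJ.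
- by rewrite /conjg !mulgA !(mulgK, mulgVK).
Qed.

Lemma prod_setV x : prod_set x -> prod_set x^-1.
Proof.
move=> [m [n [Mm Nn ->]]]; exists m^-1, (n^-1 ^ m^-1); split.
- exact: subgroupV.
- by apply: normal_subgroupJ; apply: subgroupV.
- by rewrite /conjg invgK invgM !mulgA mulVg mul1g.
Qed.

Lemma prod_setJ x y : prod_set x -> prod_set (x ^ y).
Proof.
move=> [m [n [Mm Nn ->]]]; exists (m ^ y), (n ^ y).
by rewrite conjMg; split=> //; apply: normal_subgroupJ.
Qed.

Definition prod_normal : normal_subgroup G :=
  @NormalSubgroup G (Subgroup prod_set1 prod_setM prod_setV) prod_setJ.

End ProductOfNormalSubgroups.

Section QuotientGroup.
Variables (G : groupType) (N : normal_subgroup G).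

Definition quotient_rel : rel G := fun x y => `[< N (x^-1 * y) >].

Lemma quotient_rel_equiv : equiv_class_of quotient_rel.
Proof.
split.
- by move=> x; apply/asboolP; rewrite mulVg; apply: subgroup1.
- move=> x y; apply/asboolP/asboolP => /subgroupV; by rewrite invgM invgK.
- move=> y x z /asboolP Nxy /asboolP Nyz; apply/asboolP.
  by have := subgroupM Nxy Nyz; rewrite mulgA mulgK.
Qed.

Canonical quotient_equiv := EquivRelPack quotient_rel_equiv.

Definition quotient := {eq_quot quotient_equiv}.

HB.instance Definition _ := Choice.on quotient.
HB.instance Definition _ := EqQuotient.on quotient.

Definition coset (x : G) : quotient := \pi_quotient x.
Definition coset_repr (x : quotient) : G := repr x.

Lemma coset_reprK : cancel coset_repr coset.
Proof. by move=> x; apply: reprK. Qed.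

Lemma cosetP x y : N (x^-1 * y) <-> coset x = coset y.
Proof.
by split=> [Nxy|/eqmodP/asboolP //]; apply/eqmodP/asboolP.
Qed.

Definition quotient_mul (x y : quotient) : quotient :=
  coset (coset_repr x * coset_repr y).
Definition quotient_inv (x : quotient) : quotient := coset (coset_repr x)^-1.

Lemma quotient_mulE x y : quotient_mul (coset x) (coset y) = coset (x * y).
Proof.
have Nr z : N ((coset_repr (coset z))^-1 * z) by apply/cosetP/coset_reprK.
apply/cosetP.
have := subgroupM (Nr y) (normal_subgroupJ y (Nr x)).
by rewrite /conjg invgM !mulgA mulgK.
Qed.

Lemma quotient_invE x : quotient_inv (coset x) = coset x^-1.
Proof.
have Nr : N (x^-1 * coset_repr (coset x)).
  by apply/cosetP; rewrite coset_reprK.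
apply/cosetP; rewrite invgK.
by have := normal_subgroupJ x^-1 Nr; rewrite /conjg invgK !mulgA mulgV mul1g.
Qed.

Lemma quotient_mulA : associative quotient_mul.
Proof.
move=> x y z; rewrite -(coset_reprK x) -(coset_reprK y) -(coset_reprK z).
by rewrite !quotient_mulE mulgA.
Qed.

Lemma quotient_mul1 : left_id (coset 1) quotient_mul.
Proof. by move=> x; rewrite -(coset_reprK x) quotient_mulE mul1g. Qed.

Lemma quotient_mulr1 : right_id (coset 1) quotient_mul.
Proof. by move=> x; rewrite -(coset_reprK x) quotient_mulE mulg1. Qed.

Lemma quotient_mulV : left_inverse (coset 1) quotient_inv quotient_mul.
Proof.
by move=> x; rewrite -(coset_reprK x) quotient_invE quotient_mulE mulVg.
Qed.

Lemma quotient_mulrV : right_inverse (coset 1) quotient_inv quotient_mul.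
Proof.
by move=> x; rewrite -(coset_reprK x) quotient_invE quotient_mulE mulgV.
Qed.

HB.instance Definition _ := isGroup.Build quotient quotient_mulA
  quotient_mul1 quotient_mulr1 quotient_mulV quotient_mulrV.

Lemma cosetM : {morph coset : x y / x * y}.
Proof. by move=> x y; rewrite -quotient_mulE. Qed.

Definition quotient_proj : {hom G -> quotient} := hom_of cosetM.

End QuotientGroup.

Section QuotientHom.
Variables (G H : groupType) (N : normal_subgroup G) (N' : normal_subgroup H).
Variables (f : {hom G -> H}) (fN : forall x, N x -> N' (f x)).

Definition quotient_fun (x : quotient N) : quotient N' :=
  coset N' (f (coset_repr x)).

Lemma quotient_funE x : quotient_fun (coset N x) = coset N' (f x).
Proof.
apply/cosetP; rewrite -gmulfV -gmulfM; apply: fN.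
by apply/cosetP; rewrite coset_reprK.
Qed.

Lemma quotient_funM : {morph quotient_fun : x y / x * y}.
Proof.
move=> x y; rewrite -(coset_reprK x) -(coset_reprK y).
by rewrite -cosetM !quotient_funE gmulfM cosetM.
Qed.

Definition quotient_hom : {hom quotient N -> quotient N'} :=
  hom_of quotient_funM.

End QuotientHom.

(* A word in the letters x_0, x_1, ... and their inverses: [(i, false)] stands
   for x_i and [(i, true)] for its inverse. *)
Definition word := seq (nat * bool).
Definition laws := set word.

Definition word_eval (G : groupType) (e : nat -> G) (w : word) : G :=
  \prod_(l <- w) (if l.2 then (e l.1)^-1 else e l.1).

Section Verbal.
Variables (V : laws) (G : groupType).

Definition verbal_set : set G := [set x | forall A : subgroup G,
  (forall w (e : nat -> G), V w -> A (word_eval e w)) -> A x].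

Lemma verbal_set1 : verbal_set 1.
Proof. by move=> A _; apply: subgroup1. Qed.

Lemma verbal_setM x y : verbal_set x -> verbal_set y -> verbal_set (x * y).
Proof. by move=> Vx Vy A VA; apply: subgroupM; [apply: Vx|apply: Vy]. Qed.

Lemma verbal_setV x : verbal_set x -> verbal_set x^-1.
Proof. by move=> Vx A VA; apply: subgroupV; apply: Vx. Qed.

End Verbal.

Lemma word_eval_hom (G H : groupType) (f : {hom G -> H}) e w :
  f (word_eval e w) = word_eval (f \o e) w.
Proof.
rewrite /word_eval gmulf_prod; apply: eq_bigr => l _.
by case: l.2; rewrite //= gmulfV.
Qed.

Section VerbalHom.
Variables (V : laws) (G H : groupType) (f : {hom G -> H}).

Lemma verbal_set_hom x : verbal_set V x -> verbal_set V (f x).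
Proof.
move=> Vx A VA.
have p1 : [set x | A (f x)] 1 by rewrite /= gmulf1; apply: subgroup1.
have pM y z : [set x | A (f x)] y -> [set x | A (f x)] z ->
    [set x | A (f x)] (y * z).
  by rewrite /= gmulfM; apply: subgroupM.
have pV y : [set x | A (f x)] y -> [set x | A (f x)] y^-1.
  by rewrite /= gmulfV; apply: subgroupV.
apply: (Vx (Subgroup p1 pM pV)) => w e Vw /=.
by rewrite word_eval_hom; apply: VA.
Qed.

End VerbalHom.

Section VerbalNormal.
Variables (V : laws) (G : groupType).

Lemma verbal_setJ (x y : G) : verbal_set V x -> verbal_set V (x ^ y).
Proof.
have cM : {morph (fun x => x ^ y) : a b / a * b} by move=> a b; rewrite conjMg.
exact: (verbal_set_hom (hom_of cM)).
Qed.

Definition verbal : normal_subgroup G := @NormalSubgroup G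
  (Subgroup (@verbal_set1 V G) (@verbal_setM V G) (@verbal_setV V G)) verbal_setJ.

End VerbalNormal.

Lemma verbal_hom V (G H : groupType) (f : {hom G -> H}) x :
  verbal V G x -> verbal V H (f x).
Proof. exact: verbal_set_hom. Qed.

Definition is_basis (F : groupType) (B : set F) : Prop :=
  forall (H : groupType) (g : F -> H),
    (exists f : {hom F -> H}, forall b, B b -> f b = g b) /\
    (forall f f' : {hom F -> H},
      (forall b, B b -> f b = g b) -> (forall b, B b -> f' b = g b) -> f =1 f').

(* [incr i] is i + 1 and [keep i] is i, as an index in the next range up. *)
Definition incr n (i : 'I_n) : 'I_n.+1 := lift ord0 i.
Definition keep n (i : 'I_n) : 'I_n.+1 := widen_ord (leqnSn n) i.

Record sgroup := SGroup {
  sgroup_deg :> nat -> groupType;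
  face : forall n, 'I_n.+2 -> {hom sgroup_deg n.+1 -> sgroup_deg n};
  degen : forall n, 'I_n.+1 -> {hom sgroup_deg n -> sgroup_deg n.+1};
  face_face : forall n (i j : 'I_n.+2) x, i <= j ->
    face i (face (incr j) x) = face j (face (keep i) x);
  degen_degen : forall n (i j : 'I_n.+1) x, i <= j ->
    degen (keep i) (degen j x) = degen (incr j) (degen i x);
  face_degen_lt : forall n (i : 'I_n.+2) (j : 'I_n.+1) x, i <= j ->
    face (keep i) (degen (incr j) x) = degen j (face i x);
  face_degen_eq : forall n (j : 'I_n.+1) x, face (keep j) (degen j x) = x;
  face_degen_succ : forall n (j : 'I_n.+1) x, face (incr j) (degen j x) = x;
  face_degen_gt : forall n (i : 'I_n.+2) (j : 'I_n.+1) x, j < i ->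
    face (incr i) (degen (keep j) x) = degen j (face i x)
}.

Arguments face {_ n} i.
Arguments degen {_ n} i.

Record shom (K L : sgroup) := SHom {
  shom_deg :> forall n, {hom K n -> L n};
  shom_face : forall n (i : 'I_n.+2) x,
    shom_deg n (face i x) = face i (shom_deg n.+1 x);
  shom_degen : forall n (i : 'I_n.+1) x,
    shom_deg n.+1 (degen i x) = degen i (shom_deg n x)
}.

Definition degreewise_surjective (K L : sgroup) (f : shom K L) : Prop :=
  forall n (y : L n), exists x, f n x = y.

Definition sgroup_free (K : sgroup) : Prop :=
  exists B : forall n, set (K n),
    (forall n, is_basis (B n)) /\
    (forall n (i : 'I_n.+1) x, B n x -> B n.+1 (degen i x)).

(* Homotopy groups as the homology of the Moore complex: the n-simplices all of
   whose faces are trivial, modulo the last faces of the (n+1)-simplices whose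
   other faces are trivial. *)
Section Homotopy.
Variables (K : sgroup) (n : nat).

Definition cycle_set : set (K n) :=
  match n return set (K n) with
  | 0 => setT
  | m.+1 => [set x | forall i : 'I_m.+2, face i x = 1]
  end.

Definition boundary_set : set (K n) := [set x | exists y : K n.+1,
  (forall i : 'I_n.+2, i != ord_max -> face i y = 1) /\ face ord_max y = x].

Lemma cycle_set1 : cycle_set 1.
Proof. by rewrite /cycle_set; case: n => // m i; apply: gmulf1. Qed.

Lemma cycle_setM x y : cycle_set x -> cycle_set y -> cycle_set (x * y).
Proof.
rewrite /cycle_set; case: n x y => // m x y /= Zx Zy i.
by rewrite gmulfM Zx Zy mulg1.
Qed.

Lemma cycle_setV x : cycle_set x -> cycle_set x^-1.
Proof.
rewrite /cycle_set; case: n x => // m x /= Zx i.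
by rewrite gmulfV Zx invg1.
Qed.

Definition cycles : subgroup (K n) := Subgroup cycle_set1 cycle_setM cycle_setV.

Lemma boundary_set1 : boundary_set 1.
Proof. by exists 1; split=> [i _|]; apply: gmulf1. Qed.

Lemma boundary_setM x y : boundary_set x -> boundary_set y -> boundary_set (x * y).
Proof.
move=> [a [da <-]] [b [db <-]]; exists (a * b); split; last exact: gmulfM.
by move=> i ni; rewrite gmulfM da // db // mulg1.
Qed.

Lemma boundary_setV x : boundary_set x -> boundary_set x^-1.
Proof.
move=> [a [da <-]]; exists a^-1; split; last exact: gmulfV.
by move=> i ni; rewrite gmulfV da // invg1.
Qed.

Lemma boundary_setJ x y : boundary_set x -> boundary_set (x ^ y).
Proof.
move=> [a [da <-]]; exists (a ^ degen ord_max y); split.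
  by move=> i ni; rewrite gmulfJ da // conj1g.
rewrite gmulfJ; congr (_ ^ _).
have -> : ord_max = incr (ord_max : 'I_n.+1) by apply: val_inj.
exact: face_degen_succ.
Qed.

Definition boundaries : normal_subgroup (K n) := @NormalSubgroup (K n)
  (Subgroup boundary_set1 boundary_setM boundary_setV) boundary_setJ.

Definition cycle_incl : {hom subgroup_type cycles -> K n} :=
  hom_of (fun x y : subgroup_type cycles => valM x y).

Definition homotopy_group : groupType := quotient (preim_normal cycle_incl boundaries).

End Homotopy.

Section HomotopyHom.
Variables (K L : sgroup) (f : shom K L) (n : nat).

Lemma cycle_set_hom x : cycles K n x -> cycles L n (f n x).
Proof.
rewrite /= /cycle_set; case: n x => // m x /= Zx i.
by rewrite -shom_face Zx gmulf1.
Qed.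

Lemma boundary_set_hom x : boundaries K n x -> boundaries L n (f n x).
Proof.
move=> [a [da <-]]; exists (f n.+1 a); split; last by rewrite shom_face.
by move=> i ni; rewrite -shom_face da // gmulf1.
Qed.

Definition homotopy_hom : {hom homotopy_group K n -> homotopy_group L n} :=
  @quotient_hom _ _ (preim_normal (cycle_incl K n) (boundaries K n))
    (preim_normal (cycle_incl L n) (boundaries L n)) (restr_hom cycle_set_hom)
    (fun x => @boundary_set_hom (val x)).

End HomotopyHom.

Section VerbalQuotient.
Variables (V : laws) (K : sgroup).

Definition vquot_deg n : groupType := quotient (verbal V (K n)).

Definition vquot_face n (i : 'I_n.+2) : {hom vquot_deg n.+1 -> vquot_deg n} :=
  quotient_hom (@verbal_hom V _ _ (face i)).

Definition vquot_degen n (i : 'I_n.+1) : {hom vquot_deg n -> vquot_deg n.+1} :=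
  quotient_hom (@verbal_hom V _ _ (degen i)).

Lemma vquot_faceE n (i : 'I_n.+2) x :
  vquot_face i (coset _ x) = coset _ (face i x).
Proof. exact/quotient_funE/verbal_hom. Qed.

Lemma vquot_degenE n (i : 'I_n.+1) x :
  vquot_degen i (coset _ x) = coset _ (degen i x).
Proof. exact/quotient_funE/verbal_hom. Qed.

Let vE := (vquot_faceE, vquot_degenE).

Lemma vquot_face_face n (i j : 'I_n.+2) x : i <= j ->
  vquot_face i (vquot_face (incr j) x) = vquot_face j (vquot_face (keep i) x).
Proof. by move=> ij; rewrite -(coset_reprK x) !vE face_face. Qed.

Lemma vquot_degen_degen n (i j : 'I_n.+1) x : i <= j ->
  vquot_degen (keep i) (vquot_degen j x) = vquot_degen (incr j) (vquot_degen i x).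
Proof. by move=> ij; rewrite -(coset_reprK x) !vE degen_degen. Qed.

Lemma vquot_face_degen_lt n (i : 'I_n.+2) (j : 'I_n.+1) x : i <= j ->
  vquot_face (keep i) (vquot_degen (incr j) x) = vquot_degen j (vquot_face i x).
Proof. by move=> ij; rewrite -(coset_reprK x) !vE face_degen_lt. Qed.

Lemma vquot_face_degen_eq n (j : 'I_n.+1) x :
  vquot_face (keep j) (vquot_degen j x) = x.
Proof. by rewrite -(coset_reprK x) !vE face_degen_eq. Qed.

Lemma vquot_face_degen_succ n (j : 'I_n.+1) x :
  vquot_face (incr j) (vquot_degen j x) = x.
Proof. by rewrite -(coset_reprK x) !vE face_degen_succ. Qed.

Lemma vquot_face_degen_gt n (i : 'I_n.+2) (j : 'I_n.+1) x : j < i ->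
  vquot_face (incr i) (vquot_degen (keep j) x) = vquot_degen j (vquot_face i x).
Proof. by move=> ij; rewrite -(coset_reprK x) !vE face_degen_gt. Qed.

Definition vquot : sgroup := SGroup vquot_face_face vquot_degen_degen
  vquot_face_degen_lt vquot_face_degen_eq vquot_face_degen_succ
  vquot_face_degen_gt.

End VerbalQuotient.

Section VerbalQuotientHom.
Variables (V : laws) (K L : sgroup) (f : shom K L).

Definition vquot_hom_deg n : {hom vquot V K n -> vquot V L n} :=
  quotient_hom (@verbal_hom V _ _ (f n)).

Lemma vquot_homE n x : vquot_hom_deg n (coset _ x) = coset _ (f n x).
Proof. exact/quotient_funE/verbal_hom. Qed.

Lemma vquot_hom_face n (i : 'I_n.+2) x :
  vquot_hom_deg n (face i x) = face i (vquot_hom_deg n.+1 x).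
Proof.
rewrite -(coset_reprK x); set y := coset_repr x.
transitivity (coset (verbal V (L n)) (face i (f n.+1 y))).
  rewrite -shom_face -vquot_homE; congr (vquot_hom_deg n _); exact: vquot_faceE.
by rewrite vquot_homE; apply/esym/vquot_faceE.
Qed.

Lemma vquot_hom_degen n (i : 'I_n.+1) x :
  vquot_hom_deg n.+1 (degen i x) = degen i (vquot_hom_deg n x).
Proof.
rewrite -(coset_reprK x); set y := coset_repr x.
transitivity (coset (verbal V (L n.+1)) (degen i (f n y))).
  rewrite -shom_degen -vquot_homE; congr (vquot_hom_deg n.+1 _).
  exact: vquot_degenE.
by rewrite vquot_homE; apply/esym/vquot_degenE.
Qed.

Definition vquot_hom : shom (vquot V K) (vquot V L) :=
  SHom vquot_hom_face vquot_hom_degen.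

End VerbalQuotientHom.

Section SimplicialKernel.
Variables (K L : sgroup) (f : shom K L).

Lemma sker_face_subproof n (i : 'I_n.+2) x : ker (f n.+1) x -> ker (f n) (face i x).
Proof. by rewrite /= /ker_set /= shom_face => ->; apply: gmulf1. Qed.

Lemma sker_degen_subproof n (i : 'I_n.+1) x :
  ker (f n) x -> ker (f n.+1) (degen i x).
Proof. by rewrite /= /ker_set /= shom_degen => ->; apply: gmulf1. Qed.

Definition sker_deg n : groupType := subgroup_type (ker (f n)).

Definition sker_face n (i : 'I_n.+2) : {hom sker_deg n.+1 -> sker_deg n} :=
  restr_hom (@sker_face_subproof n i).

Definition sker_degen n (i : 'I_n.+1) : {hom sker_deg n -> sker_deg n.+1} :=
  restr_hom (@sker_degen_subproof n i).

Lemma sker_face_face n (i j : 'I_n.+2) x : i <= j ->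
  sker_face i (sker_face (incr j) x) = sker_face j (sker_face (keep i) x).
Proof. by move=> ij; apply: val_inj; rewrite /= face_face. Qed.

Lemma sker_degen_degen n (i j : 'I_n.+1) x : i <= j ->
  sker_degen (keep i) (sker_degen j x) = sker_degen (incr j) (sker_degen i x).
Proof. by move=> ij; apply: val_inj; rewrite /= degen_degen. Qed.

Lemma sker_face_degen_lt n (i : 'I_n.+2) (j : 'I_n.+1) x : i <= j ->
  sker_face (keep i) (sker_degen (incr j) x) = sker_degen j (sker_face i x).
Proof. by move=> ij; apply: val_inj; rewrite /= face_degen_lt. Qed.

Lemma sker_face_degen_eq n (j : 'I_n.+1) x :
  sker_face (keep j) (sker_degen j x) = x.
Proof. by apply: val_inj; rewrite /= face_degen_eq. Qed.

Lemma sker_face_degen_succ n (j : 'I_n.+1) x :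
  sker_face (incr j) (sker_degen j x) = x.
Proof. by apply: val_inj; rewrite /= face_degen_succ. Qed.

Lemma sker_face_degen_gt n (i : 'I_n.+2) (j : 'I_n.+1) x : j < i ->
  sker_face (incr i) (sker_degen (keep j) x) = sker_degen j (sker_face i x).
Proof. by move=> ij; apply: val_inj; rewrite /= face_degen_gt. Qed.

Definition sker : sgroup := SGroup sker_face_face sker_degen_degen
  sker_face_degen_lt sker_face_degen_eq sker_face_degen_succ
  sker_face_degen_gt.

End SimplicialKernel.

Section SimplicialKernelHom.
Variables (K L K' L' : sgroup) (f : shom K L) (f' : shom K' L').
Variables (u : shom K K') (v : shom L L').
Hypothesis uv : forall n x, f' n (u n x) = v n (f n x).

Lemma sker_hom_subproof n x : ker (f n) x -> ker (f' n) (u n x).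
Proof. by rewrite /= /ker_set /= uv => ->; apply: gmulf1. Qed.

Definition sker_hom_deg n : {hom sker f n -> sker f' n} :=
  restr_hom (@sker_hom_subproof n).

Lemma sker_hom_face n (i : 'I_n.+2) x :
  sker_hom_deg n (face i x) = face i (sker_hom_deg n.+1 x).
Proof. by apply: val_inj; rewrite /= shom_face. Qed.

Lemma sker_hom_degen n (i : 'I_n.+1) x :
  sker_hom_deg n.+1 (degen i x) = degen i (sker_hom_deg n x).
Proof. by apply: val_inj; rewrite /= shom_degen. Qed.

Definition sker_hom : shom (sker f) (sker f') := SHom sker_hom_face sker_hom_degen.

End SimplicialKernelHom.

Record square := Square {
  sqK : sgroup; sqL : sgroup; sqR : sgroup; sqS : sgroup;
  alpha : shom sqK sqL;
  beta : shom sqK sqR;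
  gamma : shom sqR sqS;
  delta : shom sqL sqS;
  square_comm : forall n x, gamma n (beta n x) = delta n (alpha n x)
}.

Definition square_comm' (Q : square) n x :
  delta Q n (alpha Q n x) = gamma Q n (beta Q n x) := esym (@square_comm Q n x).

Record square_hom (Q Q' : square) := SquareHom {
  homK : shom (sqK Q) (sqK Q');
  homL : shom (sqL Q) (sqL Q');
  homR : shom (sqR Q) (sqR Q');
  homS : shom (sqS Q) (sqS Q');
  hom_alpha : forall n x, alpha Q' n (homK n x) = homL n (alpha Q n x);
  hom_beta : forall n x, beta Q' n (homK n x) = homR n (beta Q n x);
  hom_gamma : forall n x, gamma Q' n (homR n x) = homS n (gamma Q n x);
  hom_delta : forall n x, delta Q' n (homL n x) = homS n (delta Q n x)
}.

Lemma vquot_comm V (K L R S : sgroup) (f : shom K L) (f' : shom R S)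
    (u : shom K R) (v : shom L S) :
  (forall n x, f' n (u n x) = v n (f n x)) ->
  forall n x, vquot_hom V f' n (vquot_hom V u n x) =
              vquot_hom V v n (vquot_hom V f n x).
Proof.
move=> uv n x; rewrite -(coset_reprK x); set y := coset_repr x.
transitivity (coset (verbal V (S n)) (f' n (u n y))).
  rewrite -vquot_homE; congr (vquot_hom_deg V f' n _); exact: vquot_homE.
rewrite uv -vquot_homE; congr (vquot_hom_deg V v n _); exact/esym/vquot_homE.
Qed.

Arguments vquot_comm V {K L R S f f' u v}.

Section SquareQuotient.
Variable V : laws.

Definition vquot_square (Q : square) : square :=
  Square (vquot_comm V (@square_comm Q)).

Definition vquot_square_hom (Q Q' : square) (u : square_hom Q Q') :
    square_hom (vquot_square Q) (vquot_square Q') :=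
  @SquareHom (vquot_square Q) (vquot_square Q') _ _ _ _
    (vquot_comm V (hom_alpha u)) (vquot_comm V (hom_beta u))
    (vquot_comm V (hom_gamma u)) (vquot_comm V (hom_delta u)).

End SquareQuotient.

Section TotalKernel.

Definition ker_alpha_gamma (Q : square) : shom (sker (alpha Q)) (sker (gamma Q)) :=
  sker_hom (@square_comm Q).

Definition ker_beta_delta (Q : square) : shom (sker (beta Q)) (sker (delta Q)) :=
  sker_hom (@square_comm' Q).

Definition total_ker (Q : square) : sgroup := sker (ker_alpha_gamma Q).

Variables (Q Q' : square) (u : square_hom Q Q').

Lemma total_ker_hom_subproof n x :
  ker_alpha_gamma Q' n (sker_hom (hom_alpha u) n x) =
  sker_hom (hom_gamma u) n (ker_alpha_gamma Q n x).
Proof. by apply: val_inj; rewrite /= hom_beta. Qed.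

Definition total_ker_hom : shom (total_ker Q) (total_ker Q') :=
  sker_hom total_ker_hom_subproof.

End TotalKernel.

Record triple := Triple {
  tG : groupType;
  tM : normal_subgroup tG;
  tN : normal_subgroup tG
}.

Definition tMN (T : triple) : normal_subgroup (tG T) := prod_normal (tM T) (tN T).

Lemma tM_sub (T : triple) x : tM T x -> tMN T x.
Proof. by move=> Mx; exists x, 1; rewrite mulg1; split=> //; apply: subgroup1. Qed.

Lemma tN_sub (T : triple) x : tN T x -> tMN T x.
Proof. by move=> Nx; exists 1, x; rewrite mul1g; split=> //; apply: subgroup1. Qed.

Definition projM_MN (T : triple) : {hom quotient (tM T) -> quotient (tMN T)} :=
  @quotient_hom _ _ (tM T) (tMN T) idfun (@tM_sub T).

Definition projN_MN (T : triple) : {hom quotient (tN T) -> quotient (tMN T)} :=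
  @quotient_hom _ _ (tN T) (tMN T) idfun (@tN_sub T).

Record triple_hom (T T' : triple) := TripleHom {
  thom :> {hom tG T -> tG T'};
  thomM : forall x, tM T x -> tM T' (thom x);
  thomN : forall x, tN T x -> tN T' (thom x)
}.

Lemma thomMN (T T' : triple) (f : triple_hom T T') x : tMN T x -> tMN T' (f x).
Proof.
move=> [m [n [Mm Nn ->]]]; exists (f m), (f n); rewrite gmulfM.
by split=> //; [apply: thomM|apply: thomN].
Qed.

Definition triple_id (T : triple) : triple_hom T T :=
  @TripleHom T T idfun (fun _ Mx => Mx) (fun _ Nx => Nx).

Definition triple_comp (T T' T'' : triple) (g : triple_hom T' T'')
    (f : triple_hom T T') : triple_hom T T'' :=
  @TripleHom T T'' (g \o f : {hom _ -> _})
    (fun x Mx => thomM g (thomM f Mx)) (fun x Nx => thomN g (thomN f Nx)).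

Record resolution (G : groupType) (K : sgroup) := Resolution {
  aug : {hom homotopy_group K 0 -> G};
  aug_bij : bijective aug;
  resolution_free : sgroup_free K;
  resolution_acyclic : forall n (x : homotopy_group K n.+1), x = 1
}.

Record baer_square (V : laws) (T : triple) := BaerSquare {
  bsq :> square;
  resK : resolution (tG T) (sqK bsq);
  resL : resolution (quotient (tN T)) (sqL bsq);
  resR : resolution (quotient (tM T)) (sqR bsq);
  resS : resolution (quotient (tMN T)) (sqS bsq);
  aug_alpha : forall x,
    aug resL (homotopy_hom (alpha bsq) 0 x) = quotient_proj (tN T) (aug resK x);
  aug_beta : forall x,
    aug resR (homotopy_hom (beta bsq) 0 x) = quotient_proj (tM T) (aug resK x);
  aug_gamma : forall x,
    aug resS (homotopy_hom (gamma bsq) 0 x) = projM_MN T (aug resR x);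
  aug_delta : forall x,
    aug resS (homotopy_hom (delta bsq) 0 x) = projN_MN T (aug resL x);
  surj_alpha : degreewise_surjective (alpha (vquot_square V bsq));
  surj_beta : degreewise_surjective (beta (vquot_square V bsq));
  surj_gamma : degreewise_surjective (gamma (vquot_square V bsq));
  surj_delta : degreewise_surjective (delta (vquot_square V bsq));
  surj_ker_alpha : degreewise_surjective (ker_alpha_gamma (vquot_square V bsq));
  surj_ker_beta : degreewise_surjective (ker_beta_delta (vquot_square V bsq))
}.

Definition baer_group (V : laws) (T : triple) (Q : baer_square V T) : groupType :=
  homotopy_group (total_ker (vquot_square V Q)) 1.

Section BaerMaps.
Variables (V : laws).

Definition baer_hom (T T' : triple) (Q : baer_square V T) (Q' : baer_square V T')
    (u : square_hom Q Q') : {hom baer_group Q -> baer_group Q'} :=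
  homotopy_hom (total_ker_hom (vquot_square_hom V u)) 1.

Definition lifts (T T' : triple) (f : triple_hom T T')
    (Q : baer_square V T) (Q' : baer_square V T') (u : square_hom Q Q') : Prop :=
  [/\ forall x, aug (resK Q') (homotopy_hom (homK u) 0 x) = f (aug (resK Q) x),
      forall x, aug (resL Q') (homotopy_hom (homL u) 0 x) =
                quotient_hom (thomN f) (aug (resL Q) x),
      forall x, aug (resR Q') (homotopy_hom (homR u) 0 x) =
                quotient_hom (thomM f) (aug (resR Q) x)
    & forall x, aug (resS Q') (homotopy_hom (homS u) 0 x) =
                quotient_hom (thomMN f) (aug (resS Q) x)].

(* The homomorphism of Baer invariants induced by a homomorphism of triples.
   Since the maps of [Q'] are surjective only modulo V, [f] may fail to lift to a
   map of squares from [Q] to [Q']; it is therefore compared with [Q'] inside a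
   third choice of resolutions of the same triple. *)
Definition induced (T T' : triple) (f : triple_hom T T')
    (Q : baer_square V T) (Q' : baer_square V T')
    (phi : {hom baer_group Q -> baer_group Q'}) : Prop :=
  exists (P : baer_square V T') (u : square_hom Q P) (w : square_hom Q' P),
    [/\ lifts f u, lifts (triple_id T') w
      & forall x, baer_hom w (phi x) = baer_hom u x].

End BaerMaps.

(* The Baer invariant as a functor on triples, for an arbitrary choice of the
   resolutions from which it is computed. *)
Record baer_invariant (V : laws) := BaerInvariant {
  baer_choice : forall T, baer_square V T;
  baer_map : forall T T', triple_hom T T' ->
    {hom baer_group (baer_choice T) -> baer_group (baer_choice T')};
  baer_map_induced : forall T T' (f : triple_hom T T'), induced f (baer_map f);
  baer_map_id : forall T x, baer_map (triple_id T) x = x;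
  baer_map_comp : forall T T' T'' (g : triple_hom T' T'') (f : triple_hom T T') x,
    baer_map (triple_comp g f) x = baer_map g (baer_map f x)
}.

Definition baer (V : laws) (VM : baer_invariant V) (T : triple) : groupType :=
  baer_group (baer_choice VM T).
Coercion baer : baer_invariant >-> Funclass.

Record directed_set (d : Order.disp_t) := DirectedSet {
  dset :> preorderType d;
  dset_point : dset;
  dset_bound : forall i j : dset, exists k, (i <= k)%O && (j <= k)%O
}.

Section GroupSystems.
Variables (d : Order.disp_t) (I : directed_set d).

Record gsystem := GSystem {
  gs_obj :> I -> groupType;
  gs_map : forall i j, (i <= j)%O -> {hom gs_obj i -> gs_obj j};
  gs_map_id : forall i (ii : (i <= i)%O) x, gs_map ii x = x;
  gs_map_comp : forall i j k (ij : (i <= j)%O) (jk : (j <= k)%O) (ik : (i <= k)%O) x,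
    gs_map ik x = gs_map jk (gs_map ij x)
}.

Section Limit.
Variable A : gsystem.

Definition dlim_elt := {i : I & A i}.

Definition dlim_rel : rel dlim_elt := fun x y =>
  `[< exists k (xk : (tag x <= k)%O) (yk : (tag y <= k)%O),
        gs_map A xk (tagged x) = gs_map A yk (tagged y) >].

Definition bound (i j : I) : I := xchoose (dset_bound i j).

Lemma bound_l i j : (i <= bound i j)%O.
Proof. by have /andP[] := xchooseP (dset_bound i j). Qed.

Lemma bound_r i j : (j <= bound i j)%O.
Proof. by have /andP[] := xchooseP (dset_bound i j). Qed.

Lemma dlim_rel_equiv : equiv_class_of dlim_rel.
Proof.
split.
- by move=> [i x]; apply/asboolP; exists i, (lexx i), (lexx i).
- by move=> x y; apply/asboolP/asboolP => -[k [xk [yk e]]]; exists k, yk, xk.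
- move=> y x z /asboolP[k [xk [yk e]]] /asboolP[l [yl [zl e']]]; apply/asboolP.
  have km := bound_l k l; have lm := bound_r k l.
  exists (bound k l), (le_trans xk km), (le_trans zl lm).
  rewrite (gs_map_comp xk km) e (gs_map_comp zl lm) -e'.
  have ym := le_trans yk km.
  by rewrite -(gs_map_comp yk km ym) -(gs_map_comp yl lm ym).
Qed.

Canonical dlim_equiv := EquivRelPack dlim_rel_equiv.

Definition dlim := {eq_quot dlim_equiv}.

HB.instance Definition _ := Choice.on dlim.
HB.instance Definition _ := EqQuotient.on dlim.

Definition dlim_class i (x : A i) : dlim := \pi_dlim (existT (fun i => A i : Type) i x).

Lemma dlim_classP i j (x : A i) (y : A j) :
  dlim_class x = dlim_class y <->
  exists k (ik : (i <= k)%O) (jk : (j <= k)%O), gs_map A ik x = gs_map A jk y.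
Proof. by split=> [/eqmodP/asboolP//|H]; apply/eqmodP/asboolP. Qed.

Lemma dlim_class_map i j (ij : (i <= j)%O) (x : A i) :
  dlim_class (gs_map A ij x) = dlim_class x.
Proof.
apply/dlim_classP; exists j, (lexx j), ij.
by rewrite -(gs_map_comp ij (lexx j) ij).
Qed.

Lemma dlim_surj (x : dlim) : exists i (y : A i), x = dlim_class y.
Proof.
exists (tag (repr x)), (tagged (repr x)).
by rewrite /dlim_class; case: (repr x) (reprK x).
Qed.

Definition dlim_index (x : dlim) : I := tag (repr x).
Definition dlim_repr (x : dlim) : A (dlim_index x) := tagged (repr x).

Lemma dlim_reprK x : dlim_class (dlim_repr x) = x.
Proof.
by rewrite /dlim_class /dlim_repr /dlim_index; case: (repr x) (reprK x).
Qed.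

Definition dlim_mul (x y : dlim) : dlim :=
  dlim_class (gs_map A (bound_l (dlim_index x) (dlim_index y)) (dlim_repr x) *
              gs_map A (bound_r (dlim_index x) (dlim_index y)) (dlim_repr y)).
Definition dlim_one : dlim := dlim_class (1 : A (dset_point I)).
Definition dlim_inv (x : dlim) : dlim := dlim_class (dlim_repr x)^-1.

Lemma dlim_oneE i : dlim_class (1 : A i) = dlim_one.
Proof.
have il := bound_l i (dset_point I); have pl := bound_r i (dset_point I).
by apply/dlim_classP; exists (bound i (dset_point I)), il, pl; rewrite !gmulf1.
Qed.

Lemma dlim_mulE i (x y : A i) :
  dlim_mul (dlim_class x) (dlim_class y) = dlim_class (x * y).
Proof.
rewrite /dlim_mul; move: (bound_l _ _) (bound_r _ _); set b := bound _ _.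
move=> xb yb; set x' := dlim_repr _ in xb *; set y' := dlim_repr _ in yb *.
have /dlim_classP[k [xk [ik ex]]] : dlim_class x' = dlim_class x.
  exact: dlim_reprK.
have /dlim_classP[l [yl [il ey]]] : dlim_class y' = dlim_class y.
  exact: dlim_reprK.
set m := bound k l; set p := bound b m.
have km : (k <= p)%O := le_trans (bound_l k l) (bound_r b m).
have lm : (l <= p)%O := le_trans (bound_r k l) (bound_r b m).
have bm : (b <= p)%O := bound_l b m.
apply/dlim_classP; exists p, bm, (le_trans ik km).
rewrite !gmulfM -!(gs_map_comp _ _ (le_trans _ bm)).
rewrite (gs_map_comp xk km) ex -(gs_map_comp ik km (le_trans ik km)).
congr (_ * _).
by rewrite (gs_map_comp yl lm) ey -(gs_map_comp il lm (le_trans ik km)).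
Qed.

Lemma dlim_invE i (x : A i) : dlim_inv (dlim_class x) = dlim_class x^-1.
Proof.
rewrite /dlim_inv; set x' := dlim_repr _.
have /dlim_classP[k [xk [ik ex]]] : dlim_class x' = dlim_class x.
  exact: dlim_reprK.
by apply/dlim_classP; exists k, xk, ik; rewrite !gmulfV ex.
Qed.

Lemma dlim_surj2 (x y : dlim) :
  exists i (x' y' : A i), x = dlim_class x' /\ y = dlim_class y'.
Proof.
have [i [x' ->]] := dlim_surj x; have [j [y' ->]] := dlim_surj y.
exists (bound i j), (gs_map A (bound_l i j) x'), (gs_map A (bound_r i j) y').
by rewrite !dlim_class_map.
Qed.

Lemma dlim_mulA : associative dlim_mul.
Proof.
move=> x y z; have [i [x' [y' [-> ->]]]] := dlim_surj2 x y.
have [j [z' ->]] := dlim_surj z.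
rewrite -(dlim_class_map (bound_l i j) x') -(dlim_class_map (bound_l i j) y').
by rewrite -(dlim_class_map (bound_r i j) z') !dlim_mulE mulgA.
Qed.

Lemma dlim_mul1 : left_id dlim_one dlim_mul.
Proof.
by move=> x; have [i [y ->]] := dlim_surj x; rewrite -(dlim_oneE i) dlim_mulE mul1g.
Qed.

Lemma dlim_mulr1 : right_id dlim_one dlim_mul.
Proof.
by move=> x; have [i [y ->]] := dlim_surj x; rewrite -(dlim_oneE i) dlim_mulE mulg1.
Qed.

Lemma dlim_mulV : left_inverse dlim_one dlim_inv dlim_mul.
Proof.
move=> x; have [i [y ->]] := dlim_surj x.
by rewrite dlim_invE dlim_mulE mulVg dlim_oneE.
Qed.

Lemma dlim_mulrV : right_inverse dlim_one dlim_inv dlim_mul.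
Proof.
move=> x; have [i [y ->]] := dlim_surj x.
by rewrite dlim_invE dlim_mulE mulgV dlim_oneE.
Qed.

HB.instance Definition _ := isGroup.Build dlim dlim_mulA
  dlim_mul1 dlim_mulr1 dlim_mulV dlim_mulrV.

Lemma dlim_classM i : {morph @dlim_class i : x y / x * y}.
Proof. by move=> x y; rewrite -dlim_mulE. Qed.

Definition dlim_in i : {hom A i -> dlim} := hom_of (@dlim_classM i).

End Limit.

Section LimitHom.
Variables (A B : gsystem) (f : forall i, {hom A i -> B i}).
Hypothesis f_map : forall i j (ij : (i <= j)%O) x,
  f j (gs_map A ij x) = gs_map B ij (f i x).

Definition dlim_fun (x : dlim A) : dlim B := dlim_class (f _ (dlim_repr x)).

Lemma dlim_funE i (x : A i) : dlim_fun (dlim_class x) = dlim_class (f i x).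
Proof.
rewrite /dlim_fun; set x' := dlim_repr _.
have /dlim_classP[k [xk [ik ex]]] : dlim_class x' = dlim_class x.
  exact: dlim_reprK.
by apply/dlim_classP; exists k, xk, ik; rewrite -!f_map ex.
Qed.

Lemma dlim_funM : {morph dlim_fun : x y / x * y}.
Proof.
move=> x y; have [i [x' [y' [-> ->]]]] := dlim_surj2 x y.
by rewrite -dlim_classM !dlim_funE gmulfM dlim_classM.
Qed.

Definition dlim_hom : {hom dlim A -> dlim B} := hom_of dlim_funM.

End LimitHom.

Section Subsystem.
Variables (A : gsystem) (B : forall i, normal_subgroup (A i)).
Hypothesis B_map : forall i j (ij : (i <= j)%O) x, B i x -> B j (gs_map A ij x).

Definition sub_map i j (ij : (i <= j)%O) :
    {hom subgroup_type (B i) -> subgroup_type (B j)} :=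
  restr_hom (@B_map i j ij).

Lemma sub_map_id i (ii : (i <= i)%O) x : sub_map ii x = x.
Proof. by apply: val_inj; rewrite /= gs_map_id. Qed.

Lemma sub_map_comp i j k (ij : (i <= j)%O) (jk : (j <= k)%O) (ik : (i <= k)%O) x :
  sub_map ik x = sub_map jk (sub_map ij x).
Proof. by apply: val_inj; rewrite /= (gs_map_comp ij jk). Qed.

Definition subsystem : gsystem := GSystem sub_map_id sub_map_comp.

Definition sub_incl i : {hom subsystem i -> A i} :=
  hom_of (fun x y : subgroup_type (B i) => valM x y).

Definition dlim_sub_incl : {hom dlim subsystem -> dlim A} :=
  @dlim_hom subsystem A sub_incl (fun _ _ _ _ => erefl).

Lemma dlim_sub_inclE i (x : subsystem i) :
  dlim_sub_incl (dlim_class x) = dlim_class (subgroup_val x).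
Proof. exact: dlim_funE. Qed.

(* The direct limit of the B_i, as a subgroup of the direct limit of the A_i. *)
Definition dlim_sub_set (x : dlim A) : Prop := exists y, dlim_sub_incl y = x.

Lemma dlim_sub_set1 : dlim_sub_set 1.
Proof. by exists 1; apply: gmulf1. Qed.

Lemma dlim_sub_setM x y : dlim_sub_set x -> dlim_sub_set y -> dlim_sub_set (x * y).
Proof. by move=> [a <-] [b <-]; exists (a * b); apply: gmulfM. Qed.

Lemma dlim_sub_setV x : dlim_sub_set x -> dlim_sub_set x^-1.
Proof. by move=> [a <-]; exists a^-1; apply: gmulfV. Qed.

Lemma dlim_sub_setJ x y : dlim_sub_set x -> dlim_sub_set (x ^ y).
Proof.
move=> [a <-]; have [i [a' ->]] := dlim_surj a; have [j [y' ->]] := dlim_surj y.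
rewrite -(dlim_class_map (bound_l i j) a') -(dlim_class_map (bound_r i j) y').
move: (gs_map _ _ a') (gs_map _ _ y') => b z.
exists (dlim_class (in_subgroup (normal_subgroupJ z (subgroup_typeP b)) :
  subsystem (bound i j))).
rewrite !dlim_sub_inclE; exact: (gmulfJ (dlim_in A _) (subgroup_val b) z).
Qed.

Definition dlim_normal : normal_subgroup (dlim A) := @NormalSubgroup (dlim A)
  (Subgroup dlim_sub_set1 dlim_sub_setM dlim_sub_setV) dlim_sub_setJ.

End Subsystem.

End GroupSystems.

Section TripleSystems.
Variables (d : Order.disp_t) (I : directed_set d).

Record tsystem := TSystem {
  ts_obj :> I -> triple;
  ts_map : forall i j, (i <= j)%O -> triple_hom (ts_obj i) (ts_obj j);
  ts_map_id : forall i (ii : (i <= i)%O) x, ts_map ii x = x;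
  ts_map_comp : forall i j k (ij : (i <= j)%O) (jk : (j <= k)%O) (ik : (i <= k)%O) x,
    ts_map ik x = ts_map jk (ts_map ij x)
}.

Variable T : tsystem.

Definition tsystem_group : gsystem I :=
  GSystem (gs_obj := fun i => tG (T i)) (@ts_map_id T) (@ts_map_comp T).

Definition triple_lim : triple := Triple
  (@dlim_normal _ _ tsystem_group (fun i => tM (T i))
     (fun i j ij => thomM (ts_map T ij)))
  (@dlim_normal _ _ tsystem_group (fun i => tN (T i))
     (fun i j ij => thomN (ts_map T ij))).

End TripleSystems.

Lemma triple_hom_eq (T T' : triple) (f g : triple_hom T T') :
  (forall x, f x = g x) -> f = g.
Proof.
case: f g => [f fM fN] [g gM gN] /= fg.
have efg : f = g.
  move: f g fg {fM fN gM gN} => [f cf] [g cg] /= fg.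
  have e : f = g by apply/funext.
  rewrite e in cf fg *; congr UMagmaMorphism.Pack.
  move: cf cg => [[a] [b]] [[a'] [b']].
  by rewrite (Prop_irrelevance a a') (Prop_irrelevance b b').
by rewrite efg in fM fN *; congr TripleHom; apply: Prop_irrelevance.
Qed.

Section BaerSystem.
Variables (V : laws) (VM : baer_invariant V).
Variables (d : Order.disp_t) (I : directed_set d) (T : tsystem I).

Definition baer_system_map i j (ij : (i <= j)%O) : {hom VM (T i) -> VM (T j)} :=
  baer_map VM (ts_map T ij).

Lemma baer_system_map_id i (ii : (i <= i)%O) x : baer_system_map ii x = x.
Proof.
rewrite /baer_system_map (_ : ts_map T ii = triple_id (T i)) ?baer_map_id //.
by apply: triple_hom_eq => y; rewrite ts_map_id.
Qed.

Lemma baer_system_map_comp i j k (ij : (i <= j)%O) (jk : (j <= k)%O)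
    (ik : (i <= k)%O) x :
  baer_system_map ik x = baer_system_map jk (baer_system_map ij x).
Proof.
rewrite /baer_system_map -baer_map_comp; congr (baer_map VM _ x).
by apply: triple_hom_eq => y; rewrite (ts_map_comp ij jk ik).
Qed.

Definition baer_system : gsystem I :=
  GSystem baer_system_map_id baer_system_map_comp.

End BaerSystem.

(* Main.v *)
Require Import Defs.
From mathcomp Require Import all_boot all_order zify.
From HB Require Import structures.
From mathcomp Require Import boolp.

(** Let F(G) be the bar construction of the free group comonad on G. It is a
  functorial free resolution, compatible with directed colimits, and it turns a
  pullback-like square of surjections of groups (such as G, G/N, G/M, G/MN) into
  a square of surjections whose map to the pullback is surjective in each degree.
  The latter property makes the square F(T) of a triple T fibrant: any square Q
  of free resolutions of T maps to F(T) over the identity of T, and two such maps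
  are homotopic. Homotopies consist of homomorphisms, hence survive the passage to
  the quotients by V and to the total kernels. So the comparison map induces an
  isomorphism on each corner modulo V, and by the five lemma, applied to the
  kernels, an isomorphism from the Baer invariant of T computed from Q to
  pi_1 of the total kernel of F(T)/V, natural in T. Membership in a verbal subgroup
  and vanishing of faces involve finitely many elements, so that the latter group
  visibly commutes with directed colimits. *)

Set Implicit Arguments.
Unset Strict Implicit.
Unset Printing Implicit Defensive.

Local Open Scope group_scope.
Local Open Scope quotient_scope.

(** * Homomorphisms and free groups *)

(** The arrows of a given square are surjective only modulo V, so a map of squares may fail to lift
    into it. Hence all comparisons of squares point towards the bar square. Backwards, maps exist
    only corner by corner, which is why the isomorphism on total kernels comes from the five lemma
    and not from a homotopy inverse of squares. This also disposes of the third square P in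
    [induced]: after mapping everything on to a bar square, both routes lie over the same
    homomorphism of triples and are homotopic. The bar square is fibrant for two reasons. A filling
    problem divided by the faces of a preimage becomes a sphere in a common kernel, and that kernel
    is acyclic because the contraction of the bar construction is natural in the group. The preimage
    exists because G maps onto the pullback of G/N and G/M over G/MN, a property of sets that the
    free group functor preserves. Maps and homotopies are built degree by degree: every condition
    imposed on a value is multiplicative in the argument, so it suffices to meet it on a basis. *)

Section HomComp.
Variables (G H K : groupType) (g : {hom H -> K}) (f : {hom G -> H}).

Lemma hom_compM : {morph (fun x => g (f x)) : x y / x * y}.
Proof. by move=> x y; rewrite !gmulfM. Qed.

Definition hom_comp : {hom G -> K} := hom_of hom_compM.

Lemma hom_compE x : hom_comp x = g (f x). Proof. by []. Qed.

End HomComp.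

Lemma hom_div1 (G H : groupType) (f : {hom G -> H}) x y :
  f x = f y -> f (x * y^-1) = 1.
Proof. by move=> e; rewrite gmulfM gmulfV e mulgV. Qed.

Lemma quotient_homE (G H : groupType) (N : normal_subgroup G)
    (N' : normal_subgroup H) (f : {hom G -> H}) (fN : forall x, N x -> N' (f x)) x :
  quotient_hom fN (coset N x) = coset N' (f x).
Proof. exact: quotient_funE. Qed.

Lemma coset_eq1 (G : groupType) (N : normal_subgroup G) x : coset N x = 1 <-> N x.
Proof.
have -> : coset N x = 1 <-> coset N 1 = coset N x by split.
by rewrite -cosetP invg1 mul1g.
Qed.

Lemma coset_surj (G : groupType) (N : normal_subgroup G) (x : quotient N) :
  exists y, x = coset N y.
Proof. by exists (coset_repr x); rewrite coset_reprK. Qed.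

Section FreeGroup.
Variable X : choiceType.

Definition letters := seq (X * bool).

Definition free_eval (H : groupType) (g : X -> H) (w : letters) : H :=
  \prod_(l <- w) (if l.2 then (g l.1)^-1 else g l.1).

Lemma free_eval_cat (H : groupType) (g : X -> H) w w' :
  free_eval g (w ++ w') = free_eval g w * free_eval g w'.
Proof. by rewrite /free_eval big_cat. Qed.

Definition letters_inv (w : letters) : letters := rev [seq (l.1, ~~ l.2) | l <- w].

Lemma free_eval_inv (H : groupType) (g : X -> H) w :
  free_eval g (letters_inv w) = (free_eval g w)^-1.
Proof.
elim: w => [|l w IH]; first by rewrite /free_eval !big_nil invg1.
rewrite /letters_inv /= rev_cons -cats1 free_eval_cat IH /free_eval big_seq1 /=.
by rewrite big_cons invgM; case: l.2; rewrite ?invgK.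
Qed.

(* Two words are identified when they agree in every group, so the universal
   property needs no normal form. *)
Definition free_rel : rel letters := fun w w' =>
  `[< forall (H : groupType) (g : X -> H), free_eval g w = free_eval g w' >].

Lemma free_rel_equiv : equiv_class_of free_rel.
Proof.
split=> [w|w w'|w' w w'']; first exact/asboolP.
  by apply/asboolP/asboolP => e H g; rewrite e.
by move=> /asboolP e /asboolP e'; apply/asboolP => H g; rewrite e e'.
Qed.

Canonical free_equiv := EquivRelPack free_rel_equiv.

Definition free_group := {eq_quot free_equiv}.

HB.instance Definition _ := Choice.on free_group.
HB.instance Definition _ := EqQuotient.on free_group.

Definition free_class (w : letters) : free_group := \pi_free_group w.

Lemma free_classP w w' : free_class w = free_class w' <->
  forall (H : groupType) (g : X -> H), free_eval g w = free_eval g w'.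
Proof. by split=> [/eqmodP/asboolP//|e]; apply/eqmodP/asboolP. Qed.

Lemma free_class_surj (x : free_group) : exists w, x = free_class w.
Proof. by exists (repr x); rewrite /free_class reprK. Qed.

Lemma free_repr_eval (H : groupType) (g : X -> H) w :
  free_eval g (repr (free_class w)) = free_eval g w.
Proof. by move: H g; apply/free_classP; rewrite /free_class reprK. Qed.

Definition free_mul (x y : free_group) := free_class (repr x ++ repr y).
Definition free_inv (x : free_group) := free_class (letters_inv (repr x)).

Lemma free_mulE w w' : free_mul (free_class w) (free_class w') = free_class (w ++ w').
Proof. by apply/free_classP => H g; rewrite !free_eval_cat !free_repr_eval. Qed.

Lemma free_invE w : free_inv (free_class w) = free_class (letters_inv w).
Proof. by apply/free_classP => H g; rewrite !free_eval_inv free_repr_eval. Qed.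

Lemma free_mulA : associative free_mul.
Proof.
move=> x y z; have [a ->] := free_class_surj x; have [b ->] := free_class_surj y.
by have [c ->] := free_class_surj z; rewrite !free_mulE catA.
Qed.

Lemma free_mul1 : left_id (free_class [::]) free_mul.
Proof. by move=> x; have [a ->] := free_class_surj x; rewrite free_mulE. Qed.

Lemma free_mulr1 : right_id (free_class [::]) free_mul.
Proof. by move=> x; have [a ->] := free_class_surj x; rewrite free_mulE cats0. Qed.

Lemma free_mulV : left_inverse (free_class [::]) free_inv free_mul.
Proof.
move=> x; have [a ->] := free_class_surj x; rewrite free_invE free_mulE.
apply/free_classP => H g.
by rewrite free_eval_cat free_eval_inv mulVg /free_eval big_nil.
Qed.

Lemma free_mulrV : right_inverse (free_class [::]) free_inv free_mul.
Proof.
move=> x; have [a ->] := free_class_surj x; rewrite free_invE free_mulE.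
apply/free_classP => H g.
by rewrite free_eval_cat free_eval_inv mulgV /free_eval big_nil.
Qed.

HB.instance Definition _ := isGroup.Build free_group free_mulA
  free_mul1 free_mulr1 free_mulV free_mulrV.

Definition free_gen (x : X) : free_group := free_class [:: (x, false)].

Section FreeLift.
Variables (H : groupType) (g : X -> H).

Definition free_lift_fun (x : free_group) : H := free_eval g (repr x).

Lemma free_lift_class w : free_lift_fun (free_class w) = free_eval g w.
Proof. exact: free_repr_eval. Qed.

Lemma free_lift_funM : {morph free_lift_fun : x y / x * y}.
Proof.
move=> x y; have [a ->] := free_class_surj x; have [b ->] := free_class_surj y.
by rewrite [_ * _]free_mulE !free_lift_class free_eval_cat.
Qed.

Definition free_lift : {hom free_group -> H} := hom_of free_lift_funM.

Lemma free_lift_gen x : free_lift (free_gen x) = g x.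
Proof. by rewrite /= free_lift_class /free_eval big_seq1. Qed.

End FreeLift.

Lemma free_classE w : free_class w = free_eval free_gen w.
Proof.
elim: w => [|[x b] w IH]; first by rewrite /free_eval big_nil.
rewrite /free_eval big_cons -/(free_eval _ _) -IH.
case: b => /=; last by rewrite [RHS]free_mulE.
by rewrite [_^-1]free_invE [RHS]free_mulE.
Qed.

Lemma hom_free_class (H : groupType) (f : {hom free_group -> H}) w :
  f (free_class w) = free_eval (f \o free_gen) w.
Proof.
rewrite free_classE /free_eval gmulf_prod; apply: eq_bigr => -[x b] _ /=.
by case: b; rewrite ?gmulfV.
Qed.

Lemma free_hom_ext (H : groupType) (f f' : {hom free_group -> H}) :
  (forall x, f (free_gen x) = f' (free_gen x)) -> f =1 f'.
Proof.
move=> e x; have [w ->] := free_class_surj x; rewrite !hom_free_class.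
by apply: eq_bigr => -[y b] _ /=; rewrite e.
Qed.

Lemma free_basis : is_basis (fun x => exists y, x = free_gen y).
Proof.
move=> H g; split.
  by exists (free_lift (g \o free_gen)) => _ [y ->]; rewrite free_lift_gen.
by move=> f f' e e'; apply: free_hom_ext => y; rewrite e ?e'; try exists y.
Qed.

End FreeGroup.

Section FreeMap.
Variables (X Y : choiceType) (g : X -> Y).

Definition free_map : {hom free_group X -> free_group Y} :=
  free_lift (fun x => free_gen (g x)).

Lemma free_map_gen x : free_map (free_gen x) = free_gen (g x).
Proof. exact: free_lift_gen. Qed.

Lemma free_map_surj : (forall y, exists x, g x = y) ->
  forall y, exists x, free_map x = y.
Proof.
move=> /choice[s gs] y; pose t := free_lift (fun y => free_gen (s y)).
exists (t y).
suff /(_ y) : hom_comp free_map t =1 (idfun : {hom _ -> _}) by [].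
by apply: free_hom_ext => x; rewrite hom_compE free_lift_gen free_map_gen gs.
Qed.

End FreeMap.

Lemma free_map_comp (X Y Z : choiceType) (g : Y -> Z) (f : X -> Y) x :
  free_map g (free_map f x) = free_map (g \o f) x.
Proof.
suff /(_ x) : hom_comp (free_map g) (free_map f) =1 free_map (g \o f) by [].
by apply: free_hom_ext => y; rewrite hom_compE !free_map_gen.
Qed.

Lemma free_map_eq (X Y : choiceType) (f g : X -> Y) : f =1 g ->
  free_map f =1 free_map g.
Proof. by move=> e; apply: free_hom_ext => x; rewrite !free_map_gen e. Qed.

Lemma free_map_id (X : choiceType) (x : free_group X) : free_map id x = x.
Proof.
suff /(_ x) : free_map id =1 (idfun : {hom free_group X -> free_group X}) by [].
by apply: free_hom_ext => y; rewrite free_map_gen.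
Qed.

(* A square of surjections of sets whose comparison map to the pullback is
   surjective stays such after applying the free group functor: the kernel of
   free(Z) -> free(W) is generated by differences that lift. *)
Lemma free_map_pullback (X Y Z W : choiceType) (a : X -> Y) (b : X -> Z)
    (c : Z -> W) (e : Y -> W) :
  (forall y, exists x, a x = y) -> (forall z, exists x, b x = z) ->
  (forall w, exists z, c z = w) ->
  (forall x, e (a x) = c (b x)) ->
  (forall y z, e y = c z -> exists x, a x = y /\ b x = z) ->
  forall y z, free_map e y = free_map c z ->
    exists x, free_map a x = y /\ free_map b x = z.
Proof.
move=> sa sb sc ab pb.
(* The aim is that [N] contains the kernel of [free_map c]. It is normal because [free_map b] is
   onto. A section [s] of [c] defines [r] on generators so that [r] after [free_map c] is the
   projection modulo [N]; hence that kernel dies modulo [N]. *)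
pose N (z : free_group Z) := exists k, free_map a k = 1 /\ free_map b k = z.
have N1 : N 1 by exists 1; rewrite !gmulf1.
have NM x y : N x -> N y -> N (x * y).
  by move=> [k [k1 <-]] [l [l1 <-]]; exists (k * l); rewrite !gmulfM k1 l1 mulg1.
have NV x : N x -> N x^-1.
  by move=> [k [k1 <-]]; exists k^-1; rewrite !gmulfV k1 invg1.
have NJ x y : N x -> N (x ^ y).
  move=> [k [k1 <-]]; have [l <-] := free_map_surj sb y.
  by exists (k ^ l); rewrite !gmulfJ k1 conj1g.
pose NS := @NormalSubgroup _ (Subgroup N1 NM NV) NJ.
have /choice[s cs] := sc.
pose r := free_lift (fun w => coset NS (free_gen (s w))).
have rc : hom_comp r (free_map c) =1 quotient_proj NS.
  apply: free_hom_ext => z.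
  rewrite hom_compE free_map_gen free_lift_gen.
  apply/cosetP => /=.
  have [x bx] := sb z.
  have [x' [ax' bx']] : exists x', a x' = a x /\ b x' = s (c z).
    by apply: pb; rewrite ab bx cs.
  exists ((free_gen x')^-1 * free_gen x).
  by rewrite !gmulfM !gmulfV !free_map_gen ax' bx' bx mulVg.
move=> y z eyz; have [x0 ex0] := free_map_surj sa y.
have : free_map c (z * (free_map b x0)^-1) = 1.
  rewrite gmulfM gmulfV -eyz -ex0 !free_map_comp.
  by rewrite (free_map_eq (g := c \o b)) ?mulgV // => x; rewrite /= ab.
move=> c1; have := rc (z * (free_map b x0)^-1); rewrite hom_compE c1 gmulf1.
move/esym/coset_eq1 => -[k [ak bk]]; exists (k * x0).
by rewrite !gmulfM ak mul1g bk mulgVK.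
Qed.

(** * Augmented simplicial groups and fillers *)

(* Augmented simplicial groups. Degrees are shifted by one, so that the
   augmentation is the face map from degree 1 to degree 0, and faces and
   degeneracies are indexed by natural numbers. *)
Record asgroup := ASGroup {
  asg :> sgroup;
  ag : groupType;
  aug0 : {hom asg 0 -> ag};
  aug0P : forall x, aug0 (face ord0 x) = aug0 (face ord_max x)
}.

Section AugmentedFaces.
Variable A : asgroup.

Definition adeg n : groupType := if n is m.+1 then A m else ag A.

Definition aface n (i : nat) : {hom adeg n.+1 -> adeg n} :=
  match n return {hom adeg n.+1 -> adeg n} with
  | 0 => aug0 A
  | m.+1 => face (inord i : 'I_m.+2)
  end.

Definition adegen n (i : nat) : {hom adeg n.+1 -> adeg n.+2} :=
  degen (inord i : 'I_n.+1).

Lemma incr_inord n i : i <= n -> incr (inord i : 'I_n.+1) = inord i.+1.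
Proof. by move=> lin; apply: val_inj; rewrite /= inordK // inordK. Qed.

Lemma keep_inord n i : i <= n -> keep (inord i : 'I_n.+1) = inord i.
Proof. by move=> lin; apply: val_inj; rewrite /= inordK // inordK // ltnS leqW. Qed.

Lemma aface_aface n i j x : i <= j -> j <= n ->
  aface n i (aface n.+1 j.+1 x) = aface n j (aface n.+1 i x).
Proof.
case: n x => [|n] x lij ljn.
  move: ljn lij; rewrite leqn0 => /eqP ->; rewrite leqn0 => /eqP -> /=.
  have -> : inord 1 = ord_max :> 'I_2 by apply: val_inj; rewrite /= inordK.
  have -> : inord 0 = ord0 :> 'I_2 by apply: val_inj; rewrite /= inordK.
  by rewrite aug0P.
have lin := leq_trans lij ljn.
by rewrite /aface -(incr_inord ljn) -(keep_inord lin) face_face ?inordK.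
Qed.

Lemma aface_adegen_lt n i j x : i <= j -> j <= n ->
  aface n.+2 i (adegen n.+1 j.+1 x) = adegen n j (aface n.+1 i x).
Proof.
move=> lij ljn; have lin := leq_trans lij ljn.
rewrite /aface /adegen -(incr_inord ljn) -(keep_inord (leqW lin)).
by rewrite face_degen_lt // !inordK // ltnS leqW.
Qed.

Lemma aface_adegen_eq n i x : i <= n -> aface n.+1 i (adegen n i x) = x.
Proof. by move=> lin; rewrite /aface /adegen -(keep_inord lin) face_degen_eq. Qed.

Lemma aface_adegen_succ n i x : i <= n -> aface n.+1 i.+1 (adegen n i x) = x.
Proof. by move=> lin; rewrite /aface /adegen -(incr_inord lin) face_degen_succ. Qed.

Lemma aface_adegen_gt n i j x : j < i -> i <= n.+1 ->
  aface n.+2 i.+1 (adegen n.+1 j x) = adegen n j (aface n.+1 i x).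
Proof.
move=> lji lin; have ljn : j <= n by rewrite -ltnS (leq_trans lji).
rewrite /aface /adegen -(incr_inord lin) -(keep_inord ljn).
by rewrite face_degen_gt // !inordK // ltnS.
Qed.

Lemma aface_adegen1 n r t : r <= n -> (forall i, i < r -> aface n i t = 1) ->
  forall i, i < r -> aface n.+1 i (adegen n r t) = 1.
Proof.
case: r => // r; case: n t => // n t lrn t1 i lir.
by rewrite aface_adegen_lt // t1 // gmulf1.
Qed.

Definition cyclic n : adeg n -> Prop :=
  match n return adeg n -> Prop with
  | 0 => fun=> True
  | m.+1 => fun t => forall i, i <= m -> aface m i t = 1
  end.

(** The identities that y 0, ..., y n must satisfy to be the faces of one element of degree n+1;
    values beyond n are junk. In degree 0 there is a single face, hence no condition. *)
Definition spherical n : (nat -> adeg n) -> Prop :=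
  match n return (nat -> adeg n) -> Prop with
  | 0 => fun=> True
  | m.+1 => fun y => forall i j, i <= j -> j <= m -> aface m i (y j.+1) = aface m j (y i)
  end.

Lemma spherical_faces n (x : adeg n.+1) : spherical (fun i => aface n i x).
Proof. by case: n x => // n x i j lij ljn; rewrite aface_aface. Qed.

Lemma sphericalM n (y z : nat -> adeg n) :
  spherical y -> spherical z -> spherical (fun i => y i * z i).
Proof. by case: n y z => // n y z sy sz i j lij ljn; rewrite !gmulfM sy ?sz. Qed.

Lemma sphericalV n (y : nat -> adeg n) :
  spherical y -> spherical (fun i => (y i)^-1).
Proof. by case: n y => // n y sy i j lij ljn; rewrite !gmulfV sy. Qed.

(** * Horn and sphere fillers inside a simplicial subgroup *)

Section Fillers.
Variable W : forall n, adeg n -> Prop.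
Hypothesis W1 : forall n, W (1 : adeg n).
Hypothesis WM : forall n (x y : adeg n), W x -> W y -> W (x * y).
Hypothesis WV : forall n (x : adeg n), W x -> W x^-1.
Hypothesis Wface : forall n i (x : adeg n.+1), i <= n -> W x -> W (aface n i x).
Hypothesis Wdegen : forall n i (x : adeg n.+1), i <= n -> W x -> W (adegen n i x).

(** Moore's proof that simplicial groups are Kan, run inside [W]. Face r is repaired by the
    degeneracy s_r of the error [t]; the faces of [t] below r are trivial, so the faces already
    matched do not move. *)
Lemma horn_filler n (y : nat -> adeg n.+1) : (forall i, i <= n -> W (y i)) ->
  (forall i j, i <= j -> j < n -> aface n i (y j.+1) = aface n j (y i)) ->
  forall r, r <= n.+1 -> exists w, W w /\ forall i, i < r -> aface n.+1 i w = y i.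
Proof.
move=> Wy sy; elim=> [|r IH] lrn; first by exists 1.
have [w [Ww wy]] := IH (ltnW lrn); rewrite ltnS in lrn.
pose t := (aface n.+1 r w)^-1 * y r.
have t1 i : i < r -> aface n i t = 1.
  case: r @t lrn wy {IH} => // r t lrn wy lir; rewrite gmulfM gmulfV.
  by rewrite aface_aface ?(ltnW lrn) // wy ?(leq_trans lir) // sy ?mulVg.
exists (w * adegen n r t); split.
  by apply: WM => //; apply/Wdegen/WM/Wy => //; apply/WV/Wface => //; apply: leqW.
move=> i; rewrite ltnS leq_eqVlt gmulfM => /orP[/eqP->|lir].
  by rewrite aface_adegen_eq // mulgA mulgV mul1g.
by rewrite aface_adegen1 // mulg1 wy.
Qed.

(** Acyclicity of the augmented Moore complex of [W]. For n = 0 it says that the augmentation of [W]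
    is onto. *)
Definition exact_on := forall n (t : adeg n), W t -> cyclic t ->
  exists b : adeg n.+1,
    [/\ W b, forall i, i < n -> aface n i b = 1 & aface n n b = t].

(** Fill the horn that omits the last face. The error in that face is cyclic, so exactness makes it
    the last face of an element with all other faces trivial, and multiplying by this element
    corrects it. *)
Lemma sphere_filler n (y : nat -> adeg n) : exact_on ->
  (forall i, i <= n -> W (y i)) -> spherical y ->
  exists z, W z /\ forall i, i <= n -> aface n i z = y i.
Proof.
move=> exW; case: n y => [|n] y Wy sy.
  have [b [Wb _ b0]] := exW 0 (y 0) (Wy 0 isT) I.
  by exists b; split=> // i; rewrite leqn0 => /eqP->.
have [|w [Ww wy]] := @horn_filler n y (fun i lin => Wy i (leqW lin)) _ n.+1 (leqnn _).
  by move=> i j lij /ltnW; apply: sy.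
have [||b [Wb b1 bn]] := exW n.+1 ((aface n.+1 n.+1 w)^-1 * y n.+1).
- by apply: WM; [apply/WV/Wface|apply: Wy].
- move=> i lin; rewrite gmulfM gmulfV aface_aface // wy // sy //; exact: mulVg.
exists (w * b); split; first exact: WM.
move=> i; rewrite leq_eqVlt gmulfM => /orP[/eqP->|lin].
  by rewrite bn mulgA mulgV mul1g.
by rewrite b1 // wy // mulg1.
Qed.

Lemma aface_adegen_cyclic n (t : adeg n.+1) i j : cyclic t -> i <= n.+1 -> j <= n ->
  aface n.+1 i (adegen n j t) = if (i == j) || (i == j.+1) then t else 1.
Proof.
move=> ct lin ljn; have [->|nij] := eqVneq i j; first exact: aface_adegen_eq.
have [->|nij'] := eqVneq i j.+1; first exact: aface_adegen_succ.
case: n t ct lin ljn => [|n] t ct lin ljn.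
  by case: i j lin nij nij' ljn => [|[]] // [|[]].
have [lij|lji|eij] := ltngtP i j; last by rewrite eij eqxx in nij.
  by rewrite aface_adegen1 // => i' li'; apply: ct; lia.
case: i nij nij' lin lji => // i nij nij' lin lji.
have lji' : j < i by lia.
by rewrite aface_adegen_gt // ct ?gmulf1.
Qed.

(* Multiplying by a degeneracy of t moves the only nontrivial face up by one. *)
Lemma move_boundary n (t : adeg n.+1) j (b : adeg n.+2) : W t -> cyclic t ->
  j <= n.+1 -> W b -> (forall i, i <= n.+1 -> i != j -> aface n.+1 i b = 1) ->
  aface n.+1 j b = t ->
  exists b' : adeg n.+2, [/\ W b', forall i, i < n.+1 -> aface n.+1 i b' = 1
    & aface n.+1 n.+1 b' = t].
Proof.
move=> Wt ct; have [k] := ubnPeq (n.+1 - j); elim: k j b => [|k IH] j b.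
  rewrite eqn0Ngt subn_gt0 -leqNgt => ljn ljn' Wb b1 bt.
  have ej : j = n.+1 by apply/eqP; rewrite eqn_leq ljn ljn'.
  rewrite ej in b1 bt; exists b; split=> // i lin.
  by apply: b1; [exact: ltnW|rewrite neq_ltn lin].
move=> ekj ljn Wb b1 bt.
have ljn' : j < n.+1 by rewrite -subn_gt0 (eqP ekj).
apply: (IH j.+1 (b^-1 * adegen n j t)) => //.
- by rewrite subnS (eqP ekj).
- by apply: WM; [exact: WV|apply: Wdegen].
- move=> i lin nij; rewrite gmulfM gmulfV.
  rewrite aface_adegen_cyclic // (negPf nij) orbF.
  by case: eqP => [->|/eqP nij']; rewrite ?bt ?mulVg // b1 // invg1 mul1g.
- by rewrite gmulfM gmulfV b1 ?invg1 ?mul1g ?aface_adegen_succ // neq_ltn ltnSn orbT.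
Qed.

End Fillers.
End AugmentedFaces.

(** * Lifting maps and homotopies along bases *)

Lemma dependent_choice_seq (X : nat -> Type) (R : forall n, X n -> X n.+1 ->
  Prop) (x0 : X 0) :
  (forall n x, exists y, R n x y) ->
  exists f : forall n, X n, f 0 = x0 /\ forall n, R n (f n) (f n.+1).
Proof.
move=> H; pose next n x := projT1 (cid (H n x)).
pose f := fix f n : X n := if n is m.+1 then next m (f m) else x0.
by exists f; split=> // n; rewrite /= /next; case: cid.
Qed.

Section Bases.
Variables (F : groupType) (B : F -> Prop).
Hypothesis basisB : is_basis B.

(** [is_basis] is a universal property, so generation has to be extracted from it: the homomorphism
    F -> S fixing the basis, followed by the inclusion, agrees with the identity on the basis and so
    everywhere. *)
Lemma basis_ind (S : subgroup F) : (forall b, B b -> S b) -> forall x, S x.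
Proof.
move=> BS x.
pose g b : subgroup_type S :=
  match pselect (S b) with left Sb => in_subgroup Sb | right _ => 1 end.
have [[r rB] _] := basisB g.
have incM : {morph (fun y : subgroup_type S => val y) : a b / a * b}.
  by move=> a b; apply: valM.
have [_ ext] := basisB id.
have <- : hom_comp (hom_of incM) r x = x; last exact: subgroup_typeP.
apply: (ext (hom_comp (hom_of incM) r) idfun) => // b Bb.
rewrite hom_compE rB // /g.
by case: pselect => // /(_ (BS b Bb)).
Qed.

Definition multiplicative_rel (H : groupType) (R : F -> H -> Prop) :=
  [/\ R 1 1, forall x y a b, R x a -> R y b -> R (x * y) (a * b)
    & forall x a, R x a -> R x^-1 a^-1].

(** The engine of every lift: [R] will collect prescribed faces and prescribed images. Values are
    chosen on the basis, and the x with [R x (f x)] form a subgroup. *)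
Lemma basis_hom (H : groupType) (R : F -> H -> Prop) : multiplicative_rel R ->
  (forall x, exists a, R x a) -> exists f : {hom F -> H}, forall x, R x (f x).
Proof.
move=> [R1 RM RV] /choice[g gR]; have [[f fg] _] := basisB g; exists f.
have S1 : R 1 (f 1) by rewrite gmulf1.
have SM x y : R x (f x) -> R y (f y) -> R (x * y) (f (x * y)).
  by rewrite gmulfM; apply: RM.
have SV x : R x (f x) -> R x^-1 (f x^-1) by rewrite gmulfV; apply: RV.
by apply: (@basis_ind (Subgroup S1 SM SV)) => b Bb /=; rewrite fg.
Qed.

End Bases.

Section FamilyLift.
Variables (K T : nat -> groupType).
Hypothesis K_basis : forall n, exists B : K n.+1 -> Prop, is_basis B.

Local Notation homs n := (nat -> {hom K n -> T n}).

Variables (Good : forall n, homs n -> Prop).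
Variable Pres : forall n, homs n -> nat -> K n.+1 -> T n.+1 -> Prop.
Hypothesis PresM : forall n w j, multiplicative_rel (@Pres n w j).
Hypothesis fillers : forall n w, Good w -> forall j x, exists z, @Pres n w j x z.
Hypothesis Good_next : forall n (w : homs n) (w' : homs n.+1), Good w ->
  (forall j x, Pres w j x (w' j x)) -> Good w'.

(** The recursion shared by maps, vertices of homotopies and prisms of homotopies; the index j
    serves the latter two, where a degree carries several maps. [Good] is the invariant that makes
    the faces prescribed in the next degree compatible, so that fillers exist. *)
Lemma family_lift (w0 : homs 0) : Good w0 ->
  exists w : forall n, homs n,
    [/\ w 0 = w0, forall n, Good (w n) & forall n j x, Pres (w n) j x (w n.+1 j x)].
Proof.
move=> G0; pose X n := {w : homs n | Good w}.
pose R n (w : X n) (w' : X n.+1) := forall j x, Pres (sval w) j x (sval w' j x).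
have [n [w Gw]|f [f0 fS]] := @dependent_choice_seq X R (exist _ w0 G0).
  have [B basisB] := K_basis n.
  have H j : exists f : {hom K n.+1 -> T n.+1}, forall x, Pres w j x (f x).
    by apply: (basis_hom basisB) => //; apply: fillers.
  have [w' w'P] := choice H.
  by exists (exist _ w' (Good_next Gw w'P)).
exists (fun n => sval (f n)); split=> // [|n]; first by rewrite f0.
exact: (svalP (f n)).
Qed.

End FamilyLift.

(* Compatibility with degeneracies is not required: homotopy groups only see the
   faces, and a map may then be chosen freely on every basis element. *)
Record ahom (A A' : asgroup) := AHom {
  ahom_deg :> forall n, {hom adeg A n -> adeg A' n};
  ahom_face : forall n i x, i <= n ->
    ahom_deg n (aface A n i x) = aface A' n i (ahom_deg n.+1 x)
}.

Section AHomComp.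
Variables (A B C : asgroup) (g : ahom B C) (f : ahom A B).

Lemma ahom_comp_face n i x : i <= n ->
  hom_comp (g n) (f n) (aface A n i x) = aface C n i (hom_comp (g n.+1) (f n.+1) x).
Proof. by move=> lin; rewrite !hom_compE ahom_face // ahom_face. Qed.

Definition ahom_comp : ahom A C := AHom ahom_comp_face.

Definition ahom_id : ahom A A :=
  @AHom A A (fun n => idfun) (fun _ _ _ _ => erefl).

End AHomComp.

(* The vertex maps g_0, ..., g_n of a homotopy in degree n satisfy
   d_i g_j = g_(vshift i j) d_i. *)
Definition vshift i j := if i < j then j.-1 else j.

(* A simplicial homotopy h without its degeneracy identities; [hg j] is the
   common value of d_j h_j and d_j h_(j-1). *)
Record htpy (K A : asgroup) (u u' : ahom K A) := Htpy {
  hg : forall n, nat -> {hom adeg K n -> adeg A n};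
  hh : forall n, nat -> {hom adeg K n -> adeg A n.+1};
  hg_first : forall n x, hg n 0 x = u n x;
  hg_last : forall n j x, n <= j -> hg n j x = u' n x;
  hg_face : forall n i j x, i <= n -> j <= n.+1 ->
    aface A n i (hg n.+1 j x) = hg n (vshift i j) (aface K n i x);
  hh_eq : forall n j x, j < n -> aface A n j (hh n j x) = hg n j x;
  hh_succ : forall n j x, j < n -> aface A n j.+1 (hh n j x) = hg n j.+1 x;
  hh_lt : forall n i j x, i < j -> j <= n ->
    aface A n.+1 i (hh n.+1 j x) = hh n j.-1 (aface K n i x);
  hh_gt : forall n i j x, j.+1 < i -> i <= n.+1 ->
    aface A n.+1 i (hh n.+1 j x) = hh n j (aface K n i.-1 x)
}.

Section HtpyPrecomp.
Variables (J K A : asgroup) (u u' : ahom K A) (H : htpy u u') (a : ahom J K).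

Definition htpy_precomp : htpy (ahom_comp u a) (ahom_comp u' a).
Proof.
apply: (@Htpy _ _ _ _ (fun n j => hom_comp (hg H n j) (a n))
  (fun n j => hom_comp (hh H n j) (a n))).
- by move=> n x; rewrite !hom_compE hg_first.
- by move=> n j x lnj; rewrite !hom_compE hg_last.
- by move=> n i j x lin ljn; rewrite !hom_compE hg_face // ahom_face.
- by move=> n j x ljn; rewrite !hom_compE hh_eq.
- by move=> n j x ljn; rewrite !hom_compE hh_succ.
- by move=> n i j x lij ljn; rewrite !hom_compE hh_lt // ahom_face //; lia.
- by move=> n i j x lji lin; rewrite !hom_compE hh_gt // ahom_face //; lia.
Defined.

End HtpyPrecomp.

Section RelativeLifting.
Variables (K A : asgroup) (kappa : Type) (M : kappa -> asgroup).
Variable p : forall k, ahom A (M k).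
Variable valid : forall n, (forall k, adeg (M k) n) -> Prop.

Hypothesis K_basis : forall n, exists B : K n -> Prop, is_basis B.

(** The right lifting property against the inclusion of a sphere into a simplex. The targets are
    indexed by [void] (absolute case), [unit] (one map) or [bool] (the two maps out of the corner
    K); [valid] then cuts the pullback out of the product. *)
Definition relative_filling := forall n (z' : forall k, adeg (M k) n.+1) (y : nat ->
  adeg A n),
  valid z' -> spherical y ->
  (forall k i, i <= n -> p k n (y i) = aface (M k) n i (z' k)) ->
  exists z, (forall i, i <= n -> aface A n i z = y i) /\ forall k, p k n.+1 z = z' k.

Hypothesis fill : relative_filling.

Section Lift.
Variable v : forall k, ahom K (M k).
Hypothesis v_valid : forall n x, valid (fun k => v k n x).
Variable u0 : {hom ag K -> ag A}.
Hypothesis pu0 : forall k x, p k 0 (u0 x) = v k 0 x.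

Lemma relative_lift : exists u : ahom K A,
  (forall x, u 0 x = u0 x) /\ forall k n x, p k n (u n x) = v k n x.
Proof.
pose Good n (w : nat -> {hom adeg K n -> adeg A n}) :=
  (forall k x, p k n (w 0 x) = v k n x) /\
  forall x, spherical (fun i => w 0 (aface K n i x)).
pose Pres n (w : nat -> {hom adeg K n -> adeg A n}) (j : nat) x z :=
  (forall i, i <= n -> aface A n i z = w 0 (aface K n i x)) /\
  forall k, p k n.+1 z = v k n.+1 x.
have [||n w [wp ws] j x|n w w' [wp ws] ww'||w [w0 wG wP]] :=
  @family_lift (adeg K) (adeg A) _ Good Pres _ _ _ (fun=> u0).
- exact: K_basis.
- move=> n w j; split.
  + by split=> [i _|k]; rewrite !gmulf1.
  + move=> x y a b [fx px] [fy py].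
    by split=> [i lin|k]; rewrite !gmulfM ?fx ?fy ?px ?py.
  + by move=> x a [fx px]; split=> [i lin|k]; rewrite !gmulfV ?fx ?px.
- have [|z [zf zp]] := fill (v_valid x) (ws x).
    by move=> k i lin; rewrite wp ahom_face.
  by exists z.
- split=> [k x|x i j lij ljn]; first by have [_ ->] := ww' 0 x.
  have [f1 _] := ww' 0 (aface K n.+1 j.+1 x).
  have [f2 _] := ww' 0 (aface K n.+1 i x).
  by rewrite f1 ?(leq_trans lij) // f2 // aface_aface.
- by split.
- have uf n i x : i <= n -> w n 0 (aface K n i x) = aface A n i (w n.+1 0 x).
    by have [f _ lin] := wP n 0 x; rewrite f.
  exists (@AHom K A (fun n => w n 0) uf); split=> [x|k n x] /=.
    by rewrite w0.
  by have [+ _] := wG n; apply.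
Qed.

End Lift.

(** * Lifting homotopies: vertices, then prisms *)

Section HomotopyLift.
Variables (u u' : ahom K A) (v v' : forall k, ahom K (M k)).
Variable HM : forall k, htpy (v k) (v' k).
Hypothesis pu : forall k n x, p k n (u n x) = v k n x.
Hypothesis pu' : forall k n x, p k n (u' n x) = v' k n x.
Hypothesis uu' : forall x, u 0 x = u' 0 x.
Hypothesis hg_valid : forall n j x, valid (fun k => hg (HM k) n j x).
Hypothesis hh_valid : forall n j x, j < n -> valid (fun k => hh (HM k) n j x).

(** In the shifted degree n a homotopy is a chain of n prisms joining n+1 vertices, from u to u'.
    The vertices are the faces shared by consecutive prisms, so they are fixed in all degrees before
    any prism is filled. *)
Lemma homotopy_vertices : exists g : forall n, nat -> {hom adeg K n -> adeg A n},
  [/\ forall n x, g n 0 x = u n x, forall n j x, n <= j -> g n j x = u' n x,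
    forall n i j x, i <= n -> j <= n.+1 ->
      aface A n i (g n.+1 j x) = g n (vshift i j) (aface K n i x)
  & forall k n j x, p k n (g n j x) = hg (HM k) n j x].
Proof.
pose Good n (w : nat -> {hom adeg K n -> adeg A n}) :=
  [/\ forall x, w 0 x = u n x, forall j x, n <= j -> w j x = u' n x,
    forall k j x, p k n (w j x) = hg (HM k) n j x
  & forall j x, 0 < j <= n -> spherical (fun i => w (vshift i j) (aface K n i x))].
(* Both ends of the chain are forced, and all indices past the end repeat u'; only the interior
   vertices come from the filling property. *)
pose Pres n (w : nat -> {hom adeg K n -> adeg A n}) (j : nat) x z :=
  if j == 0 then z = u n.+1 x else if n < j then z = u' n.+1 x else
  (forall i, i <= n -> aface A n i z = w (vshift i j) (aface K n i x)) /\
  forall k, p k n.+1 z = hg (HM k) n.+1 j x.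
have Pface n w (w' : nat -> {hom adeg K n.+1 -> adeg A n.+1}) : Good n w ->
  (forall j x, Pres n w j x (w' j x)) ->
    forall i j x, i <= n -> j <= n.+1 ->
    aface A n i (w' j x) = w (vshift i j) (aface K n i x).
  move=> [wu wu' wp ws] ww' i j x lin ljn; have := ww' j x.
  rewrite /Pres; have [->|nj0] := eqVneq j 0.
    by move=> ->; rewrite -ahom_face // /vshift ltn0 wu.
  have [ljn' ->|ljn' [-> //]] := ltnP n j.
  rewrite -ahom_face // /vshift; have -> : i < j by lia.
  by rewrite wu' //; lia.
have [||n w [wu wu' wp ws] j x|n w w' Gw ww'||w [w0 wG wP]] :=
  @family_lift (adeg K) (adeg A) _ Good Pres _ _ _ (fun=> u 0).
- exact: K_basis.
- move=> n w j; rewrite /Pres; case: eqP => _; last case: ltnP => _.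
  + split=> [|x y a b -> ->|x a ->]; first by rewrite gmulf1.
      by rewrite gmulfM.
    by rewrite gmulfV.
  + split=> [|x y a b -> ->|x a ->]; first by rewrite gmulf1.
      by rewrite gmulfM.
    by rewrite gmulfV.
  split.
  + by split=> [i _|k]; rewrite !gmulf1.
  + move=> x y a b [fx px] [fy py].
    by split=> [i lin|k]; rewrite !gmulfM ?fx ?fy ?px ?py.
  + by move=> x a [fx px]; split=> [i lin|k]; rewrite !gmulfV ?fx ?px.
- rewrite /Pres; case: eqP => nj0; first by exists (u n.+1 x).
  case: ltnP => ljn; first by exists (u' n.+1 x).
  have jn : 0 < j <= n by rewrite ljn andbT lt0n; apply/eqP.
  have [|z [zf zp]] := fill (@hg_valid n.+1 j x) (ws j x jn); last by exists z.
  by move=> k i lin; rewrite wp hg_face // leqW.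
- have Pf := Pface n w w' Gw ww'; case: Gw => [wu wu' wp ws]; split.
  + by move=> x; have := ww' 0 x.
  + by move=> j x lnj; have := ww' j x; rewrite /Pres lnj; case: j lnj.
  + move=> k j x; have := ww' j x; rewrite /Pres; have [-> ->|nj0] := eqVneq j 0.
      by rewrite pu hg_first.
    by have [lnj ->|lnj [_ -> //]] := ltnP n j; rewrite pu' hg_last.
  + move=> j x /andP[j0 ljn] i i' lii' li'n.
    have vn a : vshift a j <= n.+1 by rewrite /vshift; case: ifP; lia.
    rewrite !Pf ?vn //; last exact: leq_trans li'n.
    rewrite aface_aface //; congr (w _ _).
    by rewrite /vshift; do !case: ifP; lia.
- split=> // k j x.
  case: j => [|j]; first by rewrite pu hg_first.
  by rewrite uu' pu' hg_last.
- exists w; split.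
  + by move=> n x; have [+ _ _ _] := wG n; apply.
  + by move=> n; have [_ + _ _] := wG n.
  + by move=> n; apply: Pface (wG n) (wP n).
  + by move=> k n; have [_ _ + _] := wG n.
Qed.

Lemma relative_homotopy : exists H : htpy u u', forall k n j x,
  p k n (hg H n j x) = hg (HM k) n j x /\
  (j < n -> p k n.+1 (hh H n j x) = hh (HM k) n j x).
Proof.
have [g [gu gu' gf gp]] := homotopy_vertices.
(* The i-th face that the homotopy identities impose on the j-th prism: an earlier prism on a face
   of x, or one of the two adjacent vertices. *)
pose hface n (w : nat -> {hom adeg K n -> adeg A n.+1}) (j i : nat) x :=
  if i < j then w j.-1 (aface K n i x) else if i == j then g n.+1 j x else
  if i == j.+1 then g n.+1 j.+1 x else w j (aface K n i.-1 x).
pose Good n (w : nat -> {hom adeg K n -> adeg A n.+1}) :=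
  (forall k j x, j < n -> p k n.+1 (w j x) = hh (HM k) n j x) /\
  forall j x, j <= n -> spherical (fun i => hface n w j i x).
pose Pres n (w : nat -> {hom adeg K n -> adeg A n.+1}) (j : nat) x z :=
  j <= n -> (forall i, i <= n.+1 -> aface A n.+1 i z = hface n w j i x) /\
    forall k, p k n.+2 z = hh (HM k) n.+1 j x.
(* Degree 0 has no prisms, so the family starts from a trivial default. The sphere condition there
   only says that u and u' have the same augmentation in degree 1. *)
have [||n w [wp ws] j x|n w w' [wp ws] ww'||w [w0 wG wP]] :=
  @family_lift (adeg K) (fun n => adeg A n.+1) _ Good Pres _ _ _
    (fun=> hom_of (fun x y => esym (mulg1 1))).
- exact: K_basis.
- move=> n w j; split.
  + by move=> _; split=> [i _|k]; rewrite /hface !gmulf1 //; do !case: ifP.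
  + move=> x y a b Hx Hy ljn; have [fx px] := Hx ljn; have [fy py] := Hy ljn.
    split=> [i lin|k]; rewrite !gmulfM ?fx ?fy ?px ?py // /hface.
    by do !case: ifP => // _; rewrite !gmulfM.
  + move=> x a Hx ljn; have [fx px] := Hx ljn.
    split=> [i lin|k]; rewrite !gmulfV ?fx ?px // /hface.
    by do !case: ifP => // _; rewrite !gmulfV.
- have [ljn|lnj] := leqP j n; last by exists 1 => ljn; rewrite leqNgt lnj in ljn.
  have [|z [zf zp]] := fill (@hh_valid n.+1 j x ljn) (ws j x ljn); last by exists z.
  move=> k i lin; rewrite /hface.
  case: ltnP => lij; first by rewrite hh_lt // wp //; lia.
  case: eqP => [->|nij]; first by rewrite gp hh_eq.
  case: eqP => [->|nij']; first by rewrite gp hh_succ.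
  by rewrite hh_gt ?wp //; lia.
- have wf j x i : j <= n -> i <= n.+1 -> aface A n.+1 i (w' j x) = hface n w j i x.
    by move=> ljn lin; have [-> //] := ww' j x ljn.
  split=> [k j x ljn|j x ljn i i' lii' li'n]; first by have [] := ww' j x ljn.
  (* Compatibility of the faces i and i'+1: first the position of i'+1 relative to j and j+1, then
     that of i. Each case is a simplicial identity or the face rule of the vertices. *)
  rewrite [in LHS]/hface; case: ltnP => c1.
    have c2 : i < j by lia.
    rewrite /hface c2 !wf /hface; try lia.
    have -> : i < j.-1 by lia.
    have -> : i' < j.-1 by lia.
    by rewrite aface_aface //; lia.
  case: eqP => c2.
    have c3 : i < j by lia.
    rewrite gf ?(leq_trans lii') // 1?leqW // /vshift c3 /hface c3 wf /hface; try lia.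
    have -> : (i' < j.-1) = false by lia.
    by have -> : i' == j.-1 by lia.
  case: eqP => c3.
    rewrite gf; try lia.
    rewrite /vshift /hface.
    have -> : i < j.+1 by lia.
    case: ltnP => c4.
      rewrite wf /hface; try lia.
      have -> : (i' < j.-1) = false by lia.
      have -> : (i' == j.-1) = false by lia.
      have -> : i' == j.-1.+1 by lia.
      by congr (g _ _ _); lia.
    have -> : i == j by lia.
    rewrite gf; try lia.
    rewrite /vshift; have -> : (i' < j) = false by lia.
    by have -> : i = i' by lia.
  have jn : j <= n by lia.
  rewrite /= /hface; case: ltnP => c4.
    rewrite !wf /hface ?c4; try lia.
    have -> : (i' < j.-1) = false by lia.
    have -> : (i' == j.-1) = false by lia.
    have -> : (i' == j.-1.+1) = false by lia.
    have -> : i' = i'.-1.+1 by lia.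
    by rewrite aface_aface //; lia.
  case: eqP => c5.
    rewrite wf ?gf /hface /vshift; try lia.
    have -> : (i < j) = false by lia.
    have -> : i == j by lia.
    by have -> : (i' < j) = false by lia.
  case: eqP => c6.
    rewrite wf ?gf /hface /vshift; try lia.
    have -> : (i < j) = false by lia.
    have -> : (i == j) = false by lia.
    have -> : i == j.+1 by lia.
    by have -> : (i' < j.+1) = false by lia.
  rewrite !wf /hface; try lia.
  have -> : (i < j) = false by lia.
  have -> : (i == j) = false by lia.
  have -> : (i == j.+1) = false by lia.
  have -> : (i' < j) = false by lia.
  have -> : (i' == j) = false by lia.
  have -> : (i' == j.+1) = false by lia.
  have -> : i' = i'.-1.+1 by lia.
  by rewrite aface_aface //; lia.
- split=> // j x; rewrite leqn0 => /eqP-> i i'.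
  rewrite leqn0 => li'0 /eqP ei'; move: li'0; rewrite ei' leqn0 => /eqP->.
  exact: etrans (gf 0 0 1%N x isT isT) (esym (gf 0 0 0 x isT isT)).
have wf n j x i : j <= n -> i <= n.+1 ->
    aface A n.+1 i (w n.+1 j x) = hface n (w n) j i x.
  by move=> ljn lin; have [-> //] := wP n j x ljn.
unshelve eexists.
  apply: (@Htpy _ _ _ _ g w) => //.
  - case=> // n j x ljn; rewrite wf //; last exact: leqW.
    by rewrite /hface ltnn eqxx.
  - case=> // n j x ljn; rewrite wf // /hface.
    by rewrite ltnNge leqnSn /= (gtn_eqF (ltnSn j)) eqxx.
  - by move=> n i j x lij ljn; rewrite wf /hface ?lij //; lia.
  - move=> n i j x lji lin; rewrite wf /hface; try lia.
    have -> : (i < j) = false by lia.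
    have -> : (i == j) = false by lia.
    by have -> : (i == j.+1) = false by lia.
by move=> k n j x; split; [apply: gp|have [+ _] := wG n; apply].
Qed.

End HomotopyLift.
End RelativeLifting.

(** * Invariance of the homotopy groups modulo V *)

Record phom (K L : sgroup) := PHom {
  phom_deg :> forall n, {hom K n -> L n};
  phom_face : forall n (i : 'I_n.+2) x,
    phom_deg n (face i x) = face i (phom_deg n.+1 x)
}.

Definition phom_of_shom (K L : sgroup) (f : shom K L) : phom K L :=
  PHom (@shom_face K L f).

Section AHomOfSHom.
Variables (K L : asgroup) (f : shom K L) (f0 : {hom ag K -> ag L}).
Hypothesis f0P : forall x, f0 (aug0 K x) = aug0 L (f 0 x).

Definition ahom_of_shom : ahom K L.
Proof.
apply: (@AHom K L (fun n => match n return {hom adeg K n -> adeg L n} with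
                            | 0 => f0 | m.+1 => f m end)).
by case=> [|n] i x _; [apply: f0P|apply: shom_face].
Defined.

End AHomOfSHom.

Section PHomOfAHom.
Variables (K L : asgroup) (f : ahom K L).

Lemma phom_of_ahom_face n (i : 'I_n.+2) x :
  f n.+1 (face i x) = face i (f n.+2 x).
Proof.
have := @ahom_face _ _ f n.+1 i x (leq_ord i).
by rewrite /aface inord_val.
Qed.

Definition phom_of_ahom : phom K L := @PHom K L (fun n => f n.+1) phom_of_ahom_face.

End PHomOfAHom.

Section VerbalQuotientPHom.
Variables (V : laws) (K L : sgroup) (f : phom K L).

Definition vquot_phom_deg n : {hom vquot V K n -> vquot V L n} :=
  quotient_hom (@verbal_hom V _ _ (f n)).

Lemma vquot_phomE n x : vquot_phom_deg n (coset _ x) = coset _ (f n x).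
Proof. exact: quotient_homE. Qed.

Lemma face_coset (M : sgroup) n (i : 'I_n.+2) (x : M n.+1) :
  face i (coset _ x : vquot V M n.+1) = coset (verbal V (M n)) (face i x).
Proof. exact: vquot_faceE. Qed.

Lemma vquot_phom_face n (i : 'I_n.+2) x :
  vquot_phom_deg n (face i x) = face i (vquot_phom_deg n.+1 x).
Proof.
have [y ->] := coset_surj x.
by rewrite vquot_phomE !face_coset vquot_phomE phom_face.
Qed.

Definition vquot_phom : phom (vquot V K) (vquot V L) := PHom vquot_phom_face.

End VerbalQuotientPHom.

Section SimplicialKernelPHom.
Variables (K L K' L' : sgroup) (f : shom K L) (f' : shom K' L').
Variables (u : phom K K') (v : phom L L').
Hypothesis uv : forall n x, f' n (u n x) = v n (f n x).

Lemma sker_phom_subproof n x : ker (f n) x -> ker (f' n) (u n x).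
Proof. by rewrite /= /ker_set /= uv => ->; apply: gmulf1. Qed.

Definition sker_phom_deg n : {hom sker f n -> sker f' n} :=
  restr_hom (@sker_phom_subproof n).

Lemma sker_phom_face n (i : 'I_n.+2) x :
  sker_phom_deg n (face i x) = face i (sker_phom_deg n.+1 x).
Proof. by apply: val_inj; rewrite /= phom_face. Qed.

Definition sker_phom : phom (sker f) (sker f') := PHom sker_phom_face.

End SimplicialKernelPHom.

Section HomotopyPHom.
Variables (K L : sgroup) (f : phom K L) (n : nat).

Lemma cycle_set_phom x : cycles K n x -> cycles L n (f n x).
Proof.
rewrite /= /cycle_set; case: n x => // m x /= Zx i.
by rewrite -phom_face Zx gmulf1.
Qed.

Lemma boundary_set_phom x : boundaries K n x -> boundaries L n (f n x).
Proof.
move=> [a [da <-]]; exists (f n.+1 a); split; last by rewrite phom_face.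
by move=> i ni; rewrite -phom_face da // gmulf1.
Qed.

Definition homotopy_phom : {hom homotopy_group K n -> homotopy_group L n} :=
  @quotient_hom _ _ (preim_normal (cycle_incl K n) (boundaries K n))
    (preim_normal (cycle_incl L n) (boundaries L n)) (restr_hom cycle_set_phom)
    (fun x => @boundary_set_phom (val x)).

(** Injectivity and surjectivity on homotopy groups are stated on representatives, so that the
    diagram chases take place in the simplicial groups themselves. *)
Definition pi_inj := forall x,
  cycles K n x -> boundaries L n (f n x) -> boundaries K n x.

Definition pi_surj := forall y, cycles L n y ->
  exists x, cycles K n x /\ boundaries L n (y^-1 * f n x).

Lemma homotopy_phom_bij : pi_inj -> pi_surj -> bijective homotopy_phom.
Proof.
move=> fi fs.
have inj : injective homotopy_phom.
  apply: gmulf_inj => x; have [y ->] := coset_surj x.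
  rewrite quotient_homE => /coset_eq1 fy; apply/coset_eq1.
  by apply: fi => //; apply: subgroup_typeP.
have surj y : exists x, homotopy_phom x = y.
  have [z ->] := coset_surj y; have [x [cx bx]] := fs _ (subgroup_typeP z).
  exists (coset _ (in_subgroup cx)); rewrite quotient_homE.
  by apply/esym/cosetP.
by have [g gK] := choice surj; exists g => // x; apply: inj; rewrite gK.
Qed.

End HomotopyPHom.

Section MooreComplex.
Variable K : sgroup.

Definition moore n (a : K n.+1) := forall i : 'I_n.+2, i != ord_max -> face i a = 1.

Lemma mooreM n (a b : K n.+1) : moore a -> moore b -> moore (a * b).
Proof. by move=> ma mb i ni; rewrite gmulfM ma // mb // mulg1. Qed.

Lemma mooreV n (a : K n.+1) : moore a -> moore a^-1.
Proof. by move=> ma i ni; rewrite gmulfV ma // invg1. Qed.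

Lemma cycle_moore n (a : K n.+1) : cycles K n.+1 a -> moore a.
Proof. by move=> ca i _; apply: ca. Qed.

Lemma moore_cycle n (a : K n.+1) : moore a -> face ord_max a = 1 -> cycles K n.+1 a.
Proof. by move=> ma a1 i; have [->|/ma] := eqVneq i ord_max. Qed.

Lemma boundary_cycle n x : boundaries K n x -> cycles K n x.
Proof.
case: n x => // n x [a [ma <-]] i.
have -> : ord_max = incr (ord_max : 'I_n.+2) by apply: val_inj.
rewrite face_face ?leq_ord // ma ?gmulf1 //.
by apply: contraTneq (ltn_ord i) => /(congr1 val) /= ->; rewrite ltnn.
Qed.

Lemma boundaries_in n (a : K n.+1) : moore a -> boundaries K n (face ord_max a).
Proof. by move=> ma; exists a. Qed.

Lemma boundaries_trans n (x y : K n) :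
  boundaries K n (x^-1 * y) -> boundaries K n y -> boundaries K n x.
Proof.
move=> bxy by_; have := subgroupM by_ (subgroupV bxy).
by rewrite invgM invgK mulgA mulgV mul1g.
Qed.

End MooreComplex.

Lemma phom_moore (K L : sgroup) (u : phom K L) n (a : K n.+1) :
  moore a -> moore (u n.+1 a).
Proof. by move=> ma i ni; rewrite -phom_face ma // gmulf1. Qed.

(* Forgetting the augmentation: the homotopy groups only see the simplicial
   group, and in degree 0 every element is a cycle. *)
Definition unaugmented (K : sgroup) : asgroup :=
  @ASGroup K (K 0) (hom_of (fun x y => esym (mulg1 1))) (fun _ => erefl).

Section Unaugmented.
Variable K : sgroup.

Lemma cyclic_cycles n (x : K n) : cyclic (x : adeg (unaugmented K) n.+1) <-> cycles K n x.
Proof.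
case: n x => [|n] x; first by split.
split=> [cx i|cx i lin]; last by rewrite /aface; apply: cx.
by have := cx i (leq_ord i); rewrite /aface inord_val.
Qed.

Lemma boundaries_aface n (b : K n.+1) x :
  (forall i, i < n.+1 -> aface (unaugmented K) n.+1 i b = 1) ->
  aface (unaugmented K) n.+1 n.+1 b = x -> boundaries K n x.
Proof.
move=> b1 bx; exists b; split=> [i ni|].
  rewrite -(inord_val i); apply: b1.
  by rewrite ltn_neqAle leq_ord andbT; apply: contraNneq ni => /(@ord_inj _ i ord_max) ->.
by rewrite -bx /=; congr (face _ b); apply: val_inj; rewrite /= inordK.
Qed.

(** Dividing [e j] by the degeneracy s_j of [t j] kills its face j and leaves (t j)^-1 t (j+1) in
    face j+1, all other faces being trivial. [move_boundary] carries this to the last face, and the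
    resulting boundaries telescope. *)
Lemma htpy_boundary n (t : nat -> K n) (e : nat -> K n.+1) :
  (forall j, j <= n.+1 -> cycles K n (t j)) ->
  (forall j, j <= n -> aface (unaugmented K) n.+1 j (e j) = t j) ->
  (forall j, j <= n -> aface (unaugmented K) n.+1 j.+1 (e j) = t j.+1) ->
  (forall i j, j <= n -> i <= n.+1 -> i != j -> i != j.+1 ->
     aface (unaugmented K) n.+1 i (e j) = 1) ->
  boundaries K n ((t 0)^-1 * t n.+1).
Proof.
move=> ct te te' e1; suff H j : j <= n.+1 -> boundaries K n ((t 0)^-1 * t j) by apply: H.
elim: j => [|j IH] ljn; first by rewrite mulVg; apply: subgroup1.
suff bj : boundaries K n ((t j)^-1 * t j.+1).
  have := subgroupM (IH (ltnW ljn)) bj.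
  by rewrite -mulgA (mulgA (t j)) mulgV mul1g.
have ctj : cyclic (t j : adeg (unaugmented K) n.+1) by apply/cyclic_cycles/ct/ltnW.
have ctj' : cyclic (t j.+1 : adeg (unaugmented K) n.+1) by apply/cyclic_cycles/ct.
pose s : adeg (unaugmented K) n.+2 := adegen (unaugmented K) n j (t j).
have [|||||||i lin nij||b [_ b1 bt]] := @move_boundary (unaugmented K) (fun _ _ => True)
  _ _ _ n ((t j)^-1 * t j.+1 : adeg (unaugmented K) n.+1) j.+1 (s^-1 * e j) => //.
- by move=> i lin; rewrite gmulfM gmulfV ctj // ctj' // invg1 mulg1.
- rewrite gmulfM gmulfV aface_adegen_cyclic // (negPf nij) orbF.
  by case: eqP => [->|/eqP nij']; rewrite ?te ?mulVg // e1 // invg1 mulg1.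
- by rewrite gmulfM gmulfV aface_adegen_cyclic // eqxx orbT te'.
by apply: boundaries_aface b1 bt.
Qed.

End Unaugmented.

(** * The five lemma for kernels, as a chase in Moore complexes *)

Section FiveLemma.
Variables (A B A' B' : sgroup) (f : shom A B) (f' : shom A' B').
Hypotheses (f_surj : degreewise_surjective f) (f'_surj : degreewise_surjective f').

(** All faces but the last of any preimage of b lie in the kernel of g. They form a horn there, and
    dividing by a filler in the kernel trivialises them without changing the image. *)
Lemma moore_lift (K L : sgroup) (g : shom K L) : degreewise_surjective g ->
  forall n (b : L n.+1), moore b -> exists a, moore a /\ g n.+1 a = b.
Proof.
move=> gs n b mb; have [a ab] := gs _ b.
pose W m : adeg (unaugmented K) m -> Prop :=
  if m is m'.+1 then fun x : K m' => g m' x = 1 else fun=> True.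
have [||||||i j lij ljn|w [/= Ww wa]] := @horn_filler (unaugmented K) W _ _ _ _ _ n
  (fun i => aface (unaugmented K) n.+1 i a) _ _ n.+1 (leqnn _).
- by case=> //= m; apply: gmulf1.
- by case=> //= m x y; rewrite gmulfM => -> ->; rewrite mulg1.
- by case=> //= m x; rewrite gmulfV => ->; rewrite invg1.
- by case=> //= m i x _; rewrite shom_face => ->; rewrite gmulf1.
- by move=> m i x _ /=; rewrite shom_degen => ->; rewrite gmulf1.
- move=> i lin /=; rewrite shom_face ab mb //.
  by apply/eqP => /(congr1 val); rewrite /= inordK; lia.
- by rewrite aface_aface // ltnW.
exists (a * w^-1); split=> [i ni|]; last by rewrite gmulfM gmulfV ab Ww invg1 mulg1.
have lin : i < n.+1.
  by rewrite ltn_neqAle leq_ord andbT; apply: contraNneq ni => /(@ord_inj _ i ord_max) ->.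
by have := wa _ lin; rewrite /= inord_val gmulfM gmulfV => ->; rewrite mulgV.
Qed.

Variables (u : phom A A') (v : phom B B').
Hypothesis uv : forall n x, f' n (u n x) = v n (f n x).
Hypotheses (u_inj : forall n, pi_inj u n) (u_surj : forall n, pi_surj u n).
Hypotheses (v_inj : forall n, pi_inj v n) (v_surj : forall n, pi_surj v n).

Lemma sker_boundaries (K L : sgroup) (g : shom K L) n (x : sker g n) (a : K n.+1) :
  moore a -> g n.+1 a = 1 -> face ord_max a = val x -> boundaries (sker g) n x.
Proof.
move=> ma a1 ax; exists (in_subgroup (a1 : ker (g n.+1) a)); split=> [i ni|].
  by apply: val_inj; rewrite /= ma.
exact: val_inj.
Qed.

Lemma sker_cycles (K L : sgroup) (g : shom K L) n (x : sker g n) :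
  cycles (sker g) n x <-> cycles K n (val x).
Proof.
case: n x => // n x; split=> cx i; first by have /(congr1 val) := cx i.
by apply: val_inj; apply: cx.
Qed.

(** If u x bounds y0 in the kernel of f', then x bounds some [a] in A, but f a need not vanish. As
    u(a)^-1 y0 is a cycle, it is u(c) up to a boundary; then v kills the class of f(ac), so f(ac)
    bounds some b, and a lift of b provides the last correction. The connecting map is thus replaced
    by surjectivity of u and injectivity of v one degree up. *)
Lemma sker_pi_inj n : pi_inj (sker_phom uv) n.
Proof.
move=> x /sker_cycles cx [y' [my' ey']].
have [y0 [my0 fy0 ey0]] : exists y0 : A' n.+1,
    [/\ moore y0, f' n.+1 y0 = 1 & face ord_max y0 = u n (val x)].
  exists (val y'); split; last by have /(congr1 val) := ey'.
    by move=> i ni; have /(congr1 val) := my' i ni.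
  exact: subgroup_typeP y'.
have [a [ma ea]] : boundaries A n (val x).
  by apply: u_inj => //; rewrite -ey0; apply: boundaries_in.
have fx1 : f n (val x) = 1 := subgroup_typeP x.
have cq : cycles A' n.+1 ((u n.+1 a)^-1 * y0).
  apply: moore_cycle; first by apply/mooreM/my0/mooreV/phom_moore.
  by rewrite gmulfM gmulfV -phom_face ea ey0 mulVg.
have [c [cc bc]] := u_surj cq.
have /v_inj [] : boundaries B' n.+1 (v n.+1 (f n.+1 (a * c))).
- have := boundary_set_phom (phom_of_shom f') bc.
  rewrite [phom_of_shom f' _ _]gmulfM gmulfV gmulfM gmulfV /= fy0 mulg1 invgK.
  by rewrite -gmulfM -!uv -!gmulfM.
- apply: moore_cycle.
    move=> i ni; rewrite -shom_face gmulfM ma // (cycle_moore cc) // mulg1.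
    exact: gmulf1.
  by rewrite -shom_face gmulfM ea cc mulg1.
move=> b [mb eb]; have [e [me fe]] := moore_lift f_surj mb.
apply: (@sker_boundaries _ _ _ _ _ (a * c * (face ord_max e)^-1)).
- apply: mooreM; first by apply: mooreM ma _; apply: cycle_moore.
  exact/mooreV/cycle_moore/boundary_cycle/boundaries_in.
- by rewrite gmulfM gmulfV shom_face fe eb mulgV.
- have ce := boundary_cycle (boundaries_in me).
  by rewrite !gmulfM gmulfV ea cc ce invg1 !mulg1.
Qed.

(** A preimage x of y up to the boundary of e is pushed into the kernel of f by a lift [a] of a
    bounding element of f x. The remaining obstruction is the cycle [q] of B' one degree up, which
    surjectivity of v removes. *)
Lemma sker_pi_surj n : pi_surj (sker_phom uv) n.
Proof.
move=> y /sker_cycles cy.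
have [x [cx [e [me ee]]]] := u_surj cy.
have fy1 : f' n (val y) = 1 := subgroup_typeP y.
have [b [mb eb]] : boundaries B n (f n x).
  apply: v_inj; first exact: (@cycle_set_phom _ _ (phom_of_shom f)).
  rewrite -uv; have -> : f' n (u n x) = f' n (face ord_max e).
    by rewrite ee gmulfM gmulfV fy1 invg1 mul1g.
  by rewrite shom_face; apply/boundaries_in/(phom_moore (phom_of_shom f')).
have [a [ma ea]] := moore_lift f_surj mb.
pose q := f' n.+1 e * (v n.+1 b)^-1.
have cq : cycles B' n.+1 q.
  apply: moore_cycle.
    apply: mooreM; first exact: (phom_moore (phom_of_shom f')).
    exact/mooreV/phom_moore.
  rewrite gmulfM gmulfV -shom_face -phom_face ee eb gmulfM gmulfV fy1 -uv.
  by rewrite invg1 mul1g mulgV.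
have [q0 [cq0 [r [mr er]]]] := v_surj cq.
have [a0 [ma0 ea0]] := moore_lift f_surj (cycle_moore cq0).
have [e2 [me2 ee2]] := moore_lift f'_surj mr.
(* Under f' the first two factors give [q], and the last two multiply it to 1 by the choice of [q0]
   and [r]. The third factor is itself a boundary, so it does not alter the last face. *)
pose t := e * (u n.+1 a)^-1 * face ord_max e2 * (u n.+1 a0)^-1.
have ce2 : face ord_max (face ord_max e2) = 1.
  exact: (boundary_cycle (boundaries_in me2)).
have ft : f' n.+1 t = 1.
  rewrite !gmulfM !gmulfV !uv ea ea0 shom_face ee2 er -/q.
  by rewrite mulgA mulgV mul1g mulgV.
have mt : moore t.
  apply: mooreM; last exact/mooreV/phom_moore.
  apply: mooreM; last exact/cycle_moore/boundary_cycle/boundaries_in.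
  by apply: mooreM => //; apply/mooreV/phom_moore.
pose x' := x * (face ord_max a)^-1 * (face ord_max a0)^-1.
have fx' : ker (f n) x'.
  rewrite /= /ker_set /= !gmulfM !gmulfV !shom_face ea ea0 eb mulgV mul1g.
  by rewrite cq0 invg1.
exists (in_subgroup fx'); split.
  apply/sker_cycles; apply: subgroupM; last exact/subgroupV/boundary_cycle/boundaries_in.
  by apply: subgroupM => //; apply/subgroupV/boundary_cycle/boundaries_in.
apply: (@sker_boundaries _ _ _ _ _ t) => //=.
rewrite /t /x' !gmulfM !gmulfV ce2 mulg1 !phom_face ee; rewrite !mulgA //.
Qed.

End FiveLemma.

Section Verbal.
Variable V : laws.

Lemma cycles_coset (K : asgroup) n (x : K n.+1) i : cycles (vquot V K) n.+1 (coset _ x) ->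
  i <= n.+1 -> verbal V (K n) (aface K n.+1 i x).
Proof. by move=> cx lin; apply/coset_eq1; rewrite -face_coset; apply: cx. Qed.

Lemma htpy_vertex_cycles (K A : asgroup) (u u' : ahom K A) (H : htpy u u') n j x :
  cycles (vquot V K) n (coset _ x) -> j <= n.+1 ->
  cycles (vquot V A) n (coset _ (hg H n.+1 j x)).
Proof.
case: n x => // n x cx ljn i; rewrite face_coset.
have -> : face i (hg H n.+2 j x) = aface A n.+1 i (hg H n.+2 j x).
  by rewrite /aface inord_val.
rewrite hg_face ?leq_ord //; apply/coset_eq1/verbal_hom/cycles_coset => //.
exact: leq_ord.
Qed.

Lemma htpy_prism_faces (K A : asgroup) (u u' : ahom K A) (H : htpy u u') n i j x :
  cycles (vquot V K) n (coset _ x) -> j <= n -> i <= n.+1 -> i != j -> i != j.+1 ->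
  verbal V (A n) (aface A n.+1 i (hh H n.+1 j x)).
Proof.
case: n x => [|n] x cx ljn lin nij nij'.
  by case: i j ljn lin nij nij' => [|[]] // [].
have [lij|lji|eij] := ltngtP i j; last by rewrite eij eqxx in nij.
  by rewrite hh_lt //; apply/verbal_hom/cycles_coset => //; lia.
by rewrite hh_gt //; [apply/verbal_hom/cycles_coset => //|]; lia.
Qed.

(** Since x is a cycle only modulo V, the outer faces of the prisms over a representative do not
    vanish; they are images of elements of the verbal subgroup under homomorphisms, hence trivial
    modulo V. *)
Lemma htpy_vquot_boundary (K A : asgroup) (u u' : ahom K A) (H : htpy u u') n x :
  cycles (vquot V K) n x ->
  boundaries (vquot V A) n ((vquot_phom V (phom_of_ahom u) n x)^-1 *
                            vquot_phom V (phom_of_ahom u') n x).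
Proof.
have [y ->] := coset_surj x => cy; rewrite !vquot_phomE /=.
pose y' : adeg K n.+1 := y.
rewrite -[u _ _](hg_first H y') -[u' _ _](hg_last H y' (leqnn n.+1)).
have face_hh i j : aface (unaugmented (vquot V A)) n.+1 i (coset _ (hh H n.+1 j y)) =
  coset (verbal V (A n)) (aface A n.+1 i (hh H n.+1 j y)) by exact: face_coset.
pose t j : vquot V A n := coset _ (hg H n.+1 j y').
pose e j : vquot V A n.+1 := coset _ (hh H n.+1 j y').
apply: (@htpy_boundary (vquot V A) n t e) => [j ljn|j ljn|j ljn|i j ljn lin nij nij'].
- exact: htpy_vertex_cycles.
- by rewrite face_hh hh_eq.
- by rewrite face_hh hh_succ.
- by rewrite face_hh; apply/coset_eq1/htpy_prism_faces.
Qed.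

End Verbal.

Definition exact_asg (A : asgroup) := exact_on (fun n (_ : adeg A n) => True).

Definition has_bases (K : sgroup) := forall n, exists B : K n -> Prop, is_basis B.

(** * The comparison theorem for resolutions, modulo V *)

Section CornerIso.
Variable V : laws.

(** With no target to cover, the relative lifting lemmas become the classical statements: maps from
    free objects to acyclic ones exist and are unique up to homotopy. *)
Lemma absolute_filling (A : asgroup) (M : void -> asgroup) (p : forall k, ahom A (M k)) :
  exact_asg A -> relative_filling p (fun _ _ => True).
Proof.
move=> exA n z' y _ sy _.
have [//|//|//|//|//|//|z [_ zy]] := @sphere_filler A (fun _ _ =>
  True) _ _ _ _ _ n y exA _ sy.
by exists z; split=> // -[].
Qed.

Let M0 (k : void) : asgroup := match k with end.

Lemma lift_exact (K A : asgroup) (u0 : {hom ag K -> ag A}) : has_bases K -> exact_asg A ->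
  exists u : ahom K A, forall x, u 0 x = u0 x.
Proof.
move=> bK exA; pose p (k : void) : ahom A (M0 k) := match k with end.
pose v (k : void) : ahom K (M0 k) := match k with end.
have [//|[]|u [uu _]] := relative_lift bK (@absolute_filling A M0 p exA) (v :=
  v) _ (u0 := u0).
by exists u.
Qed.

Lemma homotopy_exact (K A : asgroup) (u u' : ahom K A) : has_bases K -> exact_asg A ->
  (forall x, u 0 x = u' 0 x) -> inhabited (htpy u u').
Proof.
move=> bK exA uu'; pose p (k : void) : ahom A (M0 k) := match k with end.
pose v (k : void) : ahom K (M0 k) := match k with end.
pose H (k : void) : htpy (v k) (v k) := match k with end.
have [[]|[]|//|//|//|G _] := relative_homotopy bK (@absolute_filling A M0 p exA) (u :=
  u) (u' := u')
  (HM := H) _ _ _ _ _.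
exact: inhabits G.
Qed.

Lemma resolution_pi_iso (K A : asgroup) (c : ahom K A) (i0 : {hom ag A -> ag K}) :
  (forall x, c 0 (i0 x) = x) -> (forall x, i0 (c 0 x) = x) ->
  has_bases K -> has_bases A -> exact_asg K -> exact_asg A ->
  forall n, pi_inj (vquot_phom V (phom_of_ahom c)) n /\
            pi_surj (vquot_phom V (phom_of_ahom c)) n.
Proof.
move=> ci ic bK bA exK exA n.
have [v v0] := lift_exact i0 bA exK.
have [|H] := @homotopy_exact _ _ (ahom_comp v c) (ahom_id K) bK exK.
  move=> x; exact: etrans (v0 _) (ic x).
have [|H'] := @homotopy_exact _ _ (ahom_comp c v) (ahom_id A) bA exA.
  move=> x; exact: etrans (congr1 (c 0) (v0 x)) (ci x).
have idE (B : asgroup) (x : vquot V B n) :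
    vquot_phom V (phom_of_ahom (ahom_id B)) n x = x.
  by have [y ->] := coset_surj x; rewrite vquot_phomE.
have compE (B C D : asgroup) (g : ahom C D) (f : ahom B C) (x : vquot V B n) :
    vquot_phom V (phom_of_ahom (ahom_comp g f)) n x =
    vquot_phom V (phom_of_ahom g) n (vquot_phom V (phom_of_ahom f) n x).
  have [y ->] := coset_surj x.
  by rewrite (vquot_phomE V (phom_of_ahom f) y) !vquot_phomE.
split=> [x cx bx|y cy].
  have := htpy_vquot_boundary H cx; rewrite compE idE => /subgroupV.
  rewrite invgM invgK => b; apply: boundaries_trans b _.
  exact: boundary_set_phom.
exists (vquot_phom V (phom_of_ahom v) n y); split; first exact: cycle_set_phom.
have := htpy_vquot_boundary H' cy; rewrite compE idE => /subgroupV.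
by rewrite invgM invgK.
Qed.

End CornerIso.

(** * The bar construction *)

Definition counit (G : groupType) : {hom free_group G -> G} := free_lift id.

Lemma counit_gen (G : groupType) (x : G) : counit G (free_gen x) = x.
Proof. exact: free_lift_gen. Qed.

Lemma counit_nat (G H : groupType) (f : {hom G -> H}) x :
  counit H (free_map f x) = f (counit G x).
Proof.
suff /(_ x) : hom_comp (counit H) (free_map f) =1 hom_comp f (counit G) by [].
by apply: free_hom_ext => y; rewrite !hom_compE free_map_gen !counit_gen.
Qed.

Lemma counit_comult (X : choiceType) (x : free_group X) :
  counit _ (free_map (@free_gen X) x) = x.
Proof.
suff /(_ x) : hom_comp (counit _) (free_map (@free_gen X)) =1 idfun by [].
apply: (free_hom_ext (f' := idfun)) => y.
by rewrite hom_compE free_map_gen counit_gen.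
Qed.

Lemma free_map_square (X Y Y' Z : choiceType) (f : X -> Y) (g : Y -> Z)
    (f' : X -> Y') (g' : Y' -> Z) x : (forall x, g (f x) = g' (f' x)) ->
  free_map g (free_map f x) = free_map g' (free_map f' x).
Proof. by move=> e; rewrite !free_map_comp; apply: free_map_eq => y /=. Qed.

Lemma free_map_cancel (X Y : choiceType) (f : X -> Y) (g : Y -> X) x :
  cancel f g -> free_map g (free_map f x) = x.
Proof. by move=> fK; rewrite free_map_comp -[RHS]free_map_id; apply: free_map_eq. Qed.

(* The bar construction of the free group comonad, with G itself in degree 0. *)
Section Bar.
Variable G : groupType.

Fixpoint bar n : groupType := if n is m.+1 then free_group (bar m) else G.

(** With F the free group functor, this is F^i applied to the counit at F^(n-i) G. The recursion on
    i turns each simplicial identity into naturality of the counit or F applied to a lower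
    identity. *)
Fixpoint bar_face n (i : nat) : {hom bar n.+1 -> bar n} :=
  match n, i return {hom bar n.+1 -> bar n} with
  | m.+1, j.+1 => free_map (bar_face m j)
  | m, _ => counit (bar m)
  end.

Fixpoint bar_degen n (i : nat) : {hom bar n.+1 -> bar n.+2} :=
  match n, i return {hom bar n.+1 -> bar n.+2} with
  | m.+1, j.+1 => free_map (bar_degen m j)
  | m, _ => free_map (@free_gen (bar m))
  end.

Lemma bar_face0 n : bar_face n 0 = counit (bar n). Proof. by case: n. Qed.
Lemma bar_degen0 n : bar_degen n 0 = free_map (@free_gen (bar n)).
Proof. by case: n. Qed.
Lemma bar_faceS n i : bar_face n.+1 i.+1 = free_map (bar_face n i). Proof. by []. Qed.
Lemma bar_degenS n i : bar_degen n.+1 i.+1 = free_map (bar_degen n i). Proof. by []. Qed.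

Lemma bar_face_face n i j x : i <= j -> j <= n ->
  bar_face n i (bar_face n.+1 j.+1 x) = bar_face n j (bar_face n.+1 i x).
Proof.
elim: n i j x => [|n IH] [|i] [|j] x // lij ljn;
  rewrite ?bar_face0 ?bar_faceS ?counit_nat //.
by apply: free_map_square => y; apply: IH.
Qed.

Lemma bar_face_degen_lt n i j x : i <= j -> j <= n ->
  bar_face n.+2 i (bar_degen n.+1 j.+1 x) = bar_degen n j (bar_face n.+1 i x).
Proof.
elim: n i j x => [|n IH] [|i] [|j] x // lij ljn;
  rewrite ?bar_face0 1?bar_degenS ?counit_nat //.
by rewrite [bar_face n.+3 _]bar_faceS bar_degenS; apply: free_map_square => y; apply: IH.
Qed.

Lemma bar_face_degen_eq n i x : i <= n -> bar_face n.+1 i (bar_degen n i x) = x.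
Proof.
elim: n i x => [|n IH] [|i] x // lin; try by rewrite bar_face0 bar_degen0 counit_comult.
by rewrite bar_faceS bar_degenS; apply: free_map_cancel => y; apply: IH.
Qed.

Lemma bar_face_degen_succ n i x : i <= n -> bar_face n.+1 i.+1 (bar_degen n i x) = x.
Proof.
elim: n i x => [|n IH] [|i] x // lin.
- by rewrite bar_faceS bar_degen0; apply: free_map_cancel => y;
  rewrite bar_face0 counit_gen.
- by rewrite bar_faceS bar_degen0; apply: free_map_cancel => y;
  rewrite bar_face0 counit_gen.
by rewrite bar_faceS bar_degenS; apply: free_map_cancel => y; apply: IH.
Qed.

Lemma bar_face_degen_gt n i j x : j < i -> i <= n.+1 ->
  bar_face n.+2 i.+1 (bar_degen n.+1 j x) = bar_degen n j (bar_face n.+1 i x).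
Proof.
elim: n i j x => [|n IH] [|i] [|j] x // lji lin.
- by rewrite !bar_degen0 !bar_faceS; apply: free_map_square => y;
  rewrite ?bar_faceS free_map_gen.
- by case: i lji lin.
- by rewrite !bar_degen0 !bar_faceS; apply: free_map_square => y;
  rewrite ?bar_faceS free_map_gen.
by rewrite !bar_degenS !bar_faceS; apply: free_map_square => y; apply: IH.
Qed.

Lemma bar_degen_degen n i j x : i <= j -> j <= n ->
  bar_degen n.+1 i (bar_degen n j x) = bar_degen n.+1 j.+1 (bar_degen n i x).
Proof.
elim: n i j x => [|n IH] [|i] [|j] x // lij ljn; rewrite ?bar_degen0 ?bar_degenS.
- by apply: free_map_square => y; rewrite bar_degen0 free_map_gen.
- by apply: free_map_square => y; rewrite bar_degen0 free_map_gen.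
- by apply: free_map_square => y; rewrite free_map_gen.
by apply: free_map_square => y; apply: IH.
Qed.

Definition bar_sface n (i : 'I_n.+2) : {hom bar n.+2 -> bar n.+1} := bar_face n.+1 i.
Definition bar_sdegen n (i : 'I_n.+1) : {hom bar n.+1 -> bar n.+2} := bar_degen n i.

Definition bar_sgroup : sgroup.
Proof.
apply: (@SGroup (fun n => bar n.+1) bar_sface bar_sdegen) => n.
- by move=> i j x lij; apply: (bar_face_face x lij); apply: leq_ord.
- by move=> i j x lij; apply: (bar_degen_degen x lij); apply: leq_ord.
- by move=> i j x lij; apply: (bar_face_degen_lt x lij); apply: leq_ord.
- by move=> j x; apply: bar_face_degen_eq; apply: leq_ord.
- by move=> j x; apply: bar_face_degen_succ; apply: leq_ord.
- by move=> i j x lij; apply: (bar_face_degen_gt x lij); apply: leq_ord.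
Defined.

Lemma bar_augP (x : bar_sgroup 1%N) : bar_face 0 0 (face ord0 x) = bar_face 0 0 (face
  ord_max x).
Proof. exact: esym (@bar_face_face 0 0 0 x isT isT). Qed.

Definition bar_asg : asgroup := ASGroup bar_augP.

Lemma aface_bar n i (x : adeg bar_asg n.+2) : i <= n.+1 ->
  aface bar_asg n.+1 i x = bar_face n.+1 i x.
Proof. by move=> lin; rewrite /aface /= /bar_sface inordK. Qed.

Lemma bar_bases : has_bases bar_asg.
Proof. by move=> n; eexists; apply: free_basis. Qed.

End Bar.

Section BarMap.
Variables (G H : groupType) (f : {hom G -> H}).

Fixpoint bar_map n : {hom bar G n -> bar H n} :=
  match n return {hom bar G n -> bar H n} with
  | 0 => f
  | m.+1 => free_map (bar_map m)
  end.

Lemma bar_map_face n i x : bar_map n (bar_face G n i x) = bar_face H n i (bar_map n.+1 x).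
Proof.
elim: n i x => [|n IH] [|i] x; rewrite ?bar_faceS.
- exact: esym (counit_nat (bar_map 0) x).
- exact: esym (counit_nat (bar_map 0) x).
- exact: esym (counit_nat (bar_map n.+1) x).
by apply: free_map_square => y; apply: IH.
Qed.

Lemma bar_map_degen n i x :
  bar_map n.+2 (bar_degen G n i x) = bar_degen H n i (bar_map n.+1 x).
Proof.
elim: n i x => [|n IH] [|i] x; rewrite ?bar_degen0 ?bar_degenS;
  apply: free_map_square => y; rewrite ?free_map_gen //; exact: IH.
Qed.

Definition bar_shom : shom (bar_sgroup G) (bar_sgroup H).
Proof.
by apply: (@SHom (bar_sgroup G) (bar_sgroup H) (fun n => bar_map n.+1)) => n i x;
  [apply: bar_map_face|apply: bar_map_degen].
Defined.

Definition bar_ahom : ahom (bar_asg G) (bar_asg H) :=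
  @ahom_of_shom (bar_asg G) (bar_asg H) bar_shom f (@bar_map_face 0 0).

Lemma bar_map_surj : (forall y, exists x, f x = y) -> forall n y, exists x,
  bar_map n x = y.
Proof. by move=> fs; elim=> // n IH; apply: free_map_surj. Qed.

End BarMap.

Lemma bar_map_comp (G H K : groupType) (g : {hom H -> K}) (f : {hom G -> H})
    (h : {hom G -> K}) n x : (forall x, h x = g (f x)) ->
  bar_map h n x = bar_map g n (bar_map f n x).
Proof.
move=> e; elim: n x => // n IH x.
by rewrite -[LHS](free_map_id (bar_map h n.+1 x)); apply: free_map_square.
Qed.

Lemma bar_map_square (G H H' K : groupType) (g : {hom H -> K}) (f : {hom G -> H})
    (g' : {hom H' -> K}) (f' : {hom G -> H'}) n x : (forall x, g (f x) = g' (f' x)) ->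
  bar_map g n (bar_map f n x) = bar_map g' n (bar_map f' n x).
Proof. by move=> e; elim: n x => // n IH x; apply: free_map_square. Qed.

Lemma bar_map_id (G : groupType) (f : {hom G -> G}) n x : (forall x, f x = x) ->
  bar_map f n x = x.
Proof.
move=> e; elim: n x => // n IH x; rewrite -[RHS]free_map_id.
exact: free_map_eq.
Qed.

Lemma bar_pullback (G H H' K : groupType) (a : {hom G -> H}) (b : {hom G -> H'})
    (c : {hom H' -> K}) (e : {hom H -> K}) :
  (forall y, exists x, a x = y) -> (forall z, exists x, b x = z) ->
  (forall w, exists z, c z = w) ->
  (forall x, e (a x) = c (b x)) ->
  (forall y z, e y = c z -> exists x, a x = y /\ b x = z) ->
  forall n y z, bar_map e n y = bar_map c n z ->
    exists x, bar_map a n x = y /\ bar_map b n x = z.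
Proof.
move=> sa sb sc ab pb; elim=> // n IH.
apply: free_map_pullback => // [||| x]; try exact: bar_map_surj.
exact: bar_map_square.
Qed.

(* The unit of the free group comonad is an extra degeneracy; it is not a
   homomorphism, but it commutes with all maps induced from G. *)
Section BarExact.
Variable G : groupType.

(** The second factor normalises the unit so that the cone on 1 is 1; hence cones preserve kernels,
    and trivial faces remain trivial. *)
Definition bar_cone n (t : bar G n) : bar G n.+1 :=
  free_gen t * (free_gen (1 : bar G n))^-1.

Definition extra_degen n : adeg (bar_asg G) n -> adeg (bar_asg G) n.+1 :=
  match n return adeg (bar_asg G) n -> adeg (bar_asg G) n.+1 with
  | 0 => @bar_cone 0
  | m.+1 => @bar_cone m.+1
  end.

Lemma bar_cone_face0 n t : bar_face G n 0 (@bar_cone n t) = t.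
Proof. by rewrite bar_face0 gmulfM gmulfV !counit_gen invg1 mulg1. Qed.

Lemma bar_cone_faceS n i t : bar_face G n i t = 1 ->
  bar_face G n.+1 i.+1 (bar_cone t) = 1.
Proof. by move=> t1; rewrite bar_faceS gmulfM gmulfV !free_map_gen t1 gmulf1 mulgV. Qed.

(** An [ahom] respects faces only; this adds that its kernel is stable under degeneracies and cones,
    as fillers inside the kernel require. *)
Definition bar_natural (A : asgroup) (p : ahom (bar_asg G) A) :=
  (forall n i x, i <= n -> p n.+1 x = 1 -> p n.+2 (adegen (bar_asg G) n i x) = 1) /\
  (forall n t, p n t = 1 -> p n.+1 (extra_degen t) = 1).

Lemma bar_ahom_natural (H : groupType) (f : {hom G -> H}) : bar_natural (bar_ahom f).
Proof.
split=> [n i x lin x1|n t t1].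
  by apply: etrans (bar_map_degen f _ x) _; rewrite [bar_map _ _ x]x1 gmulf1.
have bE m (s : bar G m) : bar_map f m s = 1 -> bar_map f m.+1 (bar_cone s) = 1.
  by move=> s1; rewrite gmulfM gmulfV !free_map_gen s1 gmulf1 mulgV.
by case: n t t1 => [|n] t t1; apply: bE.
Qed.

Variables (kappa : Type) (M : kappa -> asgroup) (p : forall k, ahom (bar_asg G) (M k)).
Hypothesis p_nat : forall k, bar_natural (p k).

Definition bar_ker n (x : adeg (bar_asg G) n) := forall k, p k n x = 1.

(** The cone on a cycle t has t as face 0 and its other faces trivial; [move_boundary] transports t
    to the last face. Both operations stay in the common kernel of the maps p. *)
Lemma bar_exact : exact_on bar_ker.
Proof.
case=> [|n] t Wt ct.
  exists (extra_degen t); split=> [k||]; [exact: (p_nat k).2|by []|exact: bar_cone_face0].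
have [|||||||i lin nij||b' Hb'] := @move_boundary (bar_asg G) bar_ker _ _ _ n t 0
  (extra_degen t).
- by move=> m x y Wx Wy k; rewrite gmulfM Wx Wy mulg1.
- by move=> m x Wx k; rewrite gmulfV Wx invg1.
- by move=> m i x lim Wx k; apply: (p_nat k).1.
- exact: Wt.
- exact: ct.
- by [].
- by move=> k; apply: (p_nat k).2.
- rewrite aface_bar //; case: i lin nij => // i lin _; apply: bar_cone_faceS.
  case: n t Wt ct lin => [|n] t Wt ct lin; last by rewrite -aface_bar //; apply: ct.
  by have := ct i lin; case: i lin.
- by rewrite aface_bar // bar_cone_face0.
by exists b'.
Qed.

(** Fibrancy reduces to surjectivity: a preimage [x0] of the prescribed images divides the given
    sphere into the common kernel, where [bar_exact] fills it. *)
Lemma bar_relative_filling (valid : forall n, (forall k, adeg (M k) n) -> Prop) :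
  (forall n z, valid n z -> exists x, forall k, p k n x = z k) ->
  relative_filling p valid.
Proof.
move=> surj n z' y vz sy yz; have [x0 x0z] := surj _ _ vz.
have [|||||i lin k||w [Ww wy]] := @sphere_filler (bar_asg G) bar_ker _ _ _ _ _ n
  (fun i => (aface (bar_asg G) n i x0)^-1 * y i) bar_exact.
- by move=> m k; apply: gmulf1.
- by move=> m a c Wx Wy k; rewrite gmulfM Wx Wy mulg1.
- by move=> m x Wx k; rewrite gmulfV Wx invg1.
- by move=> m i x lim Wx k; rewrite ahom_face // Wx gmulf1.
- by move=> m i x lim Wx k; apply: (p_nat k).1.
- by rewrite gmulfM gmulfV ahom_face // x0z yz // mulVg.
- by apply: sphericalM => //; apply/sphericalV/spherical_faces.
exists (x0 * w); split=> [i lin|k]; last by rewrite gmulfM x0z Ww mulg1.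
by rewrite gmulfM wy // mulgA mulgV mul1g.
Qed.

End BarExact.

Lemma bar_exact_asg (G : groupType) : exact_asg (bar_asg G).
Proof.
move=> n t _ ct; pose M (k : void) : asgroup := match k with end.
pose p (k : void) : ahom (bar_asg G) (M k) := match k with end.
have Wt : bar_ker p t by case.
have pn k : bar_natural (p k) by case: k.
by have [b [_ b1 bt]] := bar_exact pn Wt ct; exists b.
Qed.

(** * Squares of augmented simplicial groups *)

Section PathComponents.
Variable K : sgroup.

Definition pi0_fun (x : K 0) : homotopy_group K 0 :=
  coset _ (in_subgroup (I : cycles K 0 x)).

Lemma pi0_funM : {morph pi0_fun : x y / x * y}.
Proof. by move=> x y; rewrite /pi0_fun -cosetM; congr (coset _ _); apply: val_inj. Qed.

Definition pi0 : {hom K 0 -> homotopy_group K 0} := hom_of pi0_funM.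

Lemma pi0_surj y : exists x, pi0 x = y.
Proof.
have [z ->] := coset_surj y; exists (val z).
by rewrite /= /pi0_fun; congr (coset _ _); apply: val_inj.
Qed.

Lemma pi0_eq1 x : pi0 x = 1 <-> boundaries K 0 x.
Proof. exact: coset_eq1. Qed.

Lemma pi0_face (x : K 1%N) : pi0 (face ord0 x) = pi0 (face ord_max x).
Proof.
have k0 : keep ord0 = ord0 :> 'I_2 by apply: val_inj.
have i0 : incr ord0 = ord_max :> 'I_2 by apply: val_inj.
(* The degeneracy cancels face 0 of x and turns its face 1 into the quotient of the two faces. *)
apply/cosetP; exists ((degen ord0 (face ord0 x))^-1 * x); split=> [i ni|].
  have -> : i = ord0.
    by apply: val_inj; case: i ni => -[|[]] //= H /eqP[]; apply: val_inj.
  by rewrite gmulfM gmulfV -[X in face X (degen _ _)]k0 face_degen_eq mulVg.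
by rewrite gmulfM gmulfV -{1}i0 face_degen_succ.
Qed.

End PathComponents.

Lemma homotopy_hom_pi0 (K L : sgroup) (f : shom K L) x :
  homotopy_hom f 0 (pi0 K x) = pi0 L (f 0 x).
Proof.
rewrite [LHS]quotient_homE; congr (coset _ _); exact: val_inj.
Qed.

Section ResolutionAsg.
Variables (G : groupType) (K : sgroup) (r : resolution G K).

Definition res_aug : {hom K 0 -> G} := hom_comp (aug r) (pi0 K).

Lemma res_augP x : res_aug (face ord0 x) = res_aug (face ord_max x).
Proof. by rewrite !hom_compE pi0_face. Qed.

(** Degrees 0 and 1 are surjectivity and injectivity of the augmentation on pi_0; higher degrees are
    vanishing of the higher homotopy groups. *)
Lemma res_exact : exact_asg (ASGroup res_augP).
Proof.
have augI := bij_inj (aug_bij r).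
case=> [|[|n]] t _ ct.
- have [g _ gK] := aug_bij r; have [x xg] := pi0_surj (g t).
  by exists x; split=> //; apply: etrans (congr1 (aug r) xg) (gK t).
- have [b [b1 bt]] : boundaries K 0 t.
    apply/pi0_eq1/augI; rewrite gmulf1; exact: (ct 0 isT).
  exists b; split=> // [i|]; last first.
    by rewrite -bt /aface; congr (face _ b); apply: val_inj; rewrite /= inordK.
  by case: i => // _; apply: b1; apply/eqP => /(congr1 val); rewrite /= inordK.
have ct' : cycles K n.+1 t.
  by move=> i; have := ct i (leq_ord i); rewrite /aface inord_val.
have /coset_eq1[b [b1 bt]] := resolution_acyclic r (coset (preim_normal (cycle_incl K
  n.+1) (boundaries K n.+1)) (in_subgroup ct')).
exists b; split=> // [i lin|].
  by apply: b1; apply/eqP => /(congr1 val); rewrite /= inordK; lia.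
by rewrite -[RHS]bt /aface; congr (face _ b); apply: val_inj; rewrite /= inordK.
Qed.

Lemma res_bases : has_bases K.
Proof. by have [B [basisB _]] := resolution_free r => n; exists (B n). Qed.

End ResolutionAsg.

Record asquare (T : triple) := ASquare {
  qsq :> square;
  eK : {hom sqK qsq 0 -> tG T};
  eL : {hom sqL qsq 0 -> quotient (tN T)};
  eR : {hom sqR qsq 0 -> quotient (tM T)};
  eS : {hom sqS qsq 0 -> quotient (tMN T)};
  eKP : forall x, eK (face ord0 x) = eK (face ord_max x);
  eLP : forall x, eL (face ord0 x) = eL (face ord_max x);
  eRP : forall x, eR (face ord0 x) = eR (face ord_max x);
  eSP : forall x, eS (face ord0 x) = eS (face ord_max x);
  e_alpha : forall x, quotient_proj (tN T) (eK x) = eL (alpha qsq 0 x);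
  e_beta : forall x, quotient_proj (tM T) (eK x) = eR (beta qsq 0 x);
  e_gamma : forall x, projM_MN T (eR x) = eS (gamma qsq 0 x);
  e_delta : forall x, projN_MN T (eL x) = eS (delta qsq 0 x)
}.

Section ASquareMaps.
Variables (T : triple) (Q : asquare T).

Definition qK := ASGroup (@eKP T Q).
Definition qL := ASGroup (@eLP T Q).
Definition qR := ASGroup (@eRP T Q).
Definition qS := ASGroup (@eSP T Q).

Definition qa : ahom qK qL := @ahom_of_shom qK qL (alpha Q) _ (@e_alpha T Q).
Definition qb : ahom qK qR := @ahom_of_shom qK qR (beta Q) _ (@e_beta T Q).
Definition qc : ahom qR qS := @ahom_of_shom qR qS (gamma Q) _ (@e_gamma T Q).
Definition qd : ahom qL qS := @ahom_of_shom qL qS (delta Q) _ (@e_delta T Q).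

Lemma q_comm n x : qd n (qa n x) = qc n (qb n x).
Proof.
case: n x => [|n] x; last exact: square_comm'.
by rewrite [LHS]quotient_homE [RHS]quotient_homE.
Qed.

Record bases_exact : Prop := BasesExact {
  K_bases : has_bases qK; L_bases : has_bases qL;
  R_bases : has_bases qR; S_bases : has_bases qS;
  K_exact : exact_asg qK; L_exact : exact_asg qL;
  R_exact : exact_asg qR; S_exact : exact_asg qS
}.

Definition corner (b : bool) : asgroup := if b then qL else qR.
Definition to_corner b : ahom qK (corner b) :=
  if b return ahom qK (corner b) then qa else qb.
Definition corner_valid n (z : forall b, adeg (corner b) n) :=
  qd n (z true) = qc n (z false).

(* The relative lifting properties of a Reedy fibrant square. *)
Record fibrant : Prop := Fibrant {
  S_filling : exact_asg qS;
  L_filling : relative_filling (fun _ : unit => qd) (fun _ _ => True);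
  R_filling : relative_filling (fun _ : unit => qc) (fun _ _ => True);
  K_filling : relative_filling to_corner corner_valid
}.

(** The surjections fed to the five lemma: the first two for the kernels of alpha and gamma, the
    third for the kernel of the map between these kernels. *)
Record vsurjective (V : laws) : Prop := VSurjective {
  va_surj : degreewise_surjective (alpha (vquot_square V Q));
  vc_surj : degreewise_surjective (gamma (vquot_square V Q));
  vker_surj : degreewise_surjective (ker_alpha_gamma (vquot_square V Q))
}.

Definition bgroup V n : groupType := homotopy_group (total_ker (vquot_square V Q)) n.

End ASquareMaps.

Record amap (T T' : triple) (Q : asquare T) (P : asquare T') := AMap {
  mK : ahom (qK Q) (qK P);
  mL : ahom (qL Q) (qL P);
  mR : ahom (qR Q) (qR P);
  mS : ahom (qS Q) (qS P);
  m_alpha : forall n x, qa P n (mK n x) = mL n (qa Q n x);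
  m_beta : forall n x, qb P n (mK n x) = mR n (qb Q n x);
  m_gamma : forall n x, qc P n (mR n x) = mS n (qc Q n x);
  m_delta : forall n x, qd P n (mL n x) = mS n (qd Q n x)
}.

Section AMapComp.
Variables (T T' T'' : triple) (Q : asquare T) (P : asquare T') (P' : asquare T'').
Variables (w : amap P P') (u : amap Q P).

Definition amap_comp : amap Q P'.
Proof.
apply: (@AMap _ _ _ _ (ahom_comp (mK w) (mK u)) (ahom_comp (mL w) (mL u))
  (ahom_comp (mR w) (mR u)) (ahom_comp (mS w) (mS u))) => n x; rewrite !hom_compE.
- by rewrite m_alpha m_alpha.
- by rewrite m_beta m_beta.
- by rewrite m_gamma m_gamma.
- by rewrite m_delta m_delta.
Defined.

End AMapComp.

Definition over (T T' : triple) (f : triple_hom T T') (Q : asquare T) (P : asquare T')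
    (u : amap Q P) : Prop :=
  [/\ forall x, mK u 0 x = f x, forall x, mL u 0 x = quotient_hom (thomN f) x,
      forall x, mR u 0 x = quotient_hom (thomM f) x
    & forall x, mS u 0 x = quotient_hom (thomMN f) x].

Section BaerMap.
Variables (V : laws) (T T' : triple) (Q : asquare T) (P : asquare T') (u : amap Q P).

Lemma vquot_phom_comm (K K' L L' : asgroup) (f : shom K L) (f' : shom K' L')
    (g : ahom K K') (h : ahom L L') :
  (forall n x, f' n (g n.+1 x) = h n.+1 (f n x)) ->
  forall n x, vquot_hom V f' n (vquot_phom V (phom_of_ahom g) n x) =
              vquot_phom V (phom_of_ahom h) n (vquot_hom V f n x).
Proof.
move=> e n x; have [y ->] := coset_surj x.
rewrite (vquot_phomE V (phom_of_ahom g) y) (vquot_homE V f y).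
rewrite (vquot_phomE V (phom_of_ahom h)).
by rewrite [LHS]vquot_homE; congr (coset _ _); apply: e.
Qed.

Let comm_alpha := @vquot_phom_comm (qK Q) (qK P) (qL Q) (qL P) (alpha Q) (alpha P)
  (mK u) (mL u) (fun n => @m_alpha _ _ _ _ u n.+1).
Let comm_gamma := @vquot_phom_comm (qR Q) (qR P) (qS Q) (qS P) (gamma Q) (gamma P)
  (mR u) (mS u) (fun n => @m_gamma _ _ _ _ u n.+1).
Let comm_beta := @vquot_phom_comm (qK Q) (qK P) (qR Q) (qR P) (beta Q) (beta P)
  (mK u) (mR u) (fun n => @m_beta _ _ _ _ u n.+1).

Definition ker_alpha_map : phom (sker (alpha (vquot_square V Q))) (sker (alpha
  (vquot_square V P))) :=
  @sker_phom _ _ _ _ (alpha (vquot_square V Q)) (alpha (vquot_square V P))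
   (vquot_phom V (phom_of_ahom (mK u))) (vquot_phom V (phom_of_ahom (mL u))) comm_alpha.

Definition ker_gamma_map : phom (sker (gamma (vquot_square V Q))) (sker (gamma
  (vquot_square V P))) :=
  @sker_phom _ _ _ _ (gamma (vquot_square V Q)) (gamma (vquot_square V P))
   (vquot_phom V (phom_of_ahom (mR u))) (vquot_phom V (phom_of_ahom (mS u))) comm_gamma.

Lemma total_map_comm n x :
  ker_alpha_gamma (vquot_square V P) n (ker_alpha_map n x) =
  ker_gamma_map n (ker_alpha_gamma (vquot_square V Q) n x).
Proof. by apply: val_inj; apply: comm_beta. Qed.

Definition total_map : phom (total_ker (vquot_square V Q)) (total_ker (vquot_square V
  P)) :=
  sker_phom total_map_comm.

Definition bmap n : {hom bgroup Q V n -> bgroup P V n} := homotopy_phom total_map n.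

End BaerMap.

Section TotalKernel.
Variables (V : laws) (T : triple) (Q : asquare T).

Definition tval n (w : total_ker (vquot_square V Q) n) : vquot V (sqK Q) n :=
  subgroup_val (subgroup_val w).

Lemma tval_inj n : injective (@tval n).
Proof. by move=> w w' e; do 2!apply: val_inj. Qed.

Lemma tval_face n i (w : total_ker (vquot_square V Q) n.+1) : tval (face i w) = face i
  (tval w).
Proof. by []. Qed.

Lemma tval_eq1 n (w : total_ker (vquot_square V Q) n) : tval w = 1 -> w = 1.
Proof. by move=> w1; apply: tval_inj. Qed.

Lemma total_alpha n (w : total_ker (vquot_square V Q) n) :
  vquot_hom V (alpha Q) n (tval w) = 1.
Proof. exact: subgroup_typeP (subgroup_val w). Qed.

Lemma total_beta n (w : total_ker (vquot_square V Q) n) :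
  vquot_hom V (beta Q) n (tval w) = 1.
Proof. by have /(congr1 val) := subgroup_typeP w. Qed.

Lemma total_in n (z : vquot V (sqK Q) n) : vquot_hom V (alpha Q) n z = 1 ->
  vquot_hom V (beta Q) n z = 1 -> exists w : total_ker (vquot_square V Q) n, tval w = z.
Proof.
move=> az bz; pose w : sker (alpha (vquot_square V Q)) n :=
  in_subgroup (az : ker (alpha (vquot_square V Q) n) z).
have bw : ker (ker_alpha_gamma (vquot_square V Q) n) w by apply: val_inj.
by exists (in_subgroup bw).
Qed.

Lemma total_in_coset n (z : sqK Q n) : verbal V (sqL Q n) (alpha Q n z) ->
  verbal V (sqR Q n) (beta Q n z) ->
  exists w : total_ker (vquot_square V Q) n, tval w = coset _ z.
Proof.
by move=> az bz; apply: total_in; rewrite [LHS]vquot_homE; apply/coset_eq1.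
Qed.

Lemma tval_alphaP n (w : total_ker (vquot_square V Q) n) (z : sqK Q n) :
  tval w = coset _ z -> verbal V (sqL Q n) (alpha Q n z).
Proof.
move=> e; have := total_alpha w; rewrite e => az; apply/coset_eq1.
by rewrite -[LHS](vquot_homE V (alpha Q)).
Qed.

Lemma tval_betaP n (w : total_ker (vquot_square V Q) n) (z : sqK Q n) :
  tval w = coset _ z -> verbal V (sqR Q n) (beta Q n z).
Proof.
move=> e; have := total_beta w; rewrite e => az; apply/coset_eq1.
by rewrite -[LHS](vquot_homE V (beta Q)).
Qed.

Lemma total_cycles n (w : total_ker (vquot_square V Q) n) :
  cycles (total_ker (vquot_square V Q)) n w <-> cycles (vquot V (sqK Q)) n (tval w).
Proof.
case: n w => // n w; split=> cw i; last by apply: tval_eq1; apply: cw.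
by rewrite -tval_face cw.
Qed.

End TotalKernel.

(** * Homotopic maps of squares agree on total kernels *)

Section Uniqueness.
Variables (V : laws) (T T' : triple) (Q : asquare T) (P : asquare T').

Lemma tval_total_map (u : amap Q P) n w :
  tval (total_map V u n w) = vquot_phom V (phom_of_ahom (mK u)) n (tval w).
Proof. by []. Qed.

(** An element of the total kernel is the class of an x whose images in L and R are verbal.
    Compatibility of the homotopies makes the images of its vertices and prisms verbal too, so these
    lie in the total kernel and [htpy_boundary] applies there. *)
Lemma bmap_htpy (u u' : amap Q P) (HK : htpy (mK u) (mK u')) (HL : htpy (mL u) (mL u'))
    (HR : htpy (mR u) (mR u')) :
  (forall n j x, qa P n (hg HK n j x) = hg HL n j (qa Q n x)) ->
  (forall n j x, qb P n (hg HK n j x) = hg HR n j (qb Q n x)) ->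
  (forall n j x, j < n -> qa P n.+1 (hh HK n j x) = hh HL n j (qa Q n x)) ->
  (forall n j x, j < n -> qb P n.+1 (hh HK n j x) = hh HR n j (qb Q n x)) ->
  forall n, bmap V u n =1 bmap V u' n.
Proof.
move=> ga gb ha hb n y; have [w ->] := coset_surj y.
rewrite [LHS]quotient_homE [RHS]quotient_homE; apply/cosetP.
suff : boundaries (total_ker (vquot_square V P)) n
  ((total_map V u n (subgroup_val w))^-1 * total_map V u' n (subgroup_val w)) by [].
have cw : cycles (vquot V (sqK Q)) n (tval (subgroup_val w)).
  by apply/total_cycles; apply: subgroup_typeP w.
move: (subgroup_val w) cw => {y}w cw.
have [x ex] := coset_surj (tval w).
have ax : verbal V (sqL Q n) (qa Q n.+1 x) := tval_alphaP ex.
have bx : verbal V (sqR Q n) (qb Q n.+1 x) := tval_betaP ex.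
rewrite ex in cw.
have /choice[t tE] j : exists z : total_ker (vquot_square V P) n,
  tval z = coset _ (hg HK n.+1 j x).
  apply: total_in_coset; [rewrite [X in verbal _ _ X](ga n.+1 j x)|
    rewrite [X in verbal _ _ X](gb n.+1 j x)]; exact: verbal_hom.
(* Prisms are controlled only for j at most n; beyond that, 1 is a default. *)
have /choice[e eE] j : exists z : total_ker (vquot_square V P) n.+1,
    j <= n -> tval z = coset _ (hh HK n.+1 j x).
  have [ljn|lnj] := leqP j n; last by exists 1.
  have [||z ez] := @total_in_coset V _ P n.+1 (hh HK n.+1 j x); last by exists z.
    by rewrite [X in verbal _ _ X](ha n.+1 j x ljn); apply: verbal_hom.
  by rewrite [X in verbal _ _ X](hb n.+1 j x ljn); apply: verbal_hom.
have face_e i j : j <= n -> tval (aface (unaugmented (total_ker (vquot_square V P)))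
  n.+1 i (e j)) =
    coset (verbal V (sqK P n)) (aface (qK P) n.+1 i (hh HK n.+1 j x)).
  by move=> ljn; rewrite [LHS]tval_face eE // [LHS]face_coset.
have -> : total_map V u n w = t 0.
  apply: tval_inj; rewrite tval_total_map ex tE [LHS]vquot_phomE hg_first //.
have -> : total_map V u' n w = t n.+1.
  by apply: tval_inj; rewrite tval_total_map ex tE [LHS]vquot_phomE hg_last.
apply: (@htpy_boundary _ n t e) => [j ljn|j ljn|j ljn|i j ljn lin nij nij'].
- by apply/total_cycles; rewrite tE; apply: htpy_vertex_cycles.
- by apply: tval_inj; rewrite face_e // tE hh_eq.
- by apply: tval_inj; rewrite face_e // tE hh_succ.
- by apply: tval_eq1; rewrite face_e //; apply/coset_eq1; exact: (htpy_prism_faces HK cw).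
Qed.

(** Homotopies are lifted against the arrows: at S absolutely, at L and R over the one at S, at K
    over both. The last problem is well posed because the homotopies at L and R agree after mapping
    to S. *)
Lemma bmap_unique (u u' : amap Q P) :
  has_bases (qK Q) -> has_bases (qL Q) -> has_bases (qR Q) -> has_bases (qS Q) ->
    fibrant P ->
  (forall x, mK u 0 x = mK u' 0 x) -> (forall x, mL u 0 x = mL u' 0 x) ->
  (forall x, mR u 0 x = mR u' 0 x) -> (forall x, mS u 0 x = mS u' 0 x) ->
  forall n, bmap V u n =1 bmap V u' n.
Proof.
move=> bK bL bR bS fP uK uL uR uS.
have [HS] := homotopy_exact bS (S_filling fP) uS.
have [//|//|HL HLE] := @relative_homotopy _ _ unit (fun _ =>
  qS P) _ _ bL (L_filling fP) (mL u) (mL u')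
  (fun _ => ahom_comp (mS u) (qd Q)) (fun _ => ahom_comp (mS u') (qd Q))
  (fun _ => htpy_precomp HS (qd Q)) (fun _ => @m_delta _ _ _ _ u) (fun _ =>
    @m_delta _ _ _ _ u') uL.
have [//|//|HR HRE] := @relative_homotopy _ _ unit (fun _ =>
  qS P) _ _ bR (R_filling fP) (mR u) (mR u')
  (fun _ => ahom_comp (mS u) (qc Q)) (fun _ => ahom_comp (mS u') (qc Q))
  (fun _ => htpy_precomp HS (qc Q)) (fun _ => @m_gamma _ _ _ _ u) (fun _ =>
    @m_gamma _ _ _ _ u') uR.
pose v (w : amap Q P) b : ahom (qK Q) (corner P b) :=
  if b return ahom (qK Q) (corner P b) then ahom_comp (mL w) (qa Q) else ahom_comp (mR
    w) (qb Q).
pose HM b : htpy (v u b) (v u' b) :=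
  if b return htpy (v u b) (v u' b) then htpy_precomp HL (qa Q) else htpy_precomp HR
    (qb Q).
have pv (w : amap Q P) b n x : to_corner P b n (mK w n x) = v w b n x.
  by case: b; [apply: m_alpha|apply: m_beta].
have [n j x|n j x ljn|HK HKE] := @relative_homotopy _ _ bool _ _ _ bK (K_filling fP)
  (mK u) (mK u')
  (v u) (v u') HM (pv u) (pv u') uK.
- have [gl _] := HLE tt n j (qa Q n x); have [gr _] := HRE tt n j (qb Q n x).
  by apply: etrans gl (etrans _ (esym gr)); rewrite !hom_compE q_comm.
- have [_ /(_ ljn) hl] := HLE tt n j (qa Q n x); have [_ /(_ ljn) hr] :=
  HRE tt n j (qb Q n x).
  by apply: etrans hl (etrans _ (esym hr)); rewrite !hom_compE q_comm.
apply: (@bmap_htpy _ _ HK HL HR) => n j x.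
- by have [] := HKE true n j x.
- by have [] := HKE false n j x.
- by move=> ljn; have [_ ->] := HKE true n j x.
- by move=> ljn; have [_ ->] := HKE false n j x.
Qed.

End Uniqueness.

Lemma projN_MNE (T : triple) y : projN_MN T (coset _ y) = coset (tMN T) y.
Proof. exact: (@quotient_homE _ _ _ _ idfun (@tN_sub T)). Qed.

Lemma projM_MNE (T : triple) y : projM_MN T (coset _ y) = coset (tMN T) y.
Proof. exact: (@quotient_homE _ _ _ _ idfun (@tM_sub T)). Qed.

Lemma projN_MN_nat (T T' : triple) (f : triple_hom T T') x :
  projN_MN T' (quotient_hom (thomN f) x) = quotient_hom (thomMN f) (projN_MN T x).
Proof.
have [y ->] := coset_surj x; by rewrite quotient_homE !projN_MNE quotient_homE.
Qed.

Lemma projM_MN_nat (T T' : triple) (f : triple_hom T T') x :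
  projM_MN T' (quotient_hom (thomM f) x) = quotient_hom (thomMN f) (projM_MN T x).
Proof.
have [y ->] := coset_surj x; by rewrite quotient_homE !projM_MNE quotient_homE.
Qed.

Lemma amap_lift (T T' : triple) (f : triple_hom T T') (Q : asquare T) (P : asquare T') :
  has_bases (qK Q) -> has_bases (qL Q) -> has_bases (qR Q) -> has_bases (qS Q) ->
    fibrant P ->
  exists u : amap Q P, over f u.
Proof.
move=> bK bL bR bS fP.
have [mS0 S0] := @lift_exact (qS Q) (qS P) (quotient_hom (thomMN f)) bS (S_filling fP).
have [//|k x|mL0 [L0 Ld]] := @relative_lift _ _ unit (fun _ => qS P) _ _ bL (L_filling fP)
  (fun _ => ahom_comp mS0 (qd Q)) _ (quotient_hom (thomN f)).
  exact: etrans (projN_MN_nat f x) (esym (S0 _)).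
have [//|k x|mR0 [R0 Rc]] := @relative_lift _ _ unit (fun _ => qS P) _ _ bR (R_filling fP)
  (fun _ => ahom_comp mS0 (qc Q)) _ (quotient_hom (thomM f)).
  exact: etrans (projM_MN_nat f x) (esym (S0 _)).
pose v b : ahom (qK Q) (corner P b) :=
  if b return ahom (qK Q) (corner P b) then ahom_comp mL0 (qa Q) else ahom_comp mR0 (qb
    Q).
have [n x|k x|mK0 [K0 Kab]] := @relative_lift _ _ bool _ _ _ bK (K_filling fP) v _ f.
- apply: etrans (Ld tt n _) (etrans _ (esym (Rc tt n _))).
  by rewrite !hom_compE q_comm.
- by case: k; [apply: etrans _ (esym (L0 _))|apply: etrans _ (esym (R0 _))];
    apply: esym; apply: quotient_homE.
by exists (@AMap _ _ _ _ mK0 mL0 mR0 mS0 (Kab true) (Kab false) (Rc tt) (Ld tt)); split.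
Qed.

Lemma bmap_comp (V : laws) (T T' T'' : triple) (Q : asquare T) (P : asquare T')
    (P' : asquare T'') (w : amap P P') (u : amap Q P) n x :
  bmap V (amap_comp w u) n x = bmap V w n (bmap V u n x).
Proof.
have [y ->] := coset_surj x.
rewrite [bmap V u n _]quotient_homE [LHS]quotient_homE [RHS]quotient_homE.
congr (coset _ _); apply: val_inj; apply: tval_inj.
have [z ez] := coset_surj (tval (subgroup_val y)).
transitivity (coset (verbal V (sqK P' n)) (mK w n.+1 (mK u n.+1 z))).
  rewrite [LHS](_ : _ = vquot_phom V (phom_of_ahom (mK (amap_comp w u))) n (tval
    (subgroup_val y))) //.
  by rewrite ez [LHS]vquot_phomE.
rewrite [RHS](_ : _ = vquot_phom V (phom_of_ahom (mK w)) n
  (vquot_phom V (phom_of_ahom (mK u)) n (tval (subgroup_val y)))) //.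
by rewrite ez [X in vquot_phom _ _ _ X]vquot_phomE [RHS]vquot_phomE.
Qed.

(** The five lemma is applied twice: from the four corners to the kernels of alpha and gamma, then
    from these to the total kernel. *)
Lemma bmap_bij (V : laws) (T : triple) (Q P : asquare T) (u : amap Q P) n :
  bases_exact Q -> bases_exact P -> vsurjective Q V -> vsurjective P V ->
  (forall x, mK u 0 x = x) -> (forall x, mL u 0 x = x) ->
  (forall x, mR u 0 x = x) -> (forall x, mS u 0 x = x) ->
  bijective (bmap V u n).
Proof.
move=> [bK bL bR bS xK xL xR xS] [bK' bL' bR' bS' xK' xL' xR' xS'].
move=> [sa sc sk] [sa' sc' sk'] uK uL uR uS.
have iK := @resolution_pi_iso V _ _ (mK u) idfun uK uK bK bK' xK xK'.
have iL := @resolution_pi_iso V _ _ (mL u) idfun uL uL bL bL' xL xL'.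
have iR := @resolution_pi_iso V _ _ (mR u) idfun uR uR bR bR' xR xR'.
have iS := @resolution_pi_iso V _ _ (mS u) idfun uS uS bS bS' xS xS'.
have ia m : pi_inj (ker_alpha_map V u) m /\ pi_surj (ker_alpha_map V u) m.
  split; [apply: sker_pi_inj|apply: sker_pi_surj] => // k; apply iK || apply iL.
have ic m : pi_inj (ker_gamma_map V u) m /\ pi_surj (ker_gamma_map V u) m.
  split; [apply: sker_pi_inj|apply: sker_pi_surj] => // k; apply iR || apply iS.
apply: homotopy_phom_bij; [apply: sker_pi_inj|apply: sker_pi_surj] => // k;
  apply ia || apply ic.
Qed.

Section ResolutionSquare.
Variables (V : laws) (T : triple) (B : baer_square V T).

Definition res_asq : asquare T.
Proof.
apply: (@ASquare T B (res_aug (resK B)) (res_aug (resL B)) (res_aug (resR B))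
  (res_aug (resS B))); try exact: res_augP.
- by move=> x; rewrite [RHS]hom_compE -homotopy_hom_pi0 aug_alpha.
- by move=> x; rewrite [RHS]hom_compE -homotopy_hom_pi0 aug_beta.
- by move=> x; rewrite [RHS]hom_compE -homotopy_hom_pi0 aug_gamma.
- by move=> x; rewrite [RHS]hom_compE -homotopy_hom_pi0 aug_delta.
Defined.

Lemma res_bases_exact : bases_exact res_asq.
Proof.
by split; [exact: res_bases (resK B)|exact: res_bases (resL B)|exact: res_bases (resR B)|
  exact: res_bases (resS B)|exact: (res_exact (r := resK B))|exact: (res_exact (r :=
    resL B))|
  exact: (res_exact (r := resR B))|exact: (res_exact (r := resS B))].
Qed.

Lemma res_vsurjective : vsurjective res_asq V.
Proof. by split; [apply: surj_alpha|apply: surj_gamma|apply: surj_ker_alpha]. Qed.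

End ResolutionSquare.

Lemma lifts_aug (G G' : groupType) (K K' : sgroup) (r : resolution G K)
    (r' : resolution G' K') (h : shom K K') (g : {hom G -> G'}) :
  (forall x, aug r' (homotopy_hom h 0 x) = g (aug r x)) ->
  forall x, g (res_aug r x) = res_aug r' (h 0 x).
Proof. by move=> e x; rewrite [RHS]hom_compE -homotopy_hom_pi0 e. Qed.

Section AMapOfSquareHom.
Variables (T T' : triple) (Q : asquare T) (P : asquare T') (f : triple_hom T T').
Variable u : square_hom Q P.
Hypothesis fK : forall x, f (eK Q x) = eK P (homK u 0 x).
Hypothesis fL : forall x, quotient_hom (thomN f) (eL Q x) = eL P (homL u 0 x).
Hypothesis fR : forall x, quotient_hom (thomM f) (eR Q x) = eR P (homR u 0 x).
Hypothesis fS : forall x, quotient_hom (thomMN f) (eS Q x) = eS P (homS u 0 x).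

Definition amap_of_square_hom : amap Q P.
Proof.
apply: (@AMap _ _ Q P
  (@ahom_of_shom (qK Q) (qK P) (homK u) _ fK) (@ahom_of_shom (qL Q) (qL P) (homL u) _ fL)
  (@ahom_of_shom (qR Q) (qR P) (homR u) _ fR) (@ahom_of_shom (qS Q) (qS P) (homS u) _
    fS)).
- by case=> [|n] x; [apply/esym/quotient_homE|apply: hom_alpha].
- by case=> [|n] x; [apply/esym/quotient_homE|apply: hom_beta].
- by case=> [|n] x; [apply: projM_MN_nat|apply: hom_gamma].
- by case=> [|n] x; [apply: projN_MN_nat|apply: hom_delta].
Defined.

Lemma amap_of_square_hom_over : over f amap_of_square_hom.
Proof. by split. Qed.

Lemma bmap_of_square_hom V n x : bmap V amap_of_square_hom n x =
  homotopy_hom (total_ker_hom (vquot_square_hom V u)) n x.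
Proof.
have [y ->] := coset_surj x; rewrite [LHS]quotient_homE [RHS]quotient_homE.
by congr (coset _ _); apply: val_inj; apply: tval_inj.
Qed.

End AMapOfSquareHom.

Lemma lifts_amap (V : laws) (T T' : triple) (f : triple_hom T T')
    (Q : baer_square V T) (P : baer_square V T') (u : square_hom Q P) : lifts f u ->
  exists w : amap (res_asq Q) (res_asq P),
    over f w /\ forall x, bmap V w 1 x = baer_hom u x.
Proof.
move=> [fK fL fR fS].
exists (@amap_of_square_hom T T' (res_asq Q) (res_asq P) f u (lifts_aug fK)
  (lifts_aug fL) (lifts_aug fR) (lifts_aug fS)).
split; first exact: amap_of_square_hom_over.
move=> x; exact: bmap_of_square_hom.
Qed.

Lemma quotient_proj_surj (G : groupType) (N : normal_subgroup G) y :
  exists x, quotient_proj N x = y.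
Proof. by have [x ->] := coset_surj y; exists x. Qed.

Lemma projN_MN_surj (T : triple) y : exists x, projN_MN T x = y.
Proof. by have [x ->] := coset_surj y; exists (coset _ x); rewrite projN_MNE. Qed.

Lemma projM_MN_surj (T : triple) y : exists x, projM_MN T x = y.
Proof. by have [x ->] := coset_surj y; exists (coset _ x); rewrite projM_MNE. Qed.

Lemma proj_MN_square (T : triple) x :
  projN_MN T (quotient_proj (tN T) x) = projM_MN T (quotient_proj (tM T) x).
Proof. by rewrite [LHS]projN_MNE [RHS]projM_MNE. Qed.

Lemma proj_MN_pullback (T : triple) y z : projN_MN T y = projM_MN T z ->
  exists x, quotient_proj (tN T) x = y /\ quotient_proj (tM T) x = z.
Proof.
have [a ->] := coset_surj y; have [b ->] := coset_surj z.
rewrite projN_MNE projM_MNE => /cosetP[m [n [Mm Nn e]]].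
have eb : b = a * m * n by rewrite -mulgA -e mulgA mulgV mul1g.
(* From a^-1 b = mn: the element an agrees with a modulo N, and (an)^-1 b is the conjugate of m by
   n, which lies in M. *)
exists (a * n); split; apply/cosetP; rewrite invgM.
  by rewrite -mulgA mulVg mulg1; apply: subgroupV.
by rewrite eb !mulgA mulgVK -mulgA; apply: normal_subgroupJ.
Qed.

(** * The bar square of a triple *)

Section BarSquare.
Variable T : triple.

Definition bar_square : square.
Proof.
apply: (@Square _ _ _ _ (bar_shom (quotient_proj (tN T))) (bar_shom (quotient_proj (tM
  T)))
  (bar_shom (projM_MN T)) (bar_shom (projN_MN T))) => n x.
by apply: bar_map_square => y; rewrite proj_MN_square.
Defined.

Definition bar_asq : asquare T.
Proof.
by apply: (@ASquare T bar_square (bar_face _ 0 0) (bar_face _ 0 0) (bar_face _ 0 0)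
  (bar_face _ 0 0)); try exact: bar_augP; apply: (@bar_map_face _ _ _ 0 0).
Defined.

Lemma bar_bases_exact : bases_exact bar_asq.
Proof. by split; (exact: bar_bases || exact: bar_exact_asg). Qed.

Lemma bar_ahom_surj (G H : groupType) (f : {hom G -> H}) :
  (forall y, exists x, f x = y) -> forall n y, exists x, bar_ahom f n x = y.
Proof. by move=> fs [|n]; [apply: fs|apply: bar_map_surj]. Qed.

(** Filling reduces to surjectivity onto S, or onto the pullback for the corner K. This holds for
    the groups of the triple and passes to every degree of the bar construction. *)
Lemma bar_fibrant : fibrant bar_asq.
Proof.
split; first exact: bar_exact_asg.
- apply: (@bar_relative_filling _ unit (fun _ => qS bar_asq) (fun _ => qd bar_asq)).
    by move=> _; apply: bar_ahom_natural.
  move=> n z _; have [x xz] := bar_ahom_surj (@projN_MN_surj T) (z tt).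
  by exists x => -[].
- apply: (@bar_relative_filling _ unit (fun _ => qS bar_asq) (fun _ => qc bar_asq)).
    by move=> _; apply: bar_ahom_natural.
  move=> n z _; have [x xz] := bar_ahom_surj (@projM_MN_surj T) (z tt).
  by exists x => -[].
apply: (@bar_relative_filling _ bool (corner bar_asq) (to_corner bar_asq)).
  by case; apply: bar_ahom_natural.
move=> n z vz.
suff [x [xa xb]] : exists x, qa bar_asq n x = z true /\ qb bar_asq n x = z false.
  by exists x; case.
case: n z vz => [|n] z vz; first exact: proj_MN_pullback vz.
apply: (bar_pullback (n := n.+1) _ _ _ _ _ vz).
- exact: quotient_proj_surj.
- exact: quotient_proj_surj.
- exact: projM_MN_surj.
- exact: proj_MN_square.
- exact: proj_MN_pullback.
Qed.

Lemma verbal_surj V (G H : groupType) (f : {hom G -> H}) : (forall y, exists x,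
  f x = y) ->
  forall y, verbal V H y -> exists x, verbal V G x /\ f x = y.
Proof.
move=> fs y Vy; pose S y := exists x, verbal V G x /\ f x = y.
have S1 : S 1 by exists 1; split; [apply: subgroup1|apply: gmulf1].
have SM a b : S a -> S b -> S (a * b).
  move=> [x [Vx <-]] [x' [Vx' <-]]; exists (x * x').
  by split; [apply: subgroupM|apply: gmulfM].
have SV a : S a -> S a^-1.
  by move=> [x [Vx <-]]; exists x^-1; split; [apply: subgroupV|apply: gmulfV].
apply: (Vy (Subgroup S1 SM SV)) => w e Vw /=.
have /choice[s sE] k : exists x, f x = e k by [].
exists (word_eval s w); split; first by move=> A; apply.
by rewrite word_eval_hom; congr (word_eval _ w); apply/funext => k /=.
Qed.

Lemma vquot_hom_surj V (K L : sgroup) (f : shom K L) :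
  degreewise_surjective f -> degreewise_surjective (vquot_hom V f).
Proof.
move=> fs n y; have [z ->] := coset_surj y; have [x <-] := fs n z.
by exists (coset _ x); apply: vquot_homE.
Qed.

(** For the map between kernels, take a representative r in R whose image in S is verbal and lift
    that image to a verbal v. Then r v^-1 is in the kernel of gamma itself, and surjectivity onto
    the pullback provides k with trivial image in L. *)
Lemma bar_vsurjective V : vsurjective bar_asq V.
Proof.
have sN n := bar_map_surj (@quotient_proj_surj _ (tN T)) (n := n).
have sM n := bar_map_surj (@quotient_proj_surj _ (tM T)) (n := n).
have sc n := bar_map_surj (@projM_MN_surj T) (n := n).
split; try by apply: vquot_hom_surj => n y; [apply: sN || apply: sc].
move=> n z; have [r er] := coset_surj (subgroup_val z : vquot V _ n).
have Vr : verbal V (sqS bar_square n) (gamma bar_square n r).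
  apply/coset_eq1; rewrite -[LHS](vquot_homE V (gamma bar_square)) -er.
  exact: subgroup_typeP z.
have [v [Vv ev]] := verbal_surj (@sc n.+1) Vr.
have [k [ka kb]] : exists k, alpha bar_square n k = 1 /\ beta bar_square n k = r * v^-1.
  apply: (bar_pullback (n := n.+1) (@quotient_proj_surj _ _) (@quotient_proj_surj _ _)
    (@projM_MN_surj T) (@proj_MN_square T) (@proj_MN_pullback T)).
  by rewrite [LHS]gmulf1 gmulfM gmulfV ev [X in X * _]/= mulgV.
have ak : ker (alpha (vquot_square V bar_square) n) (coset _ k).
  by apply: etrans (vquot_homE V (alpha bar_square) k) _; rewrite ka;
    apply/coset_eq1/subgroup1.
exists (in_subgroup ak); apply: val_inj.
apply: etrans (vquot_homE V (beta bar_square) k) _; rewrite kb.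
apply: etrans _ (esym er); by apply/cosetP; rewrite invgM invgK mulgVK.
Qed.

End BarSquare.

Section BarFunctor.
Variables (T T' : triple) (f : triple_hom T T').

Definition bar_square_hom : square_hom (bar_square T) (bar_square T').
Proof.
apply: (@SquareHom (bar_square T) (bar_square T') (bar_shom f)
  (bar_shom (quotient_hom (thomN f))) (bar_shom (quotient_hom (thomM f)))
  (bar_shom (quotient_hom (thomMN f)))) => n x; apply: bar_map_square => y.
- by rewrite [RHS]quotient_homE.
- by rewrite [RHS]quotient_homE.
- exact: projM_MN_nat.
- exact: projN_MN_nat.
Defined.

Definition bar_amap : amap (bar_asq T) (bar_asq T') :=
  @amap_of_square_hom _ _ (bar_asq T) (bar_asq T') f bar_square_hom
    (@bar_map_face _ _ _ 0 0) (@bar_map_face _ _ _ 0 0) (@bar_map_face _ _ _ 0 0)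
    (@bar_map_face _ _ _ 0 0).

Lemma bar_amap_over : over f bar_amap.
Proof. exact: amap_of_square_hom_over. Qed.

End BarFunctor.

(** * Comparison of a Baer square with the bar square *)

Section Comparison.
Variable V : laws.

Lemma triple_id_over (T : triple) (Q : asquare T) (P : asquare T) (u : amap Q P) :
  over (triple_id T) u -> [/\ forall x, mK u 0 x = x, forall x, mL u 0 x = x,
    forall x, mR u 0 x = x & forall x, mS u 0 x = x].
Proof.
move=> [uK uL uR uS]; split=> [x|x|x|x]; rewrite ?uK ?uL ?uR ?uS //;
  by have [y ->] := coset_surj x; rewrite quotient_homE.
Qed.

Section OneTriple.
Variables (T : triple) (B : baer_square V T).

Lemma comparison_ex : exists u : amap (res_asq B) (bar_asq T), over (triple_id T) u.
Proof.
have [bK bL bR bS _ _ _ _] := res_bases_exact B.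
by apply: amap_lift => //; apply: bar_fibrant.
Qed.

Definition comparison : amap (res_asq B) (bar_asq T) := projT1 (cid comparison_ex).

Lemma comparison_over : over (triple_id T) comparison.
Proof. exact: projT2 (cid comparison_ex). Qed.

Definition theta : {hom baer_group B -> bgroup (bar_asq T) V 1} := bmap V comparison 1.

Lemma theta_bij : bijective theta.
Proof.
have [uK uL uR uS] := triple_id_over comparison_over.
suff H : bijective (bmap V comparison 1) by exact H.
apply: bmap_bij => //; first exact: res_bases_exact.
- exact: bar_bases_exact.
- exact: res_vsurjective.
exact: bar_vsurjective.
Qed.

End OneTriple.

(** Uniqueness is used twice: over the identity it lets the comparison of P pass through P' by w;
    over f it identifies the comparison of P' after u with the bar map after the comparison of Q. *)
Lemma theta_natural (T T' : triple) (f : triple_hom T T') (Q : baer_square V T)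
    (P : baer_square V T') (phi : {hom baer_group Q -> baer_group P}) :
  induced f phi -> forall x, theta P (phi x) = bmap V (bar_amap f) 1 (theta Q x).
Proof.
move=> [P' [u [w [/lifts_amap[u' [u'f u'E]] /lifts_amap[w' [w'f w'E]] uw]]]] x.
have [cK cL cR cS] := triple_id_over (comparison_over P).
have [cK' cL' cR' cS'] := triple_id_over (comparison_over P').
have [dK dL dR dS] := triple_id_over (comparison_over Q).
have [wK wL wR wS] := triple_id_over w'f.
have [uK uL uR uS] := u'f.
have [fK fL fR fS] := bar_amap_over f.
have [bK bL bR bS _ _ _ _] := res_bases_exact P.
have [bK' bL' bR' bS' _ _ _ _] := res_bases_exact Q.
have -> : theta P (phi x) = bmap V (amap_comp (comparison P') w') 1 (phi x).
  apply: bmap_unique => //; first exact: bar_fibrant.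
  - by move=> y; rewrite [RHS]hom_compE cK cK' wK.
  - by move=> y; rewrite [RHS]hom_compE cL cL' wL.
  - by move=> y; rewrite [RHS]hom_compE cR cR' wR.
  - by move=> y; rewrite [RHS]hom_compE cS cS' wS.
rewrite bmap_comp w'E uw -u'E -bmap_comp /theta -bmap_comp.
apply: bmap_unique => //; first exact: bar_fibrant.
- by move=> y; rewrite [LHS]hom_compE [RHS]hom_compE cK' uK fK dK.
- by move=> y; rewrite [LHS]hom_compE [RHS]hom_compE cL' uL fL dL.
- by move=> y; rewrite [LHS]hom_compE [RHS]hom_compE cR' uR fR dR.
- by move=> y; rewrite [LHS]hom_compE [RHS]hom_compE cS' uS fS dS.
Qed.

End Comparison.

(** * Directed colimits *)

Import Order.Theory.

Section Colimits.
Variables (d : Order.disp_t) (I : directed_set d).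

(** An elementwise criterion, chosen because it can be verified for free groups, quotients and total
    kernels in turn. *)
Record is_colim (A : gsystem I) (L : groupType) (c : forall i, {hom A i -> L}) : Prop :=
  IsColim {
  colim_map : forall i j (ij : (i <= j)%O) x, c j (gs_map A ij x) = c i x;
  colim_surj : forall y, exists i x, c i x = y;
  colim_inj : forall i x, c i x = 1 -> exists j (ij : (i <= j)%O), gs_map A ij x = 1
}.

Lemma dlim_colim (A : gsystem I) : is_colim (dlim_in A).
Proof.
split=> [i j ij x|y|i x x1]; first exact: dlim_class_map.
  by have [i [x ->]] := dlim_surj y; exists i, x.
have /dlim_classP[k [ik [ik' e]]] : dlim_in A i x = dlim_in A i 1 by rewrite x1 gmulf1.
by exists k, ik; rewrite e gmulf1.
Qed.

Section OneColimit.
Variables (A : gsystem I) (L : groupType) (c : forall i, {hom A i -> L}).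
Hypothesis cL : is_colim c.

Lemma colim_eq i j (x : A i) (y : A j) : c i x = c j y ->
  exists k (ik : (i <= k)%O) (jk : (j <= k)%O), gs_map A ik x = gs_map A jk y.
Proof.
move=> e; have il := bound_l i j; have jl := bound_r i j.
have [|k [lk xy]] := colim_inj cL (x := gs_map A il x * (gs_map A jl y)^-1).
  by apply: hom_div1; rewrite !(colim_map cL).
exists k, (le_trans il lk), (le_trans jl lk).
rewrite (gs_map_comp il lk) (gs_map_comp jl lk).
by apply/divg1_eq; rewrite -gmulfV -gmulfM.
Qed.

Lemma colim_surj_above i y : exists j (ij : (i <= j)%O) x, c j x = y.
Proof.
have [j [x <-]] := colim_surj cL y.
by exists (bound i j), (bound_l i j), (gs_map A (bound_r i j) x); rewrite (colim_map cL).
Qed.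

Lemma colim_subgroup (S : forall i, A i -> Prop) :
  (forall i, S i 1) -> (forall i x y, S i x -> S i y -> S i (x * y)) ->
  (forall i x, S i x -> S i x^-1) ->
  (forall i j (ij : (i <= j)%O) x, S i x -> S j (gs_map A ij x)) ->
  exists S' : subgroup L, forall y, S' y <-> exists i x, S i x /\ c i x = y.
Proof.
move=> S1 SM SV Smap; pose P y := exists i x, S i x /\ c i x = y.
have P1 : P 1 by exists (dset_point I), 1; split; [apply: S1|apply: gmulf1].
have PM a b : P a -> P b -> P (a * b).
  move=> [i [x [Sx <-]]] [j [y [Sy <-]]].
  exists (bound i j), (gs_map A (bound_l i j) x * gs_map A (bound_r i j) y).
  by split; [apply: SM; apply: Smap|rewrite gmulfM !(colim_map cL)].
have PV a : P a -> P a^-1.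
  by move=> [i [x [Sx <-]]]; exists i, x^-1; split; [apply: SV|apply: gmulfV].
by exists (Subgroup P1 PM PV) => y; split.
Qed.

(** An assignment of infinitely many letters need not lift to one stage; the first m letters do, and
    a word reads only finitely many. *)
Lemma colim_word (e : nat -> L) m : exists i (e' : nat -> A i), forall k, k < m ->
  c i (e' k) = e k.
Proof.
elim: m => [|m [i [e' IH]]]; first by exists (dset_point I), (fun=> 1).
have [j [ij [x xm]]] := colim_surj_above i (e m).
exists j, (fun k => if k == m then x else gs_map A ij (e' k)) => k.
rewrite ltnS leq_eqVlt => /orP[/eqP->|km]; first by rewrite eqxx.
by rewrite ltn_eqF // (colim_map cL) // IH.
Qed.

Lemma word_eval_eq (G : groupType) (e e' : nat -> G) (w : word) m :
  (forall k, k < m -> e k = e' k) -> all (fun l => l.1 < m) w ->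
  word_eval e w = word_eval e' w.
Proof.
move=> ee'; elim: w => [|l w IH] /=; first by rewrite /word_eval !big_nil.
by move=> /andP[lm /IH]; rewrite /word_eval !big_cons => ->; rewrite ee'.
Qed.

(** The images of the verbal subgroups of the stages form a subgroup containing all values of the
    laws, hence all of the verbal subgroup of L. An equality in L already holds at some stage. *)
Lemma verbal_colim V i (x : A i) : verbal V L (c i x) ->
  exists j (ij : (i <= j)%O), verbal V (A j) (gs_map A ij x).
Proof.
have [S SE] : exists S : subgroup L, forall y, S y <-> exists i x,
  verbal V (A i) x /\ c i x = y.
  apply: colim_subgroup => [j|j a b|j a|j k jk a]; [exact: subgroup1|exact: subgroupM|
    exact: subgroupV|exact: verbal_hom].
move=> Vx; have /SE[j [y [Vy eyx]]] : S (c i x).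
  apply: Vx => w e Vw; apply/SE; pose m := \max_(l <- w) l.1.+1.
  have wm : all (fun l => l.1 < m) w.
    by apply/allP => l lw; rewrite /m (big_rem l) //= leq_max leqnn.
  have [j [e' ee']] := colim_word e m.
  exists j, (word_eval e' w); split; first by move=> B; apply.
  by rewrite word_eval_hom; apply: word_eval_eq wm => k /ee'.
have [k [jk [ik e]]] := colim_eq eyx.
by exists k, ik; rewrite -e; apply: verbal_hom.
Qed.

Definition free_system : gsystem I.
Proof.
apply: (@GSystem d I (fun i => free_group (A i)) (fun i j ij => free_map (gs_map A ij))).
- move=> i ii x; rewrite -[RHS]free_map_id; apply: free_map_eq => y; exact: gs_map_id.
- move=> i j k ij jk ik x; rewrite free_map_comp; apply: free_map_eq => y;
  exact: gs_map_comp.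
Defined.

Lemma free_colim : @is_colim free_system (free_group L) (fun i => free_map (c i)).
Proof.
split=> [i j ij x|y|i x].
- by rewrite [LHS]free_map_comp; apply: free_map_eq => y /=; rewrite (colim_map cL).
- pose P y := exists i (x : free_group (A i)), free_map (c i) x = y.
  have P1 : P 1 by exists (dset_point I), 1; apply: gmulf1.
  have PM a b : P a -> P b -> P (a * b).
    move=> [i [u <-]] [j [v <-]].
    exists (bound i j), (free_map (gs_map A (bound_l i j)) u * free_map (gs_map A
      (bound_r i j)) v).
    by rewrite gmulfM !free_map_comp; congr (_ * _); apply: free_map_eq => z /=;
      rewrite (colim_map cL).
  have PV a : P a -> P a^-1.
    by move=> [i [u <-]]; exists i, u^-1; apply: gmulfV.
  apply: (basis_ind (@free_basis L) (S := Subgroup P1 PM PV)) => _ [a ->] /=.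
  have [i [u <-]] := colim_surj cL a.
  by exists i, (free_gen u); rewrite free_map_gen.
(* Injectivity without normal forms: chosen lifts of the generators define [h] from the free group
   on L to the direct limit of the free groups, and [h] after [free_map (c i)] is the canonical map.
   So whatever [free_map (c i)] kills is trivial in that limit. *)
have /choice[s sE] a : exists s : dlim_elt A, c (tag s) (tagged s) = a.
  by have [j [u ua]] := colim_surj cL a; exists (existT _ j u).
pose h := free_lift (fun a => dlim_class (free_gen (tagged (s a)) : free_system (tag (s
  a)))).
have hE : hom_comp h (free_map (c i)) =1 dlim_in free_system i.
  apply: free_hom_ext => u; rewrite hom_compE free_map_gen [LHS]free_lift_gen.
  apply/dlim_classP; have [k [jk [ik e]]] := colim_eq (sE (c i u)).
  by exists k, jk, ik; rewrite [LHS]free_map_gen [RHS]free_map_gen e.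
move=> x1; apply: (colim_inj (dlim_colim free_system)).
by rewrite -hE hom_compE x1 gmulf1.
Qed.

End OneColimit.

Definition bar_system (A : gsystem I) (n : nat) : gsystem I.
Proof.
apply: (@GSystem d I (fun i => bar (A i) n) (fun i j ij => bar_map (gs_map A ij) n)).
- move=> i ii x; apply: bar_map_id => y; exact: gs_map_id.
- move=> i j k ij jk ik x; apply: bar_map_comp => y; exact: gs_map_comp.
Defined.

Lemma bar_colim (A : gsystem I) (L : groupType) (c : forall i, {hom A i -> L}) n :
  is_colim c -> @is_colim (bar_system A n) (bar L n) (fun i => bar_map (c i) n).
Proof.
by move=> cL; elim: n => [|n /free_colim[m s i]]; [case: cL => m s i; split|split].
Qed.

Section QuotientColimit.
Variables (A : gsystem I) (L : groupType) (c : forall i, {hom A i -> L}).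
Variables (N : forall i, normal_subgroup (A i)) (N' : normal_subgroup L).
Hypothesis N_map : forall i j (ij : (i <= j)%O) x, N i x -> N j (gs_map A ij x).
Hypothesis N_cone : forall i x, N i x -> N' (c i x).

Definition quotient_system : gsystem I.
Proof.
apply: (@GSystem d I (fun i => quotient (N i)) (fun i j ij =>
  quotient_hom (@N_map i j ij))).
- by move=> i ii x; have [y ->] := coset_surj x; rewrite quotient_homE gs_map_id.
- move=> i j k ij jk ik x; have [y ->] := coset_surj x.
  rewrite quotient_homE [X in quotient_hom _ X]quotient_homE quotient_homE.
  by rewrite (gs_map_comp ij jk ik).
Defined.

Lemma quotient_colim : is_colim c ->
  (forall i x, N' (c i x) -> exists j (ij : (i <= j)%O), N j (gs_map A ij x)) ->
  @is_colim quotient_system (quotient N') (fun i => quotient_hom (@N_cone i)).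
Proof.
move=> cL N'N; split=> [i j ij x|y|i x].
- by have [y ->] := coset_surj x; rewrite [X in quotient_hom _ X]quotient_homE
  !quotient_homE (colim_map cL).
- have [z ->] := coset_surj y; have [i [x <-]] := colim_surj cL z.
  by exists i, (coset _ x); rewrite quotient_homE.
have [y ->] := coset_surj x; rewrite quotient_homE => /coset_eq1/N'N[j [ij Ny]].
by exists j, ij; rewrite [LHS]quotient_homE; apply/coset_eq1.
Qed.

End QuotientColimit.

Lemma dlim_normal_in (A : gsystem I) (N : forall i, normal_subgroup (A i))
    (N_map : forall i j (ij : (i <= j)%O) x, N i x -> N j (gs_map A ij x)) i x :
  N i x -> dlim_normal N_map (dlim_in A i x).
Proof.
move=> Nx; exists (dlim_class (in_subgroup Nx : subsystem N_map i)).
exact: dlim_sub_inclE.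
Qed.

Lemma dlim_normal_ev (A : gsystem I) (N : forall i, normal_subgroup (A i))
    (N_map : forall i j (ij : (i <= j)%O) x, N i x -> N j (gs_map A ij x)) i x :
  dlim_normal N_map (dlim_in A i x) -> exists j (ij : (i <= j)%O), N j (gs_map A ij x).
Proof.
move=> [y]; have [j [z ->]] := dlim_surj y; rewrite dlim_sub_inclE.
move=> /dlim_classP[k [jk [ik e]]]; exists k, ik; rewrite -e.
exact/N_map/subgroup_typeP.
Qed.

End Colimits.

(** * Passage to the limit *)

Section Eventually.
Variables (d : Order.disp_t) (I : directed_set d) (i : I).

(** Persistence at all later stages is built in, so that finitely many such conditions hold at a
    common stage. *)
Definition eventually (P : forall j, (i <= j)%O -> Prop) :=
  exists j, (i <= j)%O /\ forall k (ik : (i <= k)%O), (j <= k)%O -> P k ik.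

Lemma eventually_and (P Q : forall j, (i <= j)%O -> Prop) :
  eventually P -> eventually Q -> eventually (fun j ij => P j ij /\ Q j ij).
Proof.
move=> [j [ij Pj]] [k [ik Qk]]; exists (bound j k).
split=> [|l il jl]; first exact: le_trans ij (bound_l j k).
by split; [apply: Pj; apply: le_trans jl; apply: bound_l|
  apply: Qk; apply: le_trans jl; apply: bound_r].
Qed.

Lemma eventually_all m (P : nat -> forall j, (i <= j)%O -> Prop) :
  (forall r, r < m -> eventually (P r)) ->
  eventually (fun j ij => forall r, r < m -> P r j ij).
Proof.
elim: m => [|m IH] evP; first by exists i; split.
have [|j [ij Pj]] := eventually_and (IH _) (evP m (ltnSn m)).
  by move=> r rm; apply: evP; apply: leqW.
exists j; split=> // k ik jk r; have [Pr Pm] := Pj k ik jk.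
by rewrite ltnS leq_eqVlt => /orP[/eqP->|/Pr].
Qed.

Lemma eventually_ex (P : forall j, (i <= j)%O -> Prop) :
  eventually P -> exists j (ij : (i <= j)%O), P j ij.
Proof. by move=> [j [ij Pj]]; exists j, ij; apply: Pj. Qed.

End Eventually.

Lemma eventually_verbal (d : Order.disp_t) (I : directed_set d) V (A : gsystem I)
    (L : groupType) (c : forall i, {hom A i -> L}) i (x : A i) : is_colim c ->
  verbal V L (c i x) -> eventually (fun j ij => verbal V (A j) (gs_map A (i := i) ij x)).
Proof.
move=> cL /(verbal_colim cL)[j [ij Vx]]; exists j; split=> // k ik jk.
by rewrite (gs_map_comp ij jk ik); apply: verbal_hom.
Qed.

(** * Total kernels of bar squares and directed colimits *)

Section TripleLimit.
Variables (V : laws) (d : Order.disp_t) (I : directed_set d) (T : tsystem I).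

Let A := tsystem_group T.
Let AN := @quotient_system d I A (fun i => tN (T i)) (fun i j ij => thomN (ts_map T ij)).
Let AM := @quotient_system d I A (fun i => tM (T i)) (fun i j ij => thomM (ts_map T ij)).

Definition triple_in i : triple_hom (T i) (triple_lim T) :=
  @TripleHom (T i) (triple_lim T) (dlim_in A i)
    (@dlim_normal_in _ _ A (fun i => tM (T i)) (fun i j ij => thomM (ts_map T ij)) i)
    (@dlim_normal_in _ _ A (fun i => tN (T i)) (fun i j ij => thomN (ts_map T ij)) i).

Lemma group_colim : @is_colim d I A (tG (triple_lim T)) (fun i => triple_in i).
Proof. exact: dlim_colim. Qed.

Lemma quotientN_colim : @is_colim d I AN (quotient (tN (triple_lim T)))
  (fun i => quotient_hom (thomN (triple_in i))).
Proof. by apply: quotient_colim; [apply: dlim_colim|move=> i x;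
  apply: dlim_normal_ev]. Qed.

Lemma quotientM_colim : @is_colim d I AM (quotient (tM (triple_lim T)))
  (fun i => quotient_hom (thomM (triple_in i))).
Proof. by apply: quotient_colim; [apply: dlim_colim|move=> i x;
  apply: dlim_normal_ev]. Qed.

Lemma proj_natural (S S' : triple) (f : triple_hom S S') n (x : bar (tG S) n) :
  bar_map (quotient_proj (tN S')) n (bar_map f n x) =
  bar_map (quotient_hom (thomN f)) n (bar_map (quotient_proj (tN S)) n x) /\
  bar_map (quotient_proj (tM S')) n (bar_map f n x) =
  bar_map (quotient_hom (thomM f)) n (bar_map (quotient_proj (tM S)) n x).
Proof. by split; apply: bar_map_square => y; rewrite [RHS]quotient_homE. Qed.

Section Eventual.
Variables (n : nat) (i : I) (x : bar (tG (T i)) n).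

Definition shift j (ij : (i <= j)%O) : bar (tG (T j)) n := bar_map (ts_map T ij) n x.

Lemma shift_verbal : verbal V (bar (tG (triple_lim T)) n) (bar_map (triple_in i) n x) ->
  eventually (fun j ij => verbal V (bar (tG (T j)) n) (@shift j ij)).
Proof. exact: (eventually_verbal (bar_colim n group_colim)). Qed.

Lemma shift_verbalN :
  verbal V (bar (quotient (tN (triple_lim T))) n)
    (bar_map (quotient_proj _) n (bar_map (triple_in i) n x)) ->
  eventually (fun j ij => verbal V (bar (quotient (tN (T j))) n)
    (bar_map (quotient_proj _) n (@shift j ij))).
Proof.
have [-> _] := proj_natural (triple_in i) x.
move=> /(eventually_verbal (bar_colim n quotientN_colim))[j [ij Vj]].
exists j; split=> // k ik jk; have [-> _] := proj_natural (ts_map T ik) x.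
exact: Vj.
Qed.

Lemma shift_verbalM :
  verbal V (bar (quotient (tM (triple_lim T))) n)
    (bar_map (quotient_proj _) n (bar_map (triple_in i) n x)) ->
  eventually (fun j ij => verbal V (bar (quotient (tM (T j))) n)
    (bar_map (quotient_proj _) n (@shift j ij))).
Proof.
have [_ ->] := proj_natural (triple_in i) x.
move=> /(eventually_verbal (bar_colim n quotientM_colim))[j [ij Vj]].
exists j; split=> // k ik jk; have [_ ->] := proj_natural (ts_map T ik) x.
exact: Vj.
Qed.

Lemma shift_in j (ij : (i <= j)%O) :
  bar_map (triple_in j) n (shift ij) = bar_map (triple_in i) n x.
Proof. exact: (colim_map (bar_colim n group_colim) ij x). Qed.

End Eventual.

Definition psi m i : {hom bgroup (bar_asq (T i)) V m ->
  bgroup (bar_asq (triple_lim T)) V m} :=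
  bmap V (bar_amap (triple_in i)) m.

Lemma psi_compat m i j (ij : (i <= j)%O) x :
  psi m j (bmap V (bar_amap (ts_map T ij)) m x) = psi m i x.
Proof.
rewrite -bmap_comp; have [bK bL bR bS _ _ _ _] := bar_bases_exact (T i).
have e x' : triple_in j (ts_map T ij x') = triple_in i x' := colim_map group_colim ij x'.
apply: bmap_unique => //; first exact: bar_fibrant.
- exact: (colim_map quotientN_colim ij).
- exact: (colim_map quotientM_colim ij).
move=> y; suff : quotient_hom (thomMN (triple_in j)) (quotient_hom (thomMN (ts_map T
  ij)) y) =
  quotient_hom (thomMN (triple_in i)) y by [].
have [z ->] := coset_surj y.
by rewrite [X in quotient_hom _ X]quotient_homE !quotient_homE e.
Qed.

Lemma tval_bar_total (S S' : triple) (f : triple_hom S S') m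
    (w : total_ker (vquot_square V (bar_asq S)) m) (z : bar (tG S) m.+1) :
  tval w = coset _ z ->
  tval (total_map V (bar_amap f) m w) = coset (verbal V _) (bar_map f m.+1 z).
Proof. by rewrite tval_total_map => ->; apply: vquot_phomE. Qed.

Lemma face_tval (S : triple) m (w : total_ker (vquot_square V (bar_asq S)) m.+1)
    (z : bar (tG S) m.+2) (r : 'I_m.+2) :
  tval w = coset _ z -> tval (face r w) = coset (verbal V _) (bar_face (tG S) m.+1 r z).
Proof. by rewrite tval_face => ->; apply: face_coset. Qed.

(** A class is given by one element, in bar degree m+2 because of the shift, subject to finitely
    many verbal conditions: on its images in the corners L and R and on each of its faces. *)
Lemma psi_surj m y : exists i x, psi m.+1 i x = y.
Proof.
have [w ->] := coset_surj y; pose w0 := subgroup_val w.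
have cw : cycles (total_ker (vquot_square V (bar_asq (triple_lim T)))) m.+1 w0.
  exact: subgroup_typeP w.
have [z ez] := coset_surj (tval w0).
have [i [x xz]] := colim_surj (bar_colim m.+2 group_colim) z.
have := tval_alphaP ez; rewrite -xz => /shift_verbalN evN.
have := tval_betaP ez; rewrite -xz => /shift_verbalM evM.
have : eventually (fun j ij => forall r, r < m.+2 ->
    verbal V (bar (tG (T j)) m.+1) (bar_face _ m.+1 r (shift x ij))).
  apply: eventually_all => r lrm.
  have : verbal V (bar (tG (triple_lim T)) m.+1)
      (bar_map (triple_in i) m.+1 (bar_face _ m.+1 r x)).
    rewrite bar_map_face; apply/coset_eq1; rewrite [bar_map _ _ x]xz.
    by rewrite -(@face_tval _ _ w0 z (Ordinal lrm)) // cw.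
  move=> /shift_verbal[j [ij Vj]]; exists j; split=> // k ik jk.
  by rewrite -bar_map_face; apply: Vj.
move=> /(eventually_and evN)/(eventually_and evM)/eventually_ex[j [ij [VM [VN Vf]]]].
have [v ev] := @total_in_coset V _ (bar_asq (T j)) m.+1 _ VN VM.
have cv : cycles (total_ker (vquot_square V (bar_asq (T j)))) m.+1 v.
  move=> r; apply: tval_eq1; rewrite (face_tval r ev); apply/coset_eq1/Vf.
  exact: ltn_ord.
exists j, (coset _ (in_subgroup cv)); rewrite [LHS]quotient_homE.
congr (coset _ _); apply: val_inj; apply: tval_inj.
rewrite [LHS](tval_bar_total _ ev) shift_in [RHS]ez.
by congr (coset _ _).
Qed.

Lemma psi_inj m i x : psi m i x = 1 ->
  exists j (ij : (i <= j)%O), bmap V (bar_amap (ts_map T ij)) m x = 1.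
Proof.
have [w ->] := coset_surj x; rewrite [psi _ _ _]quotient_homE => /coset_eq1.
move=> [b [b1 bw]]; pose w0 := subgroup_val w.
have [z ez] := coset_surj (tval b); have [u eu] := coset_surj (tval w0).
have [i' [z' zz]] := colim_surj (bar_colim m.+2 group_colim) z.
(* The cycle lives at stage i and the bounding element at stage i'; at k the last face can be
   compared with the cycle, which adds one more verbal condition. *)
pose k := bound i i'; have ik : (i <= k)%O := bound_l i i'.
have ik' : (i' <= k)%O := bound_r i i'.
pose zk := shift z' ik'; pose uk := shift u ik.
have zkz : bar_map (triple_in k) m.+2 zk = z by rewrite shift_in.
have ukw : coset (verbal V _) (bar_map (triple_in k) m.+1 uk) =
    tval (total_map V (bar_amap (triple_in i)) m w0).
  by rewrite shift_in (tval_bar_total _ eu).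
have := tval_alphaP ez; rewrite -zkz => /shift_verbalN evN.
have := tval_betaP ez; rewrite -zkz => /shift_verbalM evM.
have evf : eventually (fun j kj => forall r, r < m.+1 ->
    verbal V (bar (tG (T j)) m.+1) (bar_face _ m.+1 r (shift zk kj))).
  apply: eventually_all => r lrm.
  have : verbal V (bar (tG (triple_lim T)) m.+1)
      (bar_map (triple_in k) m.+1 (bar_face _ m.+1 r zk)).
    rewrite bar_map_face zkz; apply/coset_eq1.
    rewrite -(@face_tval _ _ b z (Ordinal (ltnW lrm : r < m.+2))) //.
    by rewrite b1 //; apply/eqP => /(congr1 val) /= erm; rewrite erm ltnn in lrm.
  move=> /shift_verbal[j [kj Vj]]; exists j; split=> // l kl jl.
  by rewrite -bar_map_face; apply: Vj.
have evl : eventually (fun j kj => verbal V (bar (tG (T j)) m.+1)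
    ((bar_face _ m.+1 m.+1 (shift zk kj))^-1 * shift uk kj)).
  have : verbal V (bar (tG (triple_lim T)) m.+1)
      (bar_map (triple_in k) m.+1 ((bar_face _ m.+1 m.+1 zk)^-1 * uk)).
    rewrite gmulfM gmulfV bar_map_face zkz; apply/cosetP; rewrite ukw.
    by rewrite -(@face_tval _ _ b z ord_max) // bw.
  move=> /shift_verbal[j [kj Vj]]; exists j; split=> // l kl jl.
  by rewrite -bar_map_face -gmulfV -gmulfM; apply: Vj.
have := eventually_and (eventually_and evN evM) (eventually_and evf evl).
move=> /eventually_ex[j [kj [[VN VM] [Vf Vl]]]].
have [v ev] := @total_in_coset V _ (bar_asq (T j)) m.+1 _ VN VM.
exists j, (le_trans ik kj); rewrite [LHS]quotient_homE; apply/coset_eq1.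
exists v; split=> [r nr|].
  apply: tval_eq1; rewrite (face_tval r ev); apply/coset_eq1/Vf.
  by rewrite ltn_neqAle -ltnS ltn_ord andbT; apply: contraNneq nr =>
    /(@ord_inj _ r ord_max) ->.
apply: tval_inj; rewrite (face_tval ord_max ev) [RHS](tval_bar_total _ eu).
rewrite (gs_map_comp (g := bar_system A m.+1) ik kj (le_trans ik kj) u).
exact/cosetP.
Qed.

End TripleLimit.

Lemma isomorphic_sym (G H : groupType) : isomorphic G H -> isomorphic H G.
Proof.
move=> [f [g fK gK]].
have gM : {morph g : x y / x * y} by move=> x y; apply: (can_inj fK); rewrite gmulfM !gK.
by exists (hom_of gM); exists f.
Qed.

Lemma isomorphic_trans (G H K : groupType) :
  isomorphic G H -> isomorphic H K -> isomorphic G K.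
Proof. by move=> [f fb] [g gb]; exists (hom_comp g f); apply: bij_comp gb fb. Qed.

Lemma colim_isomorphic (d : Order.disp_t) (I : directed_set d) (A : gsystem I)
    (L : groupType) (c : forall i, {hom A i -> L}) : is_colim c -> isomorphic (dlim A) L.
Proof.
move=> cL; pose f (x : dlim A) := c _ (dlim_repr x).
have fE i (x : A i) : f (dlim_class x) = c i x.
  have /dlim_classP[k [jk [ik e]]] := dlim_reprK (dlim_class x).
  by rewrite /f -(colim_map cL jk) e (colim_map cL).
have fM : {morph f : x y / x * y}.
  move=> x y; have [i [x' [y' [-> ->]]]] := dlim_surj2 x y.
  by rewrite -dlim_classM !fE gmulfM.
exists (hom_of fM).
have f_inj : injective (hom_of fM).
  apply: gmulf_inj => x; have [i [x' ->]] := dlim_surj x.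
  move=> fx; have [j [ij e]] := colim_inj cL (etrans (esym (fE i x')) fx).
  by rewrite -(dlim_class_map ij) e; apply: dlim_oneE.
have /choice[g gK] y : exists x, hom_of fM x = y.
  by have [i [x <-]] := colim_surj cL y; exists (dlim_class x); apply: fE.
by exists g => // x; apply: f_inj; rewrite gK.
Qed.

Theorem theorem3p5 (V : laws) (VM : baer_invariant V)
  (d : Order.disp_t) (I : directed_set d) (T : tsystem I) :
  isomorphic (VM (triple_lim T)) (dlim (baer_system VM T)).
Proof.
pose S := baer_system VM T.
pose th i : {hom S i -> bgroup (bar_asq (T i)) V 1} := theta (baer_choice VM (T i)).
have th_inj i : injective (th i) := bij_inj (theta_bij _).
have th_map i j (ij : (i <= j)%O) x :
    th j (gs_map S ij x) = bmap V (bar_amap (ts_map T ij)) 1 (th i x).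
  exact: theta_natural (baer_map_induced VM (ts_map T ij)) x.
(* The group computed from the bar square of the limit triple is the bridge: the system of Baer
   invariants has it as colimit, and [theta] of the limit triple identifies it with the other
   side. *)
have cS : @is_colim d I S (bgroup (bar_asq (triple_lim T)) V 1)
    (fun i => hom_comp (psi V T 1 i) (th i)).
  split=> [i j ij x|y|i x].
  - by rewrite !hom_compE th_map psi_compat.
  - have [i [x <-]] := psi_surj y; have [g _ gK] := theta_bij (baer_choice VM (T i)).
    by exists i, (g x); rewrite hom_compE; congr (psi _ _ _ _ _); apply: gK.
  rewrite hom_compE => /psi_inj[j [ij e]]; exists j, ij.
  by apply: (th_inj j); rewrite th_map e gmulf1.
apply: isomorphic_trans (isomorphic_sym (colim_isomorphic cS)).
by exists (theta (baer_choice VM (triple_lim T))); apply: theta_bij.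
Qed.
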